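(* For every $\Delta \in \mathbb{N}$ and every $\gamma > 0$ there exist constants $\beta > 0$ and $n_0 \in \mathbb{N}$ such that the following holds. Let $H$ be a bipartite graph on $n \geq n_0$ vertices with maximum degree $\Delta(H) \leq \Delta$ and bandwidth at most $\beta n$. Let $G$ be a graph on $n$ vertices with degree sequence $d_1 \leq d_2 \leq \dots \leq d_n$. If for every $i < n/2$ we have $$d_i \geq i + \gamma n \quad \text{or} \quad d_{n-i-\gamma n} \geq n - i,$$ then $G$ contains a copy of $H$ (i.e. a subgraph isomorphic to $H$).
   Context: A graph $H$ on $n$ vertices has bandwidth at most $b$ if there is a labelling of its vertices by $1,\dots,n$ such that $|i-j| \leq b$ for every edge $ij$. Floors and ceilings are omitted where they do not affect the argument (e.g. $\gamma n$ is treated as an integer). *)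

(* Defs.v *)
From HB Require Import structures.
From mathcomp Require Import all_boot all_order all_algebra.
From mathcomp Require Import reals.
Set Implicit Arguments. Unset Strict Implicit. Unset Printing Implicit Defensive.
Import Order.TTheory GRing.Theory Num.Theory.
Local Open Scope ring_scope.

Definition simple_graph (n : nat) (G : rel 'I_n) : Prop :=
  (forall u v, G u v = G v u) /\ (forall u, ~~ G u u).

Definition deg (n : nat) (G : rel 'I_n) (v : 'I_n) : nat := #|[set u | G v u]|.

Definition max_deg_le (n : nat) (G : rel 'I_n) (D : nat) : Prop :=
  forall v, (deg G v <= D)%N.

Definition bipartite (n : nat) (G : rel 'I_n) : Prop :=
  exists c : 'I_n -> bool, forall u v, G u v -> c u != c v.

Definition bandwidth_le (R : realType) (n : nat) (G : rel 'I_n) (b : R) : Prop :=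
  exists sigma : 'I_n -> 'I_n, injective sigma /\
    forall u v, G u v -> (`|(sigma u)%:R - (sigma v)%:R| : R) <= b.

(* nondecreasing degree sequence d_1 <= ... <= d_n, accessed 1-indexed *)
Definition deg_seq (n : nat) (G : rel 'I_n) : seq nat :=
  sort leq [seq deg G v | v <- enum 'I_n].

Definition d_ (n : nat) (G : rel 'I_n) (j : nat) : nat := nth 0%N (deg_seq G) j.-1.

Definition gn (R : realType) (gamma : R) (n : nat) : nat := `|Num.ceil (gamma * n%:R)|%N.

(* for every 1 <= i < n/2 :  d_i >= i + gamma n  or  d_{n - i - gamma n} >= n - i
   (the index n-i-gamma n must be a valid index >= 1 for the second alternative) *)
Definition degree_condition (R : realType) (n : nat) (G : rel 'I_n) (gamma : R) : Prop :=
  forall i : nat, (1 <= i)%N -> (2 * i < n)%N ->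
    ((d_ G i)%:R >= i%:R + gamma * n%:R)
    \/ ((i + gn gamma n < n)%N /\ (n - i <= d_ G (n - i - gn gamma n))%N).

Definition contains_copy (n : nat) (G H : rel 'I_n) : Prop :=
  exists phi : 'I_n -> 'I_n, injective phi /\ forall u v, H u v -> G (phi u) (phi v).

(* Main.v *)
Require Import Defs.
From HB Require Import structures.
From mathcomp Require Import all_boot all_order all_algebra.
From mathcomp Require Import boolp reals.
From mathcomp Require Import zify ring lra.
Set Implicit Arguments. Unset Strict Implicit. Unset Printing Implicit Defensive.
Import Order.TTheory GRing.Theory Num.Theory.
Local Open Scope ring_scope.

(* The degree condition makes [G] a robust expander of linear minimum degree. Robust expansion passes
   to the reduced graph of a regularity partition, where it gives permutations along edges (Hall) of
   almost all of the vertices, and walks of a fixed length between almost all pairs of clusters. Cut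
   [H] into blocks along the bandwidth order, send every block to one edge of the reduced graph, and
   let the last few slots of a block follow a walk to the next edge: this is a homomorphism whose
   fibres nearly fill the clusters.

   The blow-up lemma is replaced by an absorbing set: a set [I] of pairwise distant vertices of [H]
   is kept for the end. The neighbourhoods of the vertices of [I] are embedded first, by a
   derandomised choice which makes every vertex of [G] adjacent to the images of the neighbourhoods of
   many [x] in [I], and every set of vertices meet the candidates of almost every [x] whose cluster
   sees it. The rest of [H] is embedded greedily in the bandwidth order, avoiding a reserved set
   [Z], and Hall's theorem matches [I] with the vertices that are left. *)

(** * Hall's theorem *)

(** Clusters have unequal sizes and are never equalised. The reduced graph is pulled back to the
    vertices of [G], so that clusters count by size; a permutation of vertices along its edges
    serves as a fractional perfect matching, and the number of [u] with [(f u, f (g u)) = e] says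
    how much of [H] the edge [e] can carry. The obstacle is the end of the embedding, when the free
    vertices are too few for regularity to control. The candidates of [x] in [I] depend only on the
    images of its neighbours, hence are fixed early and can be tested against every set of vertices.
    There are [2 ^ #|V|] such tests against a set [I] of linear size, so a single [x] may fail a
    single test only with a small constant probability [1 / Lam], where [Lam = 2 ^ e0] depends on
    the proportion of [I]. This dictates the order of the constants: [sigma] comes from [gamma] and
    [Delta] alone, the expansion [nu] from [sigma], then [d], [lam], [kap], [iota_], [eta], [e0],
    and only after these the regularity parameter [dl], the number of clusters, the block length,
    [beta] and [n0]. *)

Definition rel_img (A B : finType) (r : A -> B -> bool) (S : {set A}) : {set B} :=
  [set b | [exists a in S, r a b]].

(** Induction on [#|P|], according to whether some proper nonempty subset of [P] is tight. For empty
    [P] the answer is [g0], since nothing else provides a value in [B]. *)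
Lemma hall (A B : finType) (r : A -> B -> bool) (P : {set A}) (g0 : A -> B) :
  (forall S : {set A}, S \subset P -> (#|S| <= #|rel_img r S|)%N) ->
  exists g : A -> B, {in P &, injective g} /\ {in P, forall a, r a (g a)}.
Proof.
move: {2}#|P|.+1 (ltnSn #|P|) => m; elim: m => // m IH in r P *.
rewrite ltnS => leP hP.
have [->|[a aP]] := set_0Vmem P.
  by exists g0; split=> [x y|x]; rewrite inE.
have rel_imgP (r' : A -> B -> bool) (S : {set A}) (b : B) : reflect (exists2 x, x \in S & r' x b) (b \in rel_img r' S).
  by rewrite inE; apply: (iffP existsP) => [[x /andP[]]|[x xS rx]]; exists x => //; apply/andP.
(* A tight [S] is matched by itself and the rest outside [rel_img r S]. Hall's condition survives
   there: it holds for [T :|: S], and [S] accounts for exactly [#|S|] of the images. *)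
case: (boolP [exists S : {set A}, [&& S \proper P, S != set0 & #|rel_img r S| == #|S|]]).
  case/existsP=> S /and3P[SP S0 /eqP NS].
  have ltS : (#|S| < m)%N by apply: leq_trans leP; apply: proper_card.
  have sSP := proper_sub SP.
  have [g1 [g1i g1r]] := IH r S ltS (fun T TS => hP T (subset_trans TS sSP)).
  pose r' x y := r x y && (y \notin rel_img r S).
  have ltD : (#|P :\: S| < m)%N.
    apply: leq_trans leP; rewrite cardsD (setIidPr sSP).
    have : (0 < #|S|)%N by rewrite card_gt0.
    have := subset_leq_card sSP; lia.
  have [T TD|g2 [g2i g2r]] := IH r' (P :\: S) ltD.
    have TP : T \subset P by apply: subset_trans TD (subsetDl _ _).
    have dTS : [disjoint T & S].
      by apply/pred0P=> x /=; apply/negP=> /andP[/(subsetP TD)]; rewrite inE => /andP[/negbTE->].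
    have := hP (T :|: S); rewrite subUset TP sSP => /(_ isT).
    rewrite cardsU (disjoint_setI0 dTS) cards0 subn0.
    have sub : rel_img r (T :|: S) \subset rel_img r' T :|: rel_img r S.
      apply/subsetP=> b /rel_imgP[x]; rewrite !in_setU.
      case: (boolP (b \in rel_img r S)) => [|bn]; first by rewrite orbT.
      case/orP=> xT rx; first by rewrite orbF; apply/rel_imgP; exists x; rewrite // /r' rx.
      by case/negP: bn; apply/rel_imgP; exists x.
    move/leq_trans/(_ (subset_leq_card sub)).
    have := cardsU (rel_img r' T) (rel_img r S); rewrite NS; lia.
  exists (fun x => if x \in S then g1 x else g2 x); split=> [x y xP yP|x xP].
    case: ifP => xS; case: ifP => yS; [exact: g1i| | |].
    - have yD : y \in P :\: S by rewrite inE yS yP.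
      move=> e; have /andP[_ /negP[]] := g2r _ yD.
      by apply/rel_imgP; exists x => //; rewrite -e g1r.
    - have xD : x \in P :\: S by rewrite inE xS xP.
      move=> e; have /andP[_ /negP[]] := g2r _ xD.
      by apply/rel_imgP; exists y => //; rewrite e g1r.
    - by apply: g2i; rewrite inE ?xS ?yS.
  case: ifP => xS; first exact: g1r.
  by have /andP[] : r' x (g2 x) by apply: g2r; rewrite inE xS.
(* Without tight sets every proper nonempty subset has a spare image, so giving any admissible [b]
   to [a] only uses up the surplus. *)
rewrite negb_exists => /forallP hS.
have [b rab] : exists b, r a b.
  have := hP [set a]; rewrite sub1set aP cards1 => /(_ isT).
  by case/card_gt0P=> b /rel_imgP[x /set1P-> rx]; exists b.
pose r' x y := r x y && (y != b).
have ltD : (#|P :\ a| < m)%N by have := cardsD1 a P; rewrite aP; lia.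
have [T TD|g2 [g2i g2r]] := IH r' (P :\ a) ltD.
  have [->|T0] := eqVneq T set0; first by rewrite cards0.
  have TP : T \proper P.
    apply: sub_proper_trans TD _; rewrite properD1 //.
  have := hS T; rewrite TP T0 /= => ne.
  have le1 := hP T (proper_sub TP).
  have sub : rel_img r T \subset b |: rel_img r' T.
    apply/subsetP=> y /rel_imgP[x xT rx]; rewrite !in_setU1.
    case: eqVneq => //= yb; apply/rel_imgP; exists x; rewrite // /r' rx; exact: yb.
  have := subset_leq_card sub; have := cardsU1 b (rel_img r' T).
  move: ne le1; case: (_ \notin _) => /=; lia.
exists (fun x => if x == a then b else g2 x); split=> [x y xP yP|x xP].
  case: eqVneq => [->|xa]; case: eqVneq => [->|ya] // e.
  - have yD : y \in P :\ a by rewrite !inE ya.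
    by have /andP[_] := g2r _ yD; rewrite -e eqxx.
  - have xD : x \in P :\ a by rewrite !inE xa.
    by have /andP[_] := g2r _ xD; rewrite e eqxx.
  - by apply: g2i; rewrite // !inE ?xa ?ya.
case: eqVneq => [->//|xa].
by have /andP[] : r' x (g2 x) by apply: g2r; rewrite !inE xa.
Qed.

(** * Regularity *)

Definition nbr (V : finType) (G : rel V) (u : V) : {set V} := [set v | G u v].

Definition cls (V K : finType) (f : V -> K) (i : K) : {set V} := [set v | f v == i].

Definition eR (R : realType) (V : finType) (G : rel V) (A B : {set V}) : R :=
  \sum_(u in A) \sum_(v in B) (G u v)%:R.

(* One-sided, vertex-degree form of regularity. *)
Definition low_regular (R : realType) (V : finType) (G : rel V) (d eps : R) (A B : {set V}) : bool :=
  [forall B' : {set V}, (B' \subset B) && (eps * #|B|%:R <= #|B'|%:R) ==>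
     (#|[set u in A | #|nbr G u :&: B'|%:R < d * #|B'|%:R]|%:R <= eps * #|A|%:R)].

(** The density threshold is twice the degree threshold [d] of [low_regular]. This gap makes the
    density of a witness deviate by at least [d]; sparse pairs never count as irregular. *)
Definition irregular (R : realType) (V K : finType) (G : rel V) (f : V -> K) (d eps : R) (i j : K) : bool :=
  (2 * d * #|cls f i|%:R * #|cls f j|%:R <= eR R G (cls f i) (cls f j))
    && ~~ low_regular G d eps (cls f i) (cls f j).

Lemma card_nbrI (R : realType) (V : finType) (G : rel V) (u : V) (B : {set V}) :
  \sum_(v in B) (G u v)%:R = #|nbr G u :&: B|%:R :> R.
Proof.
rewrite -sum1_card natr_sum big_mkcond [RHS]big_mkcond /=.
by apply: eq_bigr => v _; rewrite !inE; case: (v \in B); case: (G u v).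
Qed.

Section Energy.
Variables (R : realType) (V : finType) (G : rel V).

Definition cdens (K : finType) (f : V -> K) (i j : K) : R :=
  eR R G (cls f i) (cls f j) / (#|cls f i|%:R * #|cls f j|%:R).

(** Mean square density, unnormalised and summed over pairs of vertices, so that unequal classes are
    weighted automatically. *)
Definition energy (K : finType) (f : V -> K) : R :=
  \sum_u \sum_v cdens f (f u) (f v) ^+ 2.

Lemma eR_ge0 (A B : {set V}) : 0 <= eR R G A B.
Proof. by apply: sumr_ge0 => u _; apply: sumr_ge0 => v _; rewrite ler0n. Qed.

Lemma eR_le (A B : {set V}) : eR R G A B <= #|A|%:R * #|B|%:R.
Proof.
rewrite /eR mulr_natl -sumr_const; apply: ler_sum => u _.
by rewrite card_nbrI ler_nat subset_leq_card ?subsetIr.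
Qed.

Lemma cdens_ge0 (K : finType) (f : V -> K) i j : 0 <= cdens f i j.
Proof. by rewrite divr_ge0 ?eR_ge0 ?mulr_ge0. Qed.

Lemma cdens_le1 (K : finType) (f : V -> K) i j : cdens f i j <= 1.
Proof.
rewrite /cdens; have [->|N0] := eqVneq (#|cls f i|%:R * #|cls f j|%:R : R) 0.
  by rewrite invr0 mulr0.
by rewrite ler_pdivrMr ?mul1r ?eR_le // lt_def N0 mulr_ge0.
Qed.

Lemma energy_le (K : finType) (f : V -> K) : energy f <= #|V|%:R ^+ 2.
Proof.
rewrite expr2 mulr_natl -sumr_const; apply: ler_sum => u _.
rewrite -sumr_const; apply: ler_sum => v _.
by rewrite expr_le1 ?cdens_ge0 ?cdens_le1.
Qed.

Lemma sum_cls2 (K : finType) (f : V -> K) (F : V -> V -> R) :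
  \sum_u \sum_v F u v =
  \sum_i \sum_j \sum_(u in cls f i) \sum_(v in cls f j) F u v.
Proof.
rewrite (partition_big f xpredT) //=; apply: eq_bigr => i _.
rewrite exchange_big /=; under [RHS]eq_bigr do rewrite exchange_big /=.
rewrite (partition_big f xpredT) //=; apply: eq_bigr => j _.
by apply: eq_big => [u|v _]; [rewrite inE | apply: eq_bigl => u; rewrite inE].
Qed.

(** [cdens] is the conditional expectation of the adjacency matrix with respect to the pairs of
    classes. *)
Lemma sum_cdens (K : finType) (f : V -> K) (psi : K -> K -> R) :
  \sum_u \sum_v psi (f u) (f v) * (G u v)%:R =
  \sum_u \sum_v psi (f u) (f v) * cdens f (f u) (f v).
Proof.
rewrite (sum_cls2 f) [RHS](sum_cls2 f); apply: eq_bigr => i _; apply: eq_bigr => j _.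
rewrite (eq_bigr (fun u => psi i j * \sum_(v in cls f j) (G u v)%:R)); last first.
  move=> u; rewrite inE => /eqP->; rewrite mulr_sumr.
  by apply: eq_bigr => v; rewrite inE => /eqP->.
rewrite -mulr_sumr -/(eR R G _ _).
rewrite [RHS](eq_bigr (fun u => #|cls f j|%:R * (psi i j * cdens f i j))); last first.
  move=> u; rewrite inE => /eqP->; rewrite mulr_natl -sumr_const.
  by apply: eq_bigr => v; rewrite inE => /eqP->.
rewrite sumr_const -[RHS]mulr_natl mulrA [RHS]mulrCA /cdens; congr (_ * _).
have [N0|N0] := eqVneq (#|cls f i|%:R * #|cls f j|%:R : R) 0; last by rewrite mulrCA divff ?mulr1.
by apply/eqP; rewrite N0 mul0r eq_le eR_ge0 -N0 eR_le.
Qed.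

(** Pythagoras: the densities of [f] are the projection of those of [f'], so the cross term [E1] is
    [energy f]. *)
Lemma energy_refine (K K' : finType) (f : V -> K) (f' : V -> K') (p : K' -> K) :
  (forall u, f u = p (f' u)) ->
  \sum_u \sum_v (cdens f' (f' u) (f' v) - cdens f (f u) (f v)) ^+ 2 = energy f' - energy f.
Proof.
move=> fp.
have E1 : \sum_u \sum_v cdens f (f u) (f v) * cdens f' (f' u) (f' v) = energy f.
  pose psi i j := cdens f (p i) (p j).
  transitivity (\sum_u \sum_v psi (f' u) (f' v) * cdens f' (f' u) (f' v)).
    by apply: eq_bigr => u _; apply: eq_bigr => v _; rewrite /psi -!fp.
  rewrite -sum_cdens.
  transitivity (\sum_u \sum_v cdens f (f u) (f v) * (G u v)%:R).
    by apply: eq_bigr => u _; apply: eq_bigr => v _; rewrite /psi -!fp.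
  by rewrite sum_cdens; apply: eq_bigr => u _; apply: eq_bigr => v _; rewrite expr2.
rewrite [RHS](_ : _ = energy f' - 2 * energy f + energy f); last by ring.
rewrite -{1}E1 /energy mulr_sumr -sumrB -big_split /=; apply: eq_bigr => u _.
rewrite mulr_sumr -sumrB -big_split /=; apply: eq_bigr => v _; ring.
Qed.

Lemma sum_cdens_sub (K : finType) (f : V -> K) (A B : {set V}) (a b : pred K) :
  (forall u, (u \in A) = a (f u)) -> (forall u, (u \in B) = b (f u)) ->
  \sum_(u in A) \sum_(v in B) cdens f (f u) (f v) = eR R G A B.
Proof.
move=> Aa Bb; pose psi i j : R := (a i && b j)%:R.
have H (F : V -> V -> R) : \sum_(u in A) \sum_(v in B) F u v =
    \sum_u \sum_v psi (f u) (f v) * F u v.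
  rewrite big_mkcond; apply: eq_bigr => u _; rewrite /psi -Aa.
  case: ifP => uA; last by rewrite big1 // => v _; rewrite mul0r.
  rewrite big_mkcond; apply: eq_bigr => v _; rewrite -Bb /=.
  by case: ifP; rewrite ?mul1r ?mul0r.
by rewrite H -sum_cdens /eR H.
Qed.

Variables (d eps : R).
Hypotheses (d_gt0 : 0 < d) (eps_gt0 : 0 < eps).

Lemma irregular_witness (K : finType) (f : V -> K) i j : irregular G f d eps i j ->
  exists AB : {set V} * {set V}, [/\ AB.1 \subset cls f i, AB.2 \subset cls f j,
    eps * #|cls f i|%:R <= #|AB.1|%:R, eps * #|cls f j|%:R <= #|AB.2|%:R &
    eR R G AB.1 AB.2 <= (cdens f i j - d) * #|AB.1|%:R * #|AB.2|%:R].
Proof.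
case/andP=> dense; rewrite negb_forall => /existsP[B]; rewrite negb_imply -ltNge.
case/andP=> /andP[sB leB]; set A := [set u in _ | _] => leA.
exists (A, B); split=> //=; first by apply/subsetP=> u; rewrite inE => /andP[].
  exact: ltW.
(* The pair has density at least [2 * d], while the vertices of [A] send density below [d] into [B].
   An empty class would contradict the strict bound [leA]. *)
have dle : d <= cdens f i j - d.
  rewrite lerBrDr /cdens ler_pdivlMr; first by apply: le_trans dense; lra.
  rewrite mulr_gt0 // ltr0n lt0n; apply/negP=> /eqP C0.
    have A0 : #|A| = 0%N.
      apply/eqP; rewrite -leqn0 -C0 subset_leq_card //.
      by apply/subsetP=> u; rewrite inE => /andP[].
    by move: leA; rewrite A0 C0 mulr0 ltxx.
  have B0 : B = set0.
    by apply/eqP; rewrite -cards_eq0 -leqn0 -C0 subset_leq_card.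
  suff A0 : A = set0 by move: leA; rewrite A0 cards0 ltNge mulr_ge0 // ltW.
  by apply/setP=> u; rewrite !inE B0 setI0 cards0 mulr0 ltxx andbF.
apply: (@le_trans _ _ (d * #|A|%:R * #|B|%:R)); last by rewrite !ler_wpM2r.
rewrite -mulrA mulrCA mulr_natl -sumr_const; apply: ler_sum => u.
by rewrite inE card_nbrI => /andP[_ /ltW].
Qed.

(** Each class is cut by all the witnesses it takes part in, on either side, whence the factor
    [4 ^ #|K|]. By [energy_refine] an irregular pair then gains [d ^+ 2] times the product of the
    sizes of its witnesses. *)
Lemma energy_step (K : finType) (f : V -> K) :
  eps * #|V|%:R ^+ 2 < \sum_i \sum_(j | irregular G f d eps i j) (#|cls f i|%:R * #|cls f j|%:R) ->
  exists (K' : finType) (f' : V -> K'), #|K'| = (#|K| * 4 ^ #|K|)%N /\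
    energy f + d ^+ 2 * eps ^+ 3 * #|V|%:R ^+ 2 <= energy f'.
Proof.
move=> big_irr.
have /(@fin_all_exists _ (fun=> _)) [w hw] : forall ij : K * K, exists AB : {set V} * {set V},
    irregular G f d eps ij.1 ij.2 -> [/\ AB.1 \subset cls f ij.1, AB.2 \subset cls f ij.2,
    eps * #|cls f ij.1|%:R <= #|AB.1|%:R, eps * #|cls f ij.2|%:R <= #|AB.2|%:R &
    eR R G AB.1 AB.2 <= (cdens f ij.1 ij.2 - d) * #|AB.1|%:R * #|AB.2|%:R].
  move=> [i j] /=; case: (boolP (irregular G f d eps i j)) => [/irregular_witness[AB h]|_].
    by exists AB.
  by exists (set0, set0).
pose f' u : K * {ffun K -> bool * bool} :=
  (f u, [ffun j => (u \in (w (f u, j)).1, u \in (w (j, f u)).2)]).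
exists (K * {ffun K -> bool * bool})%type, f'; split.
  by rewrite card_prod card_ffun card_prod card_bool.
rewrite addrC -lerBrDr -(@energy_refine _ _ f f' fst) //.
set de := fun u v : V => cdens f' (f' u) (f' v) - cdens f (f u) (f v).
rewrite (sum_cls2 f).
apply: (@le_trans _ _ (\sum_i \sum_(j | irregular G f d eps i j)
    d ^+ 2 * eps ^+ 2 * (#|cls f i|%:R * #|cls f j|%:R))).
  under eq_bigr do rewrite -mulr_sumr.
  rewrite -mulr_sumr (_ : d ^+ 2 * eps ^+ 3 * #|V|%:R ^+ 2 = d ^+ 2 * eps ^+ 2 * (eps * #|V|%:R ^+ 2));
    last by ring.
  by rewrite ler_pM2l ?ltW // mulr_gt0 ?exprn_gt0.
apply: ler_sum => i _; rewrite big_mkcond; apply: ler_sum => j _.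
case: ifP => [irr|_]; last by apply: sumr_ge0 => u _; apply: sumr_ge0 => v _; exact: sqr_ge0.
have [sA sB lA lB le_e] := hw (i, j) irr; move: sA sB lA lB le_e => /=.
set A := (w (i, j)).1; set B := (w (i, j)).2 => sA sB lA lB le_e.
apply: (@le_trans _ _ (\sum_(u in A) \sum_(v in B) de u v ^+ 2)); last first.
  have sq0 u v : 0 <= de u v ^+ 2 by exact: sqr_ge0.
  have sub (C C' : {set V}) (F : V -> R) : C \subset C' -> (forall u, 0 <= F u) ->
      \sum_(u in C) F u <= \sum_(u in C') F u.
    move=> sC F0; rewrite [leRHS](big_setID C) /= (setIidPr sC) lerDl.
    by apply: sumr_ge0.
  apply: le_trans (sub _ _ _ sA _); last by move=> u; apply: sumr_ge0 => v _; exact: sq0.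
  by apply: ler_sum => u _; apply: sub => // v; exact: sq0.
(* The linear bound comes from [(de u v + d) ^+ 2 >= 0]; it takes the place of the Cauchy-Schwarz
   inequality and lets the drop in density be summed directly. *)
apply: (@le_trans _ _ (\sum_(u in A) \sum_(v in B) (- (2 * d) * de u v - d ^+ 2))); last first.
  apply: ler_sum => u _; apply: ler_sum => v _.
  by rewrite -subr_ge0 (_ : _ - _ = (de u v + d) ^+ 2) ?sqr_ge0 //; ring.
have -> : \sum_(u in A) \sum_(v in B) (- (2 * d) * de u v - d ^+ 2) =
  - (2 * d) * (\sum_(u in A) \sum_(v in B) de u v) - d ^+ 2 * (#|A|%:R * #|B|%:R).
  rewrite mulr_sumr (mulr_natl #|B|%:R) mulrnAr -sumr_const -sumrB; apply: eq_bigr => u _.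
  by rewrite mulr_sumr mulr_natr -sumr_const -sumrB.
have -> : \sum_(u in A) \sum_(v in B) de u v = eR R G A B - cdens f i j * (#|A|%:R * #|B|%:R).
  rewrite -(@sum_cdens_sub _ f' A B
     (fun k => (k.1 == i) && (k.2 j).1) (fun k => (k.1 == j) && (k.2 i).2)).
  - rewrite (mulr_natl #|B|%:R) mulrnAr -sumr_const -sumrB; apply: eq_bigr => u uA.
    rewrite mulr_natr -sumr_const -sumrB; apply: eq_bigr => v vB.
    by move: (subsetP sA _ uA) (subsetP sB _ vB); rewrite /de !inE => /eqP<- /eqP<-.
  - move=> u /=; rewrite ffunE /=; case: eqVneq => [->//|ne] /=.
    by apply/negbTE/negP=> /(subsetP sA); rewrite inE (negbTE ne).
  - move=> u /=; rewrite ffunE /=; case: eqVneq => [->//|ne] /=.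
    by apply/negbTE/negP=> /(subsetP sB); rewrite inE (negbTE ne).
apply: (@le_trans _ _ (d ^+ 2 * (#|A|%:R * #|B|%:R))).
  rewrite -[leLHS]mulrA ler_pM2l ?exprn_gt0 // expr2 mulrACA.
  by apply: ler_pM; rewrite ?mulr_ge0 // ltW.
have : 2 * d * eR R G A B <= 2 * d * ((cdens f i j - d) * #|A|%:R * #|B|%:R).
  by rewrite ler_pM2l // mulr_gt0.
by move: (eR _ _ _ _) => E h; lra.
Qed.

End Energy.

Theorem regularity (R : realType) (d eps : R) : 0 < d -> 0 < eps ->
  exists M : nat, forall (V : finType) (G : rel V), exists (K : finType) (f : V -> K),
    (#|K| <= M)%N /\
    \sum_i \sum_(j | irregular G f d eps i j) (#|cls f i|%:R * #|cls f j|%:R)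
      <= eps * #|V|%:R ^+ 2.
Proof.
move=> d0 e0; pose c := d ^+ 2 * eps ^+ 3.
have c0 : 0 < c by rewrite mulr_gt0 ?exprn_gt0.
(* Bound on the number of classes after [t] refinements; the summand [M t'] makes it visibly
   monotone. *)
pose M := fix M t := if t is t'.+1 then (M t' + M t' * 4 ^ M t')%N else 1%N.
have Mmono t : (M t <= M t.+1)%N by rewrite /= leq_addr.
exists (M (Num.bound c^-1)) => V G; apply: contrapT => no.
have [n0|Vn0] := eqVneq (#|V|%:R : R) 0.
  apply: no; exists unit, (fun=> tt); split.
    by rewrite card_unit; elim: (Num.bound _) => // t IH; apply: leq_trans (Mmono t).
  rewrite n0 expr2 !mulr0 big1 // => i _; rewrite big1 // => j _.
  suff -> : #|cls (fun _ : V => tt) i| = 0%N by rewrite mul0r.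
  move/eqP: n0; rewrite pnatr_eq0 => /eqP n0.
  by apply/eqP; rewrite -leqn0 -n0 max_card.
have H t : (t <= Num.bound c^-1)%N -> exists (K : finType) (f : V -> K), (#|K| <= M t)%N /\
    t%:R * (c * #|V|%:R ^+ 2) <= energy R G f.
  elim: t => [_|t IH lt_t].
    exists unit, (fun=> tt); rewrite card_unit mul0r; split=> //.
    by apply: sumr_ge0 => u _; apply: sumr_ge0 => v _; apply: sqr_ge0.
  have [K [f [leK lef]]] := IH (ltnW lt_t).
  have [small|/energy_step-/(_ d0 e0)[K' [f' [cK' lef']]]] := leP (\sum_i \sum_(j | irregular G f d eps i j)
     (#|cls f i|%:R * #|cls f j|%:R)) (eps * #|V|%:R ^+ 2).
    case: no; exists K, f; split=> //; apply: leq_trans leK _.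
    by elim: (Num.bound _) t lt_t {IH lef} => // m IHm t; rewrite ltnS leq_eqVlt => /orP[/eqP->//|/IHm h]; apply: leq_trans h (Mmono m).
  exists K', f'; split.
    by rewrite cK' /= (leq_trans _ (leq_addl _ _)) // leq_mul // leq_pexp2l.
  by apply: le_trans lef'; rewrite -/c; move: lef; rewrite -natr1; lra.
(* More than [c^-1] gains of [c * #|V|%:R ^+ 2] would push the energy above its maximum. *)
have [K [f [_ lef]]] := H _ (leqnn _).
have := le_trans lef (energy_le R G f).
rewrite mulrA ger_pMl; last by rewrite exprn_gt0 // lt_def Vn0 ler0n.
apply/negP; rewrite -ltNge -ltr_pdivrMr // div1r.
by apply: archi_boundP; rewrite invr_ge0 ltW.
Qed.

(** * Degree sequences and robust expansion *)

Lemma eR_card (R : realType) (V : finType) (G : rel V) (A B : {set V}) :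
  eR R G A B = \sum_(u in A) #|nbr G u :&: B|%:R.
Proof. by apply: eq_bigr => u _; rewrite card_nbrI. Qed.

Lemma eR_sym (R : realType) (V : finType) (G : rel V) (A B : {set V}) :
  symmetric G -> eR R G A B = eR R G B A.
Proof.
move=> sG; rewrite /eR exchange_big; apply: eq_bigr => v _.
by apply: eq_bigr => u _; rewrite sG.
Qed.

Lemma sumr_le_const (R : realType) (V : finType) (A : {set V}) (F : V -> R) (c : R) :
  (forall u, u \in A -> F u <= c) -> \sum_(u in A) F u <= #|A|%:R * c.
Proof. by move=> h; rewrite mulr_natl -sumr_const; apply: ler_sum. Qed.

Lemma sumr_ge_const (R : realType) (V : finType) (A : {set V}) (F : V -> R) (c : R) :
  (forall u, u \in A -> c <= F u) -> #|A|%:R * c <= \sum_(u in A) F u.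
Proof. by move=> h; rewrite mulr_natl -sumr_const; apply: ler_sum. Qed.

Lemma cardI_lb (V : finType) (A B : {set V}) : (#|A| + #|B| <= #|A :&: B| + #|V|)%N.
Proof.
have := cardsUI A B; have : (#|A :|: B| <= #|V|)%N by exact: max_card.
lia.
Qed.

Lemma card_sup (V : finType) (P : pred V) : (#|[set v | P v]| + #|[set v | ~~ P v]| = #|V|)%N.
Proof. by rewrite -(cardsC [set v | P v]); congr (_ + _)%N; apply: eq_card => v; rewrite !inE. Qed.

Section DegreeSequence.
Variables (R : realType) (n : nat) (G : rel 'I_n).

Lemma deg_nbr v : deg G v = #|nbr G v|.
Proof. by []. Qed.

(** In the sorted sequence every position from [j] on carries at least [x], so the smaller degrees
    sit in the first [j.-1] places. *)
Lemma card_deg_lt (x : R) (j : nat) : (0 < j <= n)%N -> x <= (d_ G j)%:R ->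
  (#|[set v | ((deg G v)%:R < x)%R]| < j)%N.
Proof.
move=> /andP[j0 jn] xd; rewrite /d_ in xd; set s := deg_seq G in xd.
have szs : size s = n by rewrite size_sort size_map size_enum_ord.
have srt : sorted leq s by apply: sort_sorted; exact: leq_total.
have -> : #|[set v | (deg G v)%:R < x]| = count (fun y : nat => y%:R < x) s.
  rewrite (permP (permEl (perm_sort _ _))) count_map cardsE cardE -size_filter.
  by rewrite enumT.
rewrite -(cat_take_drop j.-1 s) count_cat.
have -> : count (fun y : nat => y%:R < x) (drop j.-1 s) = 0%N.
  apply/eqP; rewrite -leqn0 leqNgt -has_count; apply/hasPn => y /(nthP 0%N)[i].
  rewrite size_drop nth_drop szs => lti <-; rewrite -leNgt; apply: le_trans xd _.
  rewrite ler_nat; apply: (sorted_leq_nth leq_trans leqnn) => //; rewrite ?inE ?szs; lia.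
rewrite addn0; apply: leq_ltn_trans (count_size _ _) _.
rewrite size_take_min szs; lia.
Qed.

(** Turns both alternatives into counts of vertices, the form in which the condition is applied
    below. *)
Lemma degree_condition_card (gamma : R) i : 0 <= gamma -> degree_condition G gamma ->
  (0 < i)%N -> (2 * i < n)%N ->
  (#|[set v | ((deg G v)%:R < i%:R + gamma * n%:R)%R]| < i)%N \/
  i%:R + gamma * n%:R <= #|[set v | (n - i <= deg G v)%N]|%:R :> R.
Proof.
move=> g0 dc i0 i2; have [h|[lt h]] := dc i i0 i2; [left|right].
  by apply: card_deg_lt => //; lia.
have := @card_deg_lt (n - i)%:R (n - i - gn gamma n)%N.
rewrite ler_nat h => /(_ _ isT) H.
have {}H : (#|[set v | ~~ (n - i <= deg G v)%N]| < n - i - gn gamma n)%N.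
  rewrite (eq_card (B := [set v | (deg G v)%:R < (n - i)%:R :> R])); first by apply: H; lia.
  by move=> v; rewrite !inE ltr_nat ltnNge.
have := card_sup (fun v => (n - i <= deg G v)%N); rewrite card_ord => E.
have gle : gamma * n%:R <= (gn gamma n)%:R.
  rewrite /gn; apply: le_trans (Num.Theory.ceil_ge _) _.
  by rewrite natr_absz ler_int ler_norm.
apply: (@le_trans _ _ (i%:R + (gn gamma n)%:R)); first by rewrite lerD2l.
rewrite -natrD ler_nat; lia.
Qed.

End DegreeSequence.

(** The robust neighbourhood of Kuehn, Osthus and Treglown. Unlike a plain neighbourhood it
    tolerates the deletion of few edges, hence the passage to the reduced graph. *)
Definition rnbr (R : realType) (V : finType) (G : rel V) (nu : R) (S : {set V}) : {set V} :=
  [set u | nu * #|V|%:R <= #|nbr G u :&: S|%:R].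

Definition robust_expander (R : realType) (V : finType) (G : rel V) (nu sigma : R) : Prop :=
  forall S : {set V}, sigma * #|V|%:R <= #|S|%:R <= (1 - sigma) * #|V|%:R ->
    #|S|%:R + nu * #|V|%:R <= #|rnbr G nu S|%:R.

(** The condition at [i = 1]: either all degrees are large, or linearly many vertices have degree at
    least [n - 1] and are adjacent to everything else. *)
Lemma degree_condition_min_deg (R : realType) (gamma : R) (n : nat) (G : rel 'I_n) :
  0 < gamma -> (3 <= n)%N -> simple_graph G -> degree_condition G gamma ->
  forall v, gamma * n%:R <= #|nbr G v|%:R.
Proof.
move=> g0 n3 [sG iG] dc v.
have [//| |h|h] := degree_condition_card (ltW g0) dc (i := 1%N).
- lia.
- have : #|[set v | (deg G v)%:R < 1%:R + gamma * n%:R]| = 0%N by lia.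
  move/eqP; rewrite cards_eq0 => /eqP/setP/(_ v); rewrite !inE => /negbT.
  rewrite -leNgt deg_nbr; apply: le_trans; lra.
set W := [set v | _] in h.
have sW : W :\ v \subset nbr G v.
  apply/subsetP=> w; rewrite !inE => /andP[wv]; rewrite sG; apply: contraLR => nGwv.
  have := cardsC (nbr G w); rewrite card_ord deg_nbr.
  suff : (#|[set w; v]| <= #|~: nbr G w|)%N by rewrite cards2 wv; lia.
  by apply: subset_leq_card; apply/subsetP=> u; rewrite !inE => /orP[]/eqP->; rewrite ?iG.
have le1 := subset_leq_card sW.
have : (#|W| <= #|nbr G v| + 1)%N by rewrite (cardsD1 v W); case: (v \in W); lia.
by rewrite -(ler_nat R) natrD; lra.
Qed.

(** The condition is applied at an index slightly below [#|S|], or below [n - #|S|] once [S] has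
    more than about half of the vertices. The shift [a], about [ka * N], leaves room for [nu], which
    is smaller by the factor [gamma / 8]. *)
Lemma degree_condition_robust (R : realType) (gamma sigma : R) :
  0 < gamma <= 1 -> 0 < sigma <= 1 ->
  exists nu : R, 0 < nu /\ exists n0 : nat, forall (n : nat) (G : rel 'I_n), (n0 <= n)%N ->
    symmetric G -> degree_condition G gamma -> robust_expander G nu sigma.
Proof.
move=> /andP[g0 g1] /andP[s0 s1].
pose ka : R := Num.min (sigma / 2) (gamma / 8).
have ka0 : 0 < ka by rewrite lt_min !divr_gt0.
have kas : ka <= sigma / 2 by rewrite ge_min lexx.
have kag : ka <= gamma / 8 by rewrite ge_min lexx orbT.
pose nu : R := ka * gamma / 8.
have nu0 : 0 < nu by rewrite divr_gt0 ?mulr_gt0.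
have nuk : nu <= ka / 8 by rewrite /nu; nra.
exists nu; split=> //; exists (Num.bound (4 / ka)) => n G n0n sG dc S.
set N : R := #|'I_n|%:R; have NE : N = n%:R by rewrite /N card_ord.
have kaN : 4 < ka * N.
  rewrite mulrC -ltr_pdivrMr // NE.
  apply: lt_le_trans (archi_boundP _) _; first by rewrite divr_ge0 // ltW.
  by rewrite ler_nat.
have N0 : 0 < N by rewrite NE; case: (n) NE kaN => [->|k _ _]; rewrite ?mulr0 ?ltr0n //; lra.
have nuN : nu * N <= ka / 8 * N by apply: ler_wpM2r nuk; apply: ltW.
have kagN : ka * N <= gamma / 8 * N by apply: ler_wpM2r kag; apply: ltW.
have kasN : ka * N <= sigma / 2 * N by apply: ler_wpM2r kas; apply: ltW.
set s := #|S|; move=> /andP[sl su]; rewrite leNgt; apply/negP=> small.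
set RN := rnbr G nu S in small.
pose a := (Num.truncn (ka * N)).+1.
have /andP[al au] : ka * N <= a%:R <= ka * N + 1.
  have := truncn_itv (ltW (lt_trans (ltr0n R 4) kaN)); rewrite /a -natr1 => /andP[].
  by move=> h1 /ltW ->; rewrite lerD2r.
have an : (0 < a)%N by [].
have nN : (s <= n)%N by have := max_card (mem S); rewrite card_ord.
have cI (A B : {set 'I_n}) : #|A|%:R + #|B|%:R - N <= #|A :&: B|%:R.
  by have := cardI_lb A B; rewrite -(ler_nat R) !natrD -/N; lra.
have notRN u : u \notin RN -> #|nbr G u :&: S|%:R < nu * N by rewrite inE -ltNge.
have [le_s|gt_s] := leP (2 * s%:R) (N + ka * N).
  pose i := (s - a)%N.
  have as1 : (a < s)%N by rewrite -(ltr_nat R); lra.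
  have Ei : i%:R = s%:R - a%:R :> R by rewrite /i natrB // ltnW.
  have [| |h|h] := degree_condition_card (ltW g0) dc (i := i).
  - by rewrite subn_gt0.
  - by rewrite -(ltr_nat R) natrM Ei -NE; lra.
  (* At least [a] vertices of [S] have degree [i + gamma * n] or more. A vertex outside [RN] takes
     at most [nu * N] of their edges, so [RN] itself must be large. *)
  - pose S' := S :\: [set v | (deg G v)%:R < i%:R + gamma * n%:R].
    have cS' : a%:R <= #|S'|%:R :> R.
      rewrite ler_nat cardsD; set L := [set v | _] in h *.
      have := subset_leq_card (subsetIr S L); move: h; rewrite -/s /i.
      by move: #|S :&: L| #|L| as1 => x y; clear; lia.
    have lb : #|S'|%:R * (i%:R + gamma * N) <= eR R G S' setT.
      rewrite eR_card; apply: sumr_ge_const => u; rewrite !inE -leNgt setIT => /andP[].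
      by rewrite deg_nbr NE.
    have ub : eR R G S' setT <= #|RN|%:R * #|S'|%:R + N * (nu * N).
      rewrite eR_sym // eR_card (bigID (mem RN)) /=; apply: lerD.
        apply: le_trans (_ : \sum_(u in RN) #|nbr G u :&: S'|%:R <= _).
          by rewrite (eq_bigl (mem RN)) // => u; rewrite inE.
        by apply: sumr_le_const => u _; rewrite ler_nat subset_leq_card ?subsetIr.
      apply: le_trans (_ : \sum_(u in ~: RN) #|nbr G u :&: S'|%:R <= _).
        by rewrite (eq_bigl (mem (~: RN))) // => u; rewrite !inE.
      apply: le_trans (sumr_le_const (c := nu * N) _) _.
        move=> u; rewrite in_setC => /notRN/ltW; apply: le_trans.
        by rewrite ler_nat subset_leq_card // setIS // subsetDl.
      by apply: ler_wpM2r; [rewrite ltW // mulr_gt0 | rewrite /N ler_nat max_card].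
    have := le_trans lb ub; rewrite Ei; move: small; rewrite -/N -/s.
    move: (#|RN|%:R) (#|S'|%:R) cS' (s%:R) => rn s' cS' sr small le1.
    have : s' * (sr - a%:R + gamma * N - rn) <= nu * N * N by lra.
    apply/negP; rewrite -ltNge.
    have : gamma * N / 2 <= sr - a%:R + gamma * N - rn by lra.
    have gN : 0 < gamma * N / 2 by rewrite divr_gt0 // mulr_gt0.
    have p4 : 0 < ka * gamma * N * N by rewrite !mulr_gt0.
    have : nu * N * N < a%:R * (gamma * N / 2).
      have : ka * N * (gamma * N / 2) <= a%:R * (gamma * N / 2) by rewrite ler_pM2r.
      by rewrite /nu; lra.
    by move=> h1 h2; apply: lt_le_trans h1 _; apply: ler_pM => //; apply: ltW.
  (* A vertex of degree at least [n - i] has at least [#|S| - i = a] neighbours in [S], so it lies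
     in [RN]. *)
  - set W := [set v | _] in h.
    have : W \subset RN.
      apply/subsetP=> w; rewrite !inE deg_nbr => hw.
      apply: le_trans (cI (nbr G w) S); rewrite -/N.
      have : (n - i <= #|nbr G w|)%N by [].
      rewrite -(ler_nat R) natrB ?Ei -?NE; last exact: leq_trans (leq_subr _ _) nN.
      by rewrite -/s; lra.
    move/subset_leq_card; rewrite -(ler_nat R) => /(le_trans h).
    by rewrite Ei -NE; move: small; rewrite -/N -/s; lra.
pose j := (n - s - a)%N.
have asn : (a < n - s)%N by rewrite -(ltr_nat R) natrB // -NE; lra.
have Ej : j%:R = N - s%:R - a%:R :> R by rewrite /j natrB ?natrB // ?NE // ltnW.
pose T := ~: RN.
have cT : #|T|%:R = N - #|RN|%:R by rewrite /T cardsCs setCK natrB ?max_card.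
have [| |h|h] := degree_condition_card (ltW g0) dc (i := j).
- by rewrite subn_gt0.
- by rewrite -(ltr_nat R) natrM Ej -NE; lra.
(* Vertices outside [RN] have almost all their neighbours outside [S], which forces a small
   degree. *)
- have /subset_leq_card : T \subset [set v | (deg G v)%:R < j%:R + gamma * n%:R].
    apply/subsetP=> u; rewrite in_setC => /notRN; rewrite inE deg_nbr => hu.
    have := cI (nbr G u) S; rewrite -/s Ej -NE; lra.
  move/leq_ltn_trans/(_ h); rewrite -(ltr_nat R) cT Ej.
  by move: small; rewrite -/N -/s; lra.
(* Now linearly many vertices of [S] have degree at least [n - j = s + a], hence many neighbours in
   [T]; but each vertex of [T] has fewer than [nu * N] neighbours in [S]. *)
set W := [set v | _] in h.
have lb : #|W :&: S|%:R * ((ka - nu) * N) <= eR R G (W :&: S) T.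
  rewrite eR_card; apply: sumr_ge_const => w; rewrite !inE deg_nbr => /andP[hw _].
  apply: le_trans (cI (nbr G w) T); rewrite -/N cT.
  have : (n - j <= #|nbr G w|)%N by [].
  rewrite -(ler_nat R) natrB ?Ej -?NE; last exact: leq_trans (leq_subr _ _) (leq_subr _ _).
  by move: small; rewrite -/s -/N; lra.
have ub : eR R G (W :&: S) T <= N * (nu * N).
  rewrite eR_sym // eR_card; apply: le_trans (sumr_le_const (c := nu * N) _) _.
    move=> u; rewrite in_setC => /notRN/ltW; apply: le_trans.
    by rewrite ler_nat subset_leq_card // setIS // subsetIr.
  by apply: ler_wpM2r; [rewrite ltW // mulr_gt0 | rewrite /N ler_nat max_card].
have cWS : gamma * N / 2 <= #|W :&: S|%:R.
  have := cI W S; rewrite -/s -/N; move: h; rewrite Ej -NE; lra.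
have := le_trans lb ub; apply/negP; rewrite -ltNge.
have : gamma * N / 2 * ((ka - nu) * N) <= #|W :&: S|%:R * ((ka - nu) * N).
  by rewrite ler_pM2r // mulr_gt0 //; lra.
apply: lt_le_trans.
have : 0 < ka * gamma * N * N by rewrite !mulr_gt0.
have : nu * N * (gamma * N) <= ka / 8 * N * (gamma * N).
  by apply: ler_wpM2r nuN; rewrite ltW // mulr_gt0.
have -> : N * (nu * N) = ka * gamma * N * N / 8 by rewrite /nu; field.
lra.
Qed.

(** * The reduced graph *)

Section ReducedGraph.
Variables (R : realType) (V : finType) (G : rel V) (K : finType) (f : V -> K) (d dl zeta : R).

(** Both directions are asked for because [low_regular] is one-sided. The case [i = j] is not
    excluded. *)
Definition reduced : rel K := fun i j =>
  [&& low_regular G d dl (cls f i) (cls f j), low_regular G d dl (cls f j) (cls f i),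
      zeta * #|V|%:R <= #|cls f i|%:R & zeta * #|V|%:R <= #|cls f j|%:R].

(** Working on [V] weights every cluster by its size, so expansion and degrees can be compared
    directly with those of [G]. *)
Definition blowup : rel V := fun u v => reduced (f u) (f v).

Lemma reduced_sym : symmetric reduced.
Proof. by move=> i j; rewrite /reduced andbCA; congr (_ && (_ && _)); rewrite andbC. Qed.

Lemma blowup_sym : symmetric blowup.
Proof. by move=> u v; rewrite /blowup reduced_sym. Qed.

End ReducedGraph.

Lemma low_regularW (R : realType) (V : finType) (G : rel V) (d e1 e2 : R) (A B : {set V}) :
  e1 <= e2 -> low_regular G d e1 A B -> low_regular G d e2 A B.
Proof.
move=> le12 /forallP h; apply/forallP=> B'; apply/implyP=> /andP[sB leB].
have /implyP := h B'; rewrite sB (le_trans _ leB) ?ler_wpM2r // => /(_ isT) /le_trans; apply.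
by rewrite ler_wpM2r.
Qed.

Lemma card_cls (R : realType) (V K : finType) (f : V -> K) (P : pred K) :
  \sum_(i | P i) #|cls f i|%:R = #|[set v | P (f v)]|%:R :> R.
Proof.
rewrite -natr_sum; congr (_%:R); rewrite -sum1_card (partition_big f P) /=.
  apply: eq_bigr => i Pi; rewrite -sum1_card; apply: eq_bigl => v; rewrite !inE.
  by case: eqVneq => [->|]; rewrite ?Pi ?andbF.
by move=> v; rewrite inE.
Qed.

(** The weight of [bad] is quadratic in [dl], so that Markov's inequality leaves at most [dl * #|V|]
    vertices in clusters with many bad partners. *)
Definition reduced_bound (R : realType) (V K : finType) (G : rel V) (f : V -> K) (d dl zeta : R)
    (bad : rel K) : Prop :=
  \sum_i \sum_(j | bad i j) (#|cls f i|%:R * #|cls f j|%:R) <= dl ^+ 2 * #|V|%:R ^+ 2 /\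
  forall i j, ~~ bad i j -> ~~ reduced G f d dl zeta i j ->
    eR R G (cls f i) (cls f j) <= 2 * d * (#|cls f i|%:R * #|cls f j|%:R).

(** A pair is bad if it is irregular in one of two directions or if one of its two clusters is
    small. Each of these four reasons weighs at most [e * #|V|%:R ^+ 2], whence [e = dl ^+ 2 / 4];
    [zeta] is such that at most [M] small clusters hold at most [e * #|V|] vertices together. *)
Lemma reduced_graph (R : realType) (d dl : R) : 0 < d -> 0 < dl <= 1 ->
  exists (M : nat) (zeta : R), 0 < zeta /\ forall (V : finType) (G : rel V), symmetric G ->
    exists (K : finType) (f : V -> K) (bad : rel K),
    (#|K| <= M)%N /\ reduced_bound G f d dl zeta bad.
Proof.
move=> d0 /andP[dl0 dl1]; pose e := dl ^+ 2 / 4.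
have e0 : 0 < e by rewrite divr_gt0 ?exprn_gt0.
have edl : e <= dl by rewrite /e; nra.
have [M HM] := regularity d0 e0.
exists M, (e / M.+1%:R); split=> [|V G sG]; first by rewrite divr_gt0.
have [K [f [leK irr]]] := HM V G; set z := e / _.
pose small i := #|cls f i|%:R < z * #|V|%:R.
pose I i j := irregular G f d e i j.
exists K, f, (fun i j => [|| I i j, I j i, small i | small j]); split=> //; split; last first.
  move=> i j; rewrite !negb_or /reduced -!leNgt => /and4P[n1 n2 -> ->].
  rewrite !andbT leNgt; apply: contra => big; apply/andP; split.
    apply: low_regularW edl _; move: n1; rewrite /I /irregular -!mulrA in big * => n1.
    by move: n1; rewrite (ltW _) /= ?negbK //; move: big; rewrite !mulrA.
  apply: low_regularW edl _; move: n2; rewrite /I /irregular eR_sym // => n2.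
  move: n2; rewrite (_ : _ <= _) /= ?negbK // -mulrA (mulrC #|_|%:R); exact: ltW.
have N0 : 0 <= #|V|%:R :> R by [].
have msmall : \sum_(i | small i) #|cls f i|%:R <= e * #|V|%:R.
  apply: (@le_trans _ _ (\sum_(i : K) z * #|V|%:R)).
    rewrite big_mkcond; apply: ler_sum => i _; case: ifP => [/ltW//|_].
    by rewrite mulr_ge0 // divr_ge0 // ltW.
  rewrite sumr_const -[leLHS]mulr_natl mulrA; apply: ler_wpM2r => //.
  rewrite /z mulrCA ger_pMr // ler_pdivrMr // mul1r ler_nat; exact: leqW.
have total : \sum_i #|cls f i|%:R = #|V|%:R :> R.
  by rewrite card_cls; congr (_%:R); apply: eq_card => v; rewrite inE.
have nn i j : 0 <= #|cls f i|%:R * #|cls f j|%:R :> R by rewrite mulr_ge0.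
apply: (@le_trans _ _ (\sum_i \sum_j ((I i j)%:R + (I j i)%:R + (small i)%:R + (small j)%:R)
   * (#|cls f i|%:R * #|cls f j|%:R))).
  apply: ler_sum => i _; rewrite big_mkcond; apply: ler_sum => j _.
  have := nn i j; move: (_ * _) => c.
  by case: (I i j); case: (I j i); case: (small i); case: (small j) => /=; lra.
under eq_bigr do under eq_bigr do rewrite !mulrDl.
under eq_bigr do rewrite !big_split /=.
rewrite !big_split /=.
have S1 : \sum_i \sum_j (I i j)%:R * (#|cls f i|%:R * #|cls f j|%:R) <= e * #|V|%:R ^+ 2.
  apply: le_trans irr; apply: ler_sum => i _; rewrite [leRHS]big_mkcond; apply: ler_sum => j _.
  by rewrite -/(I i j); case: (I i j); rewrite ?mul1r ?mul0r.
have S2 : \sum_i \sum_j (I j i)%:R * (#|cls f i|%:R * #|cls f j|%:R) <= e * #|V|%:R ^+ 2.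
  rewrite exchange_big /=; apply: le_trans S1.
  by apply: ler_sum => i _; apply: ler_sum => j _; rewrite (mulrC #|cls f j|%:R).
have S3 : \sum_i \sum_(j : K) (small i)%:R * (#|cls f i|%:R * #|cls f j|%:R) <= e * #|V|%:R ^+ 2.
  rewrite [leLHS](_ : _ = (\sum_(i | small i) #|cls f i|%:R) * #|V|%:R).
    by rewrite expr2 mulrA ler_wpM2r.
  rewrite mulr_suml [RHS]big_mkcond; apply: eq_bigr => i _; rewrite -total.
  by case: (small i); rewrite ?mulr_sumr; [apply: eq_bigr | rewrite big1] => // j _; rewrite ?mul1r ?mul0r.
have S4 : \sum_(i : K) \sum_j (small j)%:R * (#|cls f i|%:R * #|cls f j|%:R) <= e * #|V|%:R ^+ 2.
  rewrite exchange_big /=; apply: le_trans S3.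
  by apply: ler_sum => i _; apply: ler_sum => j _; rewrite (mulrC #|cls f j|%:R).
have : 4 * e = dl ^+ 2 by rewrite /e; field.
move: (#|V|%:R ^+ 2) S1 S2 S3 S4 => N2 S1 S2 S3 S4 <-; lra.
Qed.

Section ReducedExpansion.
Variables (R : realType) (V : finType) (G : rel V) (K : finType) (f : V -> K).
Variables (d dl zeta gamma nu sigma : R) (bad : rel K).
Hypotheses (sG : symmetric G) (rb : reduced_bound G f d dl zeta bad).
Hypotheses (d0 : 0 < d) (dl0 : 0 < dl) (nu0 : 0 < nu) (g0 : 0 < gamma) (V0 : (0 < #|V|)%N).
Hypotheses (min_deg : forall v, gamma * #|V|%:R <= #|nbr G v|%:R).
Hypotheses (rob : robust_expander G nu sigma).
Hypotheses (dnu : dl + 2 * d <= nu ^+ 2 / 4) (dg : dl + 2 * d <= gamma / 2) (dl1 : dl <= 1).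

Let N : R := #|V|%:R.
Let N0 : 0 < N. Proof. by rewrite ltr0n. Qed.
Let Gs := blowup G f d dl zeta.

Lemma sum_pairs_cls (Q : rel K) :
  \sum_u #|[set v | Q (f u) (f v)]|%:R = \sum_i \sum_(j | Q i j) (#|cls f i|%:R * #|cls f j|%:R) :> R.
Proof.
rewrite (partition_big f xpredT) //=; apply: eq_bigr => i _.
rewrite -mulr_sumr card_cls (eq_bigr (fun=> #|[set v | Q i (f v)]|%:R)); last by move=> u /eqP->.
by rewrite sumr_const mulr_natl; congr (_ *+ _); apply: eq_card => u; rewrite inE.
Qed.

Lemma eR_cls_pairs (Q : rel K) :
  \sum_u #|[set v | G u v && Q (f u) (f v)]|%:R =
  \sum_i \sum_(j | Q i j) eR R G (cls f i) (cls f j).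
Proof.
transitivity (\sum_u \sum_v (Q (f u) (f v))%:R * (G u v)%:R : R).
  apply: eq_bigr => u _; rewrite -sum1_card natr_sum big_mkcond; apply: eq_bigr => v _.
  by rewrite inE; case: (G u v); case: (Q _ _); rewrite /= ?mul1r ?mul0r.
rewrite (sum_cls2 f); apply: eq_bigr => i _; rewrite [RHS]big_mkcond; apply: eq_bigr => j _.
case: ifP => Qij.
  by apply: eq_bigr => u; rewrite inE => /eqP->; apply: eq_bigr => v; rewrite inE => /eqP->; rewrite Qij mul1r.
by rewrite big1 // => u; rewrite inE => /eqP->; rewrite big1 // => v; rewrite inE => /eqP->; rewrite Qij mul0r.
Qed.

(** Bad pairs contribute [dl ^+ 2 <= dl] and sparse pairs [2 * d], in units of [N ^+ 2]. *)
Lemma deleted_edges : \sum_u #|[set v | G u v && ~~ Gs u v]|%:R <= (dl + 2 * d) * N ^+ 2.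
Proof.
rewrite (eR_cls_pairs (fun i j => ~~ reduced G f d dl zeta i j)).
have [rb1 rb2] := rb.
apply: (@le_trans _ _ (\sum_i (\sum_(j | bad i j) (#|cls f i|%:R * #|cls f j|%:R) +
   \sum_j 2 * d * (#|cls f i|%:R * #|cls f j|%:R)))).
  apply: ler_sum => i _; rewrite [leLHS]big_mkcond [in leRHS]big_mkcond -big_split /=.
  apply: ler_sum => j _; have nn : 0 <= #|cls f i|%:R * #|cls f j|%:R :> R by rewrite mulr_ge0.
  have nd : 0 <= 2 * d * (#|cls f i|%:R * #|cls f j|%:R) by rewrite !mulr_ge0 // ltW.
  case: ifP => nr; last by case: ifP => _; lra.
  case: ifP => [_|/negbT/rb2-/(_ nr)]; last by lra.
  by have := eR_le R G (cls f i) (cls f j); lra.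
rewrite big_split /= [leRHS]mulrDl; apply: lerD.
  by apply: le_trans rb1 _; rewrite ler_pM2r ?exprn_gt0 // expr2 ger_pMr.
rewrite (eq_bigr (fun i => 2 * d * N * #|cls f i|%:R)); last first.
  move=> i _; rewrite -!mulr_sumr (card_cls R f xpredT).
  have -> : #|[set v | xpredT (f v)]| = #|V| by apply: eq_card => v; rewrite inE.
  by rewrite -/N; ring.
rewrite -mulr_sumr (card_cls R f xpredT).
have -> : #|[set v | xpredT (f v)]| = #|V| by apply: eq_card => v; rewrite inE.
by rewrite -/N expr2 mulrA.
Qed.

(** A vertex that leaves the robust neighbourhood has lost at least [nu / 2 * N] edges; by
    [deleted_edges] and [dnu] this happens to at most [nu / 2 * N] vertices. *)
Lemma blowup_expands (S : {set V}) : sigma * N <= #|S|%:R <= (1 - sigma) * N ->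
  #|S|%:R + nu / 2 * N <= #|rnbr Gs (nu / 2) S|%:R.
Proof.
move=> /rob le1; set W := rnbr G nu S :\: rnbr Gs (nu / 2) S.
have sub : rnbr G nu S \subset rnbr Gs (nu / 2) S :|: W.
  by apply/subsetP=> u hu; rewrite !inE; move: hu; rewrite inE => ->; rewrite andbT orbN.
have := subset_leq_card sub; rewrite cardsU => cle.
have {}cle : #|rnbr G nu S|%:R <= #|rnbr Gs (nu / 2) S|%:R + #|W|%:R :> R.
  by rewrite -natrD ler_nat; lia.
suff : #|W|%:R <= nu / 2 * N by move: le1; rewrite -/N; lra.
have : #|W|%:R * (nu / 2 * N) <= (dl + 2 * d) * N ^+ 2.
  apply: le_trans deleted_edges; rewrite [leRHS](bigID (mem W)) /=.
  apply: le_trans (_ : \sum_(u in W) #|[set v | G u v && ~~ Gs u v]|%:R <= _); last first.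
    by rewrite lerDl; apply: sumr_ge0.
  apply: sumr_ge_const => u; rewrite !inE -ltNge -/N => /andP[lo hi].
  have : (#|nbr G u :&: S| <= #|nbr Gs u :&: S| + #|[set v | G u v && ~~ Gs u v]|)%N.
    rewrite -cardsUI; apply: leq_trans (leq_addr _ _).
    apply: subset_leq_card; apply/subsetP=> v; rewrite !inE => /andP[-> ->].
    by rewrite /= andbT orbN.
  by rewrite -(ler_nat R) natrD; lra.
have : (dl + 2 * d) * N ^+ 2 <= nu / 2 * N * (nu / 2 * N).
  by rewrite (_ : _ * (_ * N) = nu ^+ 2 / 4 * N ^+ 2) ?ler_pM2r ?exprn_gt0 //; field.
move=> h1 h2; have := le_trans h2 h1.
by rewrite ler_pM2r // mulr_gt0 // divr_gt0.
Qed.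

Definition typical : {set V} := [set u | gamma / 2 * N <= #|nbr Gs u|%:R].

Lemma nbr_blowup u : nbr Gs u = [set v | reduced G f d dl zeta (f u) (f v)].
Proof. by []. Qed.

(** By Markov's inequality few vertices lie in a cluster with many bad partners. Any other cluster
    has average degree at least [gamma * N], of which bad and sparse pairs take at most
    [(dl + 2 * d) * N]. *)
Lemma card_typical : #|~: typical|%:R <= dl * N.
Proof.
have [rb1 rb2] := rb.
pose X := [set u : V | dl * N < #|[set v | bad (f u) (f v)]|%:R].
have cX : #|X|%:R <= dl * N.
  have : #|X|%:R * (dl * N) <= dl ^+ 2 * N ^+ 2.
    apply: le_trans rb1; rewrite -sum_pairs_cls [leRHS](bigID (mem X)) /=.
    apply: le_trans (_ : \sum_(u in X) #|[set v | bad (f u) (f v)]|%:R <= _); last first.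
      by rewrite lerDl; apply: sumr_ge0.
    by apply: sumr_ge_const => u; rewrite inE => /ltW.
  by rewrite -exprMn expr2 ler_pM2r // mulr_gt0.
apply: le_trans cX; rewrite ler_nat; apply: subset_leq_card; apply/subsetP=> u.
rewrite !inE; apply: contraR; rewrite -leNgt => hu.
set i := f u in hu *; have ui : u \in cls f i by rewrite inE.
have c0 : 0 < #|cls f i|%:R :> R by rewrite ltr0n (cardD1 u) ui.
rewrite nbr_blowup -/i; set D := #|[set v | _]|%:R.
have E1 : #|cls f i|%:R * (gamma * N) <= \sum_j eR R G (cls f i) (cls f j).
  apply: (@le_trans _ _ (\sum_(w in cls f i) #|nbr G w|%:R)); first exact: sumr_ge_const.
  rewrite /eR exchange_big /=; apply: ler_sum => w wi.
  rewrite -(setIT (nbr G w)) -card_nbrI (partition_big f xpredT) //=; apply: ler_sum => j _.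
  by rewrite le_eqVlt; apply/orP; left; apply/eqP; apply: eq_bigl => v; rewrite !inE.
have : \sum_j eR R G (cls f i) (cls f j) <= #|cls f i|%:R * (D + dl * N + 2 * d * N).
  apply: (@le_trans _ _ (\sum_j #|cls f i|%:R * (((reduced G f d dl zeta i j)%:R + (bad i j)%:R + 2 * d) * #|cls f j|%:R))).
    apply: ler_sum => j _; have nn : 0 <= #|cls f i|%:R * #|cls f j|%:R :> R by rewrite mulr_ge0.
    rewrite mulrCA.
    have := eR_le R G (cls f i) (cls f j).
    have nd : 0 <= 2 * d * (#|cls f i|%:R * #|cls f j|%:R) by rewrite !mulr_ge0 // ltW.
    move: (rb2 i j); case: (bad i j); case: (reduced _ _ _ _ _ i j) => /= h; try (by clear h; lra); have := h isT isT; lra.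
  rewrite -mulr_sumr ler_pM2l //; under eq_bigr do rewrite !mulrDl.
  rewrite !big_split /= -mulr_sumr (card_cls R f xpredT).
  have mk (P : pred K) : \sum_j (P j)%:R * #|cls f j|%:R = #|[set v | P (f v)]|%:R :> R.
    rewrite -card_cls [RHS]big_mkcond; apply: eq_bigr => j _.
    by case: (P j); rewrite ?mul1r ?mul0r.
  have -> : #|[set v | xpredT (f v)]| = #|V| by apply: eq_card => v; rewrite inE.
  by rewrite !mk -/N -/D; lra.
move/(le_trans E1); rewrite ler_pM2l // => h.
have : (dl + 2 * d) * N <= gamma / 2 * N by rewrite ler_pM2r.
by lra.
Qed.

Hypotheses (s0 : 0 < sigma) (sg : sigma <= gamma / 8) (dls : dl <= sigma).

Lemma typical_meets (S : {set V}) u : u \in typical -> (1 - sigma) * N <= #|S|%:R ->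
  exists2 v, v \in S & Gs u v.
Proof.
rewrite inE => hu hS; have := cardI_lb (nbr Gs u) S; rewrite -(ler_nat R) !natrD -/N => h.
have sN : sigma * N <= gamma / 8 * N by rewrite ler_pM2r.
have gN : 0 < gamma * N by rewrite mulr_gt0.
have : 0 < #|nbr Gs u :&: S|%:R :> R by move: hu; rewrite -/N; lra.
by rewrite ltr0n => /card_gt0P[v]; rewrite !inE => /andP[? ?]; exists v.
Qed.

(** Hall's condition holds by minimum degree for small [S], by expansion for medium [S], and by
    [typical_meets] for nearly spanning [S]. An injection of the finite set [U] into itself is a
    permutation. *)
Lemma blowup_perm (U : {set V}) : U \subset typical ->
  N - #|U|%:R <= nu / 2 * N -> N - #|U|%:R <= gamma / 4 * N ->
  exists g : V -> V, [/\ {in U &, injective g}, {in U, forall u, g u \in U} &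
    {in U, forall u, Gs u (g u)}].
Proof.
move=> sU cU1 cU2; pose r a b := Gs a b && (b \in U).
have [S sS|g [gi gr]] := @hall V V r U id.
  have [->|S0] := eqVneq S set0; first by rewrite cards0.
  have [a aS] := set0Pn _ S0.
  have cI (A B : {set V}) : #|A|%:R + #|B|%:R - N <= #|A :&: B|%:R.
    by have := cardI_lb A B; rewrite -(ler_nat R) !natrD -/N; lra.
  have [small|big] := leP (#|S|%:R : R) (gamma / 4 * N).
    rewrite -(ler_nat R); apply: le_trans small _.
    apply: (@le_trans _ _ #|nbr Gs a :&: U|%:R).
      have := cI (nbr Gs a) U; have := subsetP sU _ (subsetP sS _ aS); rewrite inE; lra.
    rewrite ler_nat; apply: subset_leq_card; apply/subsetP=> b; rewrite !inE => /andP[ab bU].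
    by apply/existsP; exists a; rewrite aS /r ab.
  have [mid|large] := leP (#|S|%:R : R) ((1 - sigma) * N).
    have gN := mulr_gt0 g0 N0.
    have sN : sigma * N <= gamma / 8 * N by rewrite ler_pM2r.
    have sS1 : sigma * N <= #|S|%:R by lra.
    have := blowup_expands (S := S); rewrite sS1 mid => /(_ isT) h.
    rewrite -(ler_nat R); apply: (@le_trans _ _ #|rnbr Gs (nu / 2) S :&: U|%:R).
      by have := cI (rnbr Gs (nu / 2) S) U; lra.
    rewrite ler_nat; apply: subset_leq_card; apply/subsetP=> b; rewrite !inE => /andP[ab bU].
    have : 0 < #|nbr Gs b :&: S|%:R :> R by apply: lt_le_trans ab; rewrite mulr_gt0 // divr_gt0.
    rewrite ltr0n => /card_gt0P[w]; rewrite !inE => /andP[bw wS].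
    by apply/existsP; exists w; rewrite wS /r bU andbT /= /Gs blowup_sym; exact: bw.
  apply: leq_trans (subset_leq_card sS) _; apply: subset_leq_card; apply/subsetP=> b bU.
  have [v vS bv] := typical_meets (subsetP sU _ bU) (ltW large).
  by rewrite inE; apply/existsP; exists v; rewrite vS /r bU andbT /= /Gs blowup_sym; exact: bv.
by exists g; split=> // u /gr/andP[].
Qed.

(** The set reached with [k] inner vertices grows by [nu / 2 * N] per step until it misses at most
    [sigma * N] vertices. From then on each step reaches every typical vertex, so the length can be
    prescribed exactly. *)
Lemma blowup_walk (t : nat) u w : 1 <= sigma + t%:R * (nu / 2) ->
  u \in typical -> w \in typical ->
  exists p : seq V, size p = t.+1 /\ path Gs u (rcons p w).
Proof.
move=> ht tu tw.
pose S k := [set w : V | `[< exists p : seq V, size p = k /\ path Gs u (rcons p w) >]].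
have inS k x : reflect (exists p : seq V, size p = k /\ path Gs u (rcons p x)) (x \in S k).
  by rewrite inE; apply: asboolP.
have nextS k x y : x \in S k -> Gs x y -> y \in S k.+1.
  move=> /inS[p [sp pp]] xy; apply/inS; exists (rcons p x); split; first by rewrite size_rcons sp.
  by rewrite rcons_path pp last_rcons.
have nu2 : 0 < nu / 2 by rewrite divr_gt0.
have cS k : Num.min (sigma * N + k%:R * (nu / 2) * N) ((1 - sigma) * N) <= #|S k|%:R.
  elim: k => [|k IH].
    rewrite ge_min; apply/orP; left; rewrite !mul0r addr0.
    have gN := mulr_gt0 g0 N0; have sN : sigma * N <= gamma / 8 * N by rewrite ler_pM2r.
    apply: (@le_trans _ _ (gamma / 2 * N)); first by lra.
    move: (tu); rewrite inE => /le_trans; apply; rewrite ler_nat; apply: subset_leq_card.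
    by apply/subsetP=> x; rewrite inE => ux; apply/inS; exists [::]; rewrite /= ux.
  have [mid|large] := leP (#|S k|%:R : R) ((1 - sigma) * N).
    have sS1 : sigma * N <= #|S k|%:R.
      apply: le_trans IH; rewrite le_min; apply/andP; split.
        rewrite lerDl; apply: mulr_ge0 (ltW N0); apply: mulr_ge0 => //; exact: ltW.
      have : #|nbr Gs u|%:R <= N by rewrite ler_nat max_card.
      move: (tu); rewrite inE -/N => h1 h2.
      have gN := mulr_gt0 g0 N0; have sN : sigma * N <= gamma / 8 * N by rewrite ler_pM2r.
      lra.
    have := blowup_expands (S := S k); rewrite sS1 mid => /(_ isT) h.
    apply: (@le_trans _ _ (#|rnbr Gs (nu / 2) (S k)|%:R)).
      apply: le_trans h; rewrite ge_min; move: IH; rewrite ge_min => /orP[IH|IH].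
        by apply/orP; left; rewrite -natr1; lra.
      apply/orP; right; apply: le_trans IH _.
      rewrite lerDl; apply: mulr_ge0 (ltW N0); exact: ltW.
    rewrite ler_nat; apply: subset_leq_card; apply/subsetP=> b; rewrite inE => ab.
    have : 0 < #|nbr Gs b :&: S k|%:R :> R by apply: lt_le_trans ab; rewrite mulr_gt0 // divr_gt0.
    rewrite ltr0n => /card_gt0P[x]; rewrite !in_setI inE => /andP[bx xS].
    by apply: nextS xS _; rewrite /Gs blowup_sym.
  rewrite ge_min; apply/orP; right; apply: (@le_trans _ _ #|typical|%:R).
    have := cardsC typical; move/(congr1 (fun k => k%:R : R)); rewrite natrD -/N.
    have := card_typical; have : dl * N <= sigma * N by rewrite ler_pM2r.
    by lra.
  rewrite ler_nat; apply: subset_leq_card; apply/subsetP=> b tb.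
  have [v vS bv] := typical_meets tb (ltW large).
  by apply: nextS vS _; rewrite /Gs blowup_sym.
have big : (1 - sigma) * N <= #|S t|%:R.
  apply: le_trans (cS t); rewrite le_min lexx andbT -mulrDl ler_pM2r //; move: s0; lra.
have [v /inS[p [sp pp]] wv] := typical_meets tw big.
exists (rcons p v); split; first by rewrite size_rcons sp.
rewrite rcons_path pp last_rcons /= /Gs blowup_sym; exact: wv.
Qed.

End ReducedExpansion.

(** * Choice of absorbers *)

Section TupleSums.
Variables (R : realType) (V : finType) (W : {set V}).

(** Unnormalised expectation over independent uniform choices from [W]; the recursion allows
    conditioning on the first coordinate. *)
Fixpoint sumk (k : nat) (g : seq V -> R) : R :=
  if k is k'.+1 then \sum_(u in W) sumk k' (fun s => g (u :: s)) else g [::].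

Definition tuple_in (k : nat) (s : seq V) : bool := (size s == k) && all (mem W) s.

Lemma sumk_le k (g h : seq V -> R) :
  (forall s, tuple_in k s -> g s <= h s) -> sumk k g <= sumk k h.
Proof.
elim: k g h => [|k IH] g h le_gh /=; first exact: le_gh.
apply: ler_sum => u uW; apply: IH => s /andP[/eqP sk sW]; apply: le_gh.
by rewrite /tuple_in /= sk eqxx uW.
Qed.

Lemma eq_sumk k (g h : seq V -> R) :
  (forall s, tuple_in k s -> g s = h s) -> sumk k g = sumk k h.
Proof. by move=> e; apply/eqP; rewrite eq_le !sumk_le // => s /e->. Qed.

Lemma sumk_lt k (g h : seq V -> R) s0 : tuple_in k s0 -> g s0 < h s0 ->
  (forall s, tuple_in k s -> g s <= h s) -> sumk k g < sumk k h.
Proof.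
elim: k g h s0 => [|k IH] g h [|u0 s0] //= /andP[/eqP[sk] /andP[uW sW]] lt0 le_gh.
have {}uW : u0 \in W := uW.
rewrite (bigD1 u0) //= [ltRHS](bigD1 u0) //=; apply: ltr_leD.
  apply: (IH _ _ s0) => //; first by rewrite /tuple_in sk eqxx.
  by move=> s /andP[/eqP ss sW']; apply: le_gh; rewrite /tuple_in /= ss eqxx uW.
apply: ler_sum => u /andP[uW' _]; apply: sumk_le => s /andP[/eqP ss sW']; apply: le_gh.
by rewrite /tuple_in /= ss eqxx uW'.
Qed.

Lemma sumk_const k (c : R) : sumk k (fun=> c) = #|W|%:R ^+ k * c.
Proof. by elim: k => [|k IH] /=; rewrite ?mul1r // sumr_const IH exprS -mulrA mulr_natl. Qed.

Lemma sumkD k (g h : seq V -> R) : sumk k (fun s => g s + h s) = sumk k g + sumk k h.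
Proof. by elim: k g h => [|k IH] g h //=; rewrite -big_split; apply: eq_bigr => u _; rewrite IH. Qed.

Lemma sumkZ k (a : R) (g : seq V -> R) : sumk k (fun s => a * g s) = a * sumk k g.
Proof. by elim: k g => [|k IH] g //=; rewrite mulr_sumr; apply: eq_bigr => u _; rewrite IH. Qed.

Lemma sumk_sum k (Y : finType) (F : Y -> seq V -> R) :
  sumk k (fun s => \sum_y F y s) = \sum_y sumk k (F y).
Proof.
elim: k F => [|k IH] F //=; rewrite exchange_big /=; apply: eq_bigr => u _.
by rewrite (IH (fun y s => F y (u :: s))).
Qed.

Lemma sumk_all k (P : pred V) :
  sumk k (fun s => (all P s)%:R) = #|[set u in W | P u]|%:R ^+ k.
Proof.
elim: k => [|k IH] /=; first by [].
rewrite exprS mulr_natl -sumr_const big_mkcond [RHS]big_mkcond; apply: eq_bigr => u _.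
rewrite inE; case: (u \in W) => //=; case: (P u) => /=; first exact: IH.
by rewrite sumk_const mulr0.
Qed.

Lemma sumk_mem k (theta : R) u : 1 <= theta * #|W|%:R ->
  sumk k (fun s => (u \in s)%:R) <= k%:R * theta * #|W|%:R ^+ k.
Proof.
move=> h; elim: k => [|k IH] /=; first by rewrite !mul0r.
have W0 : 0 <= #|W|%:R :> R by [].
apply: (@le_trans _ _ (\sum_(w in W) ((u == w)%:R * #|W|%:R ^+ k + k%:R * theta * #|W|%:R ^+ k))).
  apply: ler_sum => w _; case: (eqVneq u w) => [->|ne] /=.
    rewrite mul1r -[leLHS]addr0; apply: lerD; last first.
      by apply: le_trans IH; apply: le_trans (sumk_le (g := fun=> 0) _); rewrite ?sumk_const ?mulr0.
    rewrite -[leRHS]mulr1 -sumk_const; by apply: sumk_le => s _; case: (_ \in _) => /=; rewrite ?ler01.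
  rewrite mul0r add0r; apply: le_trans IH; apply: sumk_le => s _.
  by rewrite inE (negbTE ne).
rewrite big_split /= sumr_const -mulr_suml.
have : \sum_(w in W) (u == w)%:R <= 1 :> R.
  rewrite (bigID (pred1 u)) /= [X in _ + X]big1 ?addr0; last by move=> w /andP[_]; rewrite eq_sym => /negbTE->.
  rewrite big_mkcondl big_pred1_eq; case: ifP => _; rewrite ?eqxx //; exact: ler01.
rewrite -[X in _ + X]mulr_natl exprS -natr1 => h1.
have h2 : (\sum_(w in W) (u == w)%:R) * #|W|%:R ^+ k <= theta * #|W|%:R * #|W|%:R ^+ k.
  by apply: ler_wpM2r; rewrite ?exprn_ge0 // (le_trans h1).
apply: le_trans (lerD h2 (lexx _)) _.
by rewrite le_eqVlt; apply/orP; left; apply/eqP; ring.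
Qed.

(** Union bound over repetitions of each coordinate; [theta] bounds the chance [1 / #|W|] of a
    single coincidence. *)
Lemma sumk_uniq k (theta : R) : 0 <= theta -> 1 <= theta * #|W|%:R ->
  sumk k (fun s => (~~ uniq s)%:R) <= k%:R ^+ 2 * theta * #|W|%:R ^+ k.
Proof.
move=> t0 h; elim: k => [|k IH] /=; first by rewrite expr2 !mul0r.
apply: (@le_trans _ _ (\sum_(w in W) (k%:R * theta * #|W|%:R ^+ k + k%:R ^+ 2 * theta * #|W|%:R ^+ k))).
  apply: ler_sum => w _; apply: le_trans (lerD (sumk_mem k w h) IH).
  rewrite -sumkD; apply: sumk_le => s _; rewrite negb_and negbK.
  by case: (w \in s); case: (uniq s); rewrite /= ?addr0 ?add0r // lerDl.
rewrite sumr_const -[leLHS]mulr_natl [#|W|%:R ^+ k.+1]exprS -natr1.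
have : 0 <= k.+1%:R * theta * (#|W|%:R * #|W|%:R ^+ k) by rewrite !mulr_ge0 ?exprn_ge0.
by rewrite -natr1; lra.
Qed.

End TupleSums.

(* Each [y] carries the weight [alpha y * (1/2)^hits / (1-p/4)^relevant] and each [z] the weight
   [beta z * Lam^bad / 4^steps]; averaged over the good tuples the total never increases, so at
   every step some good tuple keeps it from growing. *)
Lemma tuple_choice_weighted (R : realType) (V X Y Z : finType) (av : X -> {set V}) (k : nat) (cap : X -> nat)
  (good : X -> seq V -> bool) (ry : X -> Y -> bool) (hit : X -> Y -> seq V -> bool)
  (rz : X -> Z -> bool) (bad : X -> Z -> seq V -> bool) (p Lam : R) (P : pred X) :
  0 < p <= 1 -> 1 <= Lam ->
  (forall x (U : {set V}), P x -> (#|U :&: av x| <= cap x)%N -> let W := av x :\: U in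
    [/\ (0 < #|W|)%N, sumk W k (fun s => (~~ good x s)%:R) <= p / 4 * #|W|%:R ^+ k,
     forall y, ry x y -> p * #|W|%:R ^+ k <= sumk W k (fun s => (hit x y s)%:R) &
     forall z, rz x z -> sumk W k (fun s => (bad x z s)%:R) <= Lam^-1 * #|W|%:R ^+ k]) ->
  forall (I : seq X) (U : {set V}) (alpha : Y -> R) (beta : Z -> R),
  uniq I -> all P I ->
  (forall y, 0 <= alpha y) -> (forall z, 0 <= beta z) ->
  (forall x, x \in I -> (#|U :&: av x| + k * count (fun x' => ~~ [disjoint av x & av x']) I <= cap x)%N) ->
  exists s : X -> seq V, [/\ {in I, forall x, tuple_in (av x :\: U) k (s x) /\ good x (s x)},
    {in I &, forall x y, x != y -> [disjoint s x & s y]} &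
    \sum_y alpha y * ((1 / 2) ^+ count (fun x => ry x y && hit x y (s x)) I / (1 - p / 4) ^+ count (ry^~ y) I)
    + \sum_z beta z * (Lam ^+ count (fun x => rz x z && bad x z (s x)) I / 4 ^+ size I)
    <= \sum_y alpha y + \sum_z beta z].
Proof.
move=> /andP[p0 p1] L1 hyp; have L0 : 0 < Lam by apply: lt_le_trans L1.
elim=> [|x I IH] U alpha beta.
  move=> _ _ a0 b0 _; exists (fun=> [::]); split=> //=.
  by apply: lerD; apply: ler_sum => y _; rewrite divr1 mulr1.
rewrite cons_uniq => /andP[xI uI] /= /andP[Px PI] a0 b0 hcap.
have cx : (#|U :&: av x| <= cap x)%N by apply: leq_trans (leq_addr _ _) (hcap x (mem_head _ _)).
have [W0 Hgood Hhit Hbad] := hyp x U Px cx; set W := av x :\: U in W0 Hgood Hhit Hbad.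
have g0 : 0 < 1 - p / 4 by lra.
pose fa y s : R := if ry x y then (1 / 2) ^+ hit x y s / (1 - p / 4) else 1.
pose fb z s : R := (if rz x z then Lam ^+ bad x z s else 1) / 4.
pose Phi s := \sum_y alpha y * fa y s + \sum_z beta z * fb z s.
pose Phi0 := \sum_y alpha y + \sum_z beta z.
have Wk0 : 0 < #|W|%:R ^+ k :> R by rewrite exprn_gt0 // ltr0n.
pose Gk := sumk W k (fun s => (good x s)%:R) : R.
have GkE : Gk + sumk W k (fun s => (~~ good x s)%:R) = #|W|%:R ^+ k.
  rewrite -sumkD -[RHS]mulr1 -sumk_const; apply: eq_sumk => s _.
  by case: (good x s); rewrite /= ?addr0 ?add0r.
have Gk_lb : (1 - p / 4) * #|W|%:R ^+ k <= Gk by move: Hgood GkE; lra.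
(* A hit has probability at least [p], so the factor averages to at most
   [(1 - p / 2) / (1 - p / 4) <= 1 - p / 4], which is at most the share of the good tuples. *)
have Ea y : sumk W k (fun s => (good x s)%:R * fa y s) <= Gk.
  rewrite /fa; case ryx: (ry x y); last by apply: sumk_le => s _; rewrite mulr1.
  apply: (@le_trans _ _ (sumk W k (fun s => (1 - p / 4)^-1 * (1 + (- (1/2)) * (hit x y s)%:R)))).
    apply: sumk_le => s _; have : 0 < (1 - p / 4)^-1 by rewrite invr_gt0.
    move: (_^-1) => gi gi0.
    by case: (good x s); case: (hit x y s); rewrite /= ?expr0 ?expr1; lra.
  rewrite sumkZ sumkD sumkZ sumk_const mulr1 ler_pdivrMl //.
  have := Hhit y ryx; move: (sumk W k _) => h hh.
  apply: (@le_trans _ _ ((1 - p / 2) * #|W|%:R ^+ k)); first by lra.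
  apply: (@le_trans _ _ ((1 - p / 4) * ((1 - p / 4) * #|W|%:R ^+ k))); last by rewrite ler_pM2l.
  by rewrite mulrA ler_pM2r //; nra.
(* The factor [Lam] occurs with probability at most [1 / Lam], so the average is at most
   [(1 + 1) / 4], again below the share of the good tuples. *)
have Eb z : sumk W k (fun s => (good x s)%:R * fb z s) <= Gk.
  have h34 : 1 / 2 * #|W|%:R ^+ k <= Gk by apply: le_trans Gk_lb; rewrite ler_pM2r //; lra.
  rewrite /fb; case rzx: (rz x z); last first.
    by apply: sumk_le => s _; case: (good x s) => /=; lra.
  apply: (@le_trans _ _ (sumk W k (fun s => 1 / 4 * (1 + Lam * (bad x z s)%:R)))).
    apply: sumk_le => s _; case: (good x s); case: (bad x z s); rewrite /= ?expr0 ?expr1; lra.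
  rewrite sumkZ sumkD sumkZ sumk_const mulr1.
  have : Lam * sumk W k (fun s => (bad x z s)%:R) <= #|W|%:R ^+ k.
    by rewrite -ler_pdivlMl //; exact: Hbad.
  by lra.
have tot : sumk W k (fun s => (good x s)%:R * Phi s) <= sumk W k (fun s => (good x s)%:R * Phi0).
  rewrite [leLHS](_ : _ = \sum_y alpha y * sumk W k (fun s => (good x s)%:R * fa y s) +
     \sum_z beta z * sumk W k (fun s => (good x s)%:R * fb z s)); last first.
    under eq_bigr do rewrite -sumkZ; under [X in _ + X]eq_bigr do rewrite -sumkZ.
    rewrite -!sumk_sum -sumkD; apply: eq_sumk => s _; rewrite mulrDr !mulr_sumr.
    by congr (_ + _); apply: eq_bigr => y _; rewrite mulrCA.
  rewrite [leRHS](_ : _ = \sum_y alpha y * Gk + \sum_z beta z * Gk); last first.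
    rewrite -!mulr_suml -mulrDl -/Phi0 -sumkZ; apply: eq_sumk => s _; exact: mulrC.
  by apply: lerD; apply: ler_sum => ? _; apply: ler_wpM2l.
have [s0 [s0W s0g s0P]] : exists s0, [/\ tuple_in W k s0, good x s0 & Phi s0 <= Phi0].
  apply: contrapT => no.
  have lt s : tuple_in W k s -> good x s -> Phi0 < Phi s.
    by move=> sW sg; rewrite ltNge; apply/negP=> le; apply: no; exists s.
  have [s1 [s1W s1g]] : exists s1, tuple_in W k s1 /\ good x s1.
    apply: contrapT => no'; have : Gk <= sumk W k (fun=> 0).
      apply: sumk_le => s sW; case: (boolP (good x s)) => // sg.
      by case: no'; exists s.
    rewrite sumk_const mulr0; apply/negP; rewrite -ltNge; apply: lt_le_trans Gk_lb.
    exact: mulr_gt0.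
  move: tot; apply/negP; rewrite -ltNge; apply: (sumk_lt s1W).
    by rewrite s1g !mul1r lt.
  move=> s sW; case: (boolP (good x s)) => sg; last by rewrite !mul0r.
  by rewrite !mul1r ltW // lt.
pose U' := U :|: [set u in s0].
have szs0 : size s0 = k by case/andP: s0W => /eqP.
have s0av u : u \in s0 -> u \in av x /\ u \notin U.
  by case/andP: s0W => _ /allP h /h; rewrite /= inE => /andP[].
(* If the pools of [x'] and [x] meet, the [k] vertices of [s0] may block the former, but [x] no
   longer counts among the conflicts of [x']: the capacity is unchanged. *)
have hcap' x' : x' \in I ->
    (#|U' :&: av x'| + k * count (fun x'' => ~~ [disjoint av x' & av x'']) I <= cap x')%N.
  move=> x'I; have := hcap x'; rewrite inE x'I orbT /= => /(_ isT); apply: leq_trans.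
  case: (boolP [disjoint av x' & av x]) => dis; rewrite /= mulnDr ?muln0 ?muln1 ?add0n.
    rewrite leq_add2r; apply: subset_leq_card; apply/subsetP=> u; rewrite !inE.
    case/andP=> /orP[->//|/s0av[ux _]] ux'.
    by have /pred0P/(_ u) := dis; rewrite /= ux ux'.
  rewrite addnA leq_add2r /U' setIUl (leq_trans (leq_card_setU _ _)) // leq_add2l.
  rewrite (leq_trans (subset_leq_card (subsetIl _ _))) // -szs0 cardsE.
  exact: card_size.
have a0' y : 0 <= alpha y * fa y s0.
  by rewrite mulr_ge0 // /fa; case: ifP => // _; rewrite divr_ge0 ?exprn_ge0 // ?ltW //; lra.
have b0' z : 0 <= beta z * fb z s0.
  by rewrite mulr_ge0 // /fb divr_ge0 //; case: ifP => // _; rewrite exprn_ge0 // ltW.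
have [s [sI sd sPhi]] := IH U' _ _ uI PI a0' b0' hcap'.
have ne_x x' : x' \in I -> (x' == x) = false by move=> x'I; apply/negbTE; apply: contraNneq xI => <-.
pose s' x' := if x' == x then s0 else s x'.
have s'E x' : x' \in I -> s' x' = s x' by move=> /ne_x h; rewrite /s' h.
have dis0 x' : x' \in I -> [disjoint s0 & s x'].
  move=> /sI[/andP[_ /allP h] _]; apply/pred0P=> u /=; apply/negP=> /andP[u0 /h].
  by rewrite /= !inE u0 orbT.
exists s'; split.
- move=> x'; rewrite inE => /orP[/eqP->|x'I]; first by rewrite /s' eqxx.
  rewrite s'E //; have [/andP[sz sa] sg] := sI _ x'I; split=> //; rewrite /tuple_in sz /=.
  by apply: sub_all sa => u; rewrite /= !inE negb_or -andbA => /and3P[-> _ ->].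
- move=> x1 x2; rewrite !inE => /orP[/eqP->|x1I] /orP[/eqP->|x2I]; rewrite ?eqxx // => ne.
  + by rewrite (s'E x2) // {1}/s' eqxx dis0.
  + by rewrite (s'E x1) // {1}/s' eqxx disjoint_sym dis0.
  + by rewrite !s'E // sd.
apply: le_trans s0P; apply: le_trans sPhi.
have e1 y : ((ry x y && hit x y (s' x)) + count (fun x' => ry x' y && hit x' y (s' x')) I)%N =
    ((ry x y && hit x y s0) + count (fun x' => ry x' y && hit x' y (s x')) I)%N.
  rewrite /= {1}/s' eqxx; congr (_ + _)%N; apply: eq_in_count => x' x'I; by rewrite s'E.
have e2 z : ((rz x z && bad x z (s' x)) + count (fun x' => rz x' z && bad x' z (s' x')) I)%N =
    ((rz x z && bad x z s0) + count (fun x' => rz x' z && bad x' z (s x')) I)%N.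
  rewrite /= {1}/s' eqxx; congr (_ + _)%N; apply: eq_in_count => x' x'I; by rewrite s'E.
rewrite le_eqVlt; apply/orP; left; apply/eqP; congr (_ + _); apply: eq_bigr => y _.
  rewrite e1 -mulrA; congr (_ * _); rewrite /fa /= !exprD; case: (ry x y) => /=.
    by rewrite expr1 invfM mulrACA.
  by rewrite !expr0 !mul1r.
rewrite e2 -mulrA; congr (_ * _); rewrite /fb /= exprD exprS invfM mulrACA; congr (_ * _).
by case: (rz x y).
Qed.

Lemma sumr_ind (R : realType) (V : finType) (A : {set V}) (P : pred V) :
  \sum_(u in A) (P u)%:R = #|[set u in A | P u]|%:R :> R.
Proof.
rewrite -natr_sum -sum1_card big_mkcond [in RHS]big_mkcond; congr (_%:R).
by apply: eq_bigr => u _; rewrite inE; case: (u \in A) => //=; case: (P u).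
Qed.

Section CommonNeighbours.
Variables (R : realType) (V : finType) (G : rel V).

Fixpoint cnb (T : {set V}) (m : bitseq) (s : seq V) : {set V} :=
  match m, s with
  | b :: m', u :: s' => cnb (if b then nbr G u :&: T else T) m' s'
  | _, _ => T
  end.

Lemma in_cnb T m s v : (v \in cnb T m s) = (v \in T) && all (fun u => G u v) (mask m s).
Proof.
elim: m s T => [|b m IH] [|u s] T; rewrite ?mask0 ?andbT //= IH.
by case: b => //=; rewrite !inE andbAC [RHS]andbCA andbA andbAC.
Qed.

(** What the tuple argument takes from regularity. The threshold [c] is absolute, so the property
    passes to the smaller sets that arise as coordinates are exposed. *)
Definition thick (d e c : R) (D T : {set V}) : Prop := forall T' : {set V}, T' \subset T -> c <= #|T'|%:R ->
  #|[set u in D | #|nbr G u :&: T'|%:R < d * #|T'|%:R]|%:R <= e * #|D|%:R.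

Lemma thick_sub (d e e' c : R) (D W T : {set V}) : W \subset D ->
  e * #|D|%:R <= e' * #|W|%:R -> thick d e c D T -> thick d e' c W T.
Proof.
move=> sW le_e th T' sT cT; apply: le_trans (le_trans (th T' sT cT) le_e).
by rewrite ler_nat; apply: subset_leq_card; apply/subsetP=> u; rewrite !inE => /andP[/(subsetP sW)->].
Qed.

(** Expose the coordinates one by one. Each is atypical with probability at most [e], and otherwise
    shrinks the current set by at most the factor [d]; the bound on [c] keeps the set above the
    threshold through all [k] steps. *)
Lemma sumk_cnb (d e c : R) (W T0 : {set V}) k m (T : {set V}) : 0 < d <= 1 -> 0 <= e ->
  thick d e c W T0 -> T \subset T0 -> c <= d ^+ k * #|T|%:R ->
  sumk W k (fun s => (#|cnb T m s|%:R < d ^+ count id m * #|T|%:R)%R%:R) <= k%:R * e * #|W|%:R ^+ k.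
Proof.
move=> /andP[d0 d1] e0 th; elim: k m T => [|k IH] m T sT cT /=.
  rewrite !mul0r; have -> : cnb T m [::] = T by case: m => // -[].
  by rewrite ltNge ler_piMl // exprn_ile1 // ltW.
have Wk0 : 0 <= #|W|%:R ^+ k :> R by rewrite exprn_ge0.
have cT' : c <= d ^+ k * #|T|%:R.
  apply: le_trans cT _; apply: ler_wpM2r => //; rewrite exprS ger_pMl ?exprn_gt0 //.
have cst : \sum_(u in W) k%:R * e * #|W|%:R ^+ k <= k.+1%:R * e * #|W|%:R ^+ k.+1.
  rewrite sumr_const -[leLHS]mulr_natl exprS -natr1.
  have : 0 <= e * (#|W|%:R * #|W|%:R ^+ k) by rewrite !mulr_ge0.
  lra.
case: m => [|[] m] /=.
- apply: le_trans cst; apply: ler_sum => u _; apply: le_trans (IH [::] T sT cT').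
  by apply: sumk_le => s _.
- apply: (@le_trans _ _ (\sum_(u in W) (k%:R * e * #|W|%:R ^+ k +
     (#|nbr G u :&: T|%:R < d * #|T|%:R)%R%:R * #|W|%:R ^+ k))).
    apply: ler_sum => u _; have [lo|hi] := boolP (#|nbr G u :&: T|%:R < d * #|T|%:R)%R.
      rewrite mul1r -[leLHS]add0r; apply: lerD; first by rewrite !mulr_ge0.
      by rewrite -[leRHS]mulr1 -sumk_const; apply: sumk_le => s _; rewrite lern1 leq_b1.
    rewrite mul0r addr0; rewrite -leNgt in hi.
    have sT1 : nbr G u :&: T \subset T0 by apply: subset_trans sT; exact: subsetIr.
    have cT1 : c <= d ^+ k * #|nbr G u :&: T|%:R.
      by apply: le_trans cT _; rewrite exprSr -mulrA; apply: ler_wpM2l hi; rewrite exprn_ge0 // ltW.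
    apply: le_trans (IH m _ sT1 cT1); apply: sumk_le => s _; rewrite ler_nat.
    have h : d ^+ (1 + count id m) * #|T|%:R <= d ^+ count id m * #|nbr G u :&: T|%:R.
      by rewrite exprSr -mulrA; apply: ler_wpM2l hi; rewrite exprn_ge0 // ltW.
    by case: (ltP #|_|%:R (d ^+ (1 + _) * _)) => // /lt_le_trans/(_ h) ->.
  rewrite big_split /=.
  have cT0 : c <= #|T|%:R.
    by apply: le_trans cT _; rewrite ler_piMl // exprn_ile1 // ltW.
  have : (\sum_(u in W) (#|nbr G u :&: T|%:R < d * #|T|%:R)%R%:R) * #|W|%:R ^+ k
      <= e * #|W|%:R * #|W|%:R ^+ k.
    apply: ler_wpM2r => //; apply: le_trans (th T sT cT0).
    by rewrite (sumr_ind R W (fun u => #|nbr G u :&: T|%:R < d * #|T|%:R)).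
  rewrite mulr_suml => h; apply: le_trans (lerD (lexx _) h) _.
  rewrite sumr_const -[X in X + _]mulr_natl exprS -natr1.
  by rewrite le_eqVlt; apply/orP; left; apply/eqP; ring.
- by rewrite add0n; apply: le_trans cst; apply: ler_sum => u _; exact: IH.
Qed.

End CommonNeighbours.

(** Weakened to the constants of [reduced_nbrs_thick], so that both kinds of constraint can be
    treated together. *)
Lemma low_regular_thick (R : realType) (V : finType) (G : rel V) (d dl : R) (D C T : {set V}) :
  0 < d -> 0 <= dl -> low_regular G d dl D C -> T \subset C ->
  thick G (d / 2) (4 * dl) (dl * #|C|%:R) D T.
Proof.
move=> d0 dl0 /forallP lr sT T' sT' cT'; have := lr T'.
rewrite (subset_trans sT' sT) cT' /= => h.
apply: le_trans (le_trans h _); last by rewrite ler_wpM2r //; lra.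
rewrite ler_nat; apply: subset_leq_card; apply/subsetP=> u; rewrite !inE => /andP[-> /=].
by move/lt_le_trans; apply; apply: ler_wpM2r => //; lra.
Qed.

(** Clusters containing at least a [dl]-fraction of themselves in [T'] carry three quarters of [T'].
    In each of them at least three quarters of the supposed exceptional set [A] have proportion [d],
    so the density from [A] to [T'] is at least [9 / 16 * d], above [d / 2]. *)
Lemma reduced_nbrs_thick (R : realType) (V : finType) (G : rel V) (K : finType) (f : V -> K)
    (d dl zeta : R) (i : K) (T : {set V}) : 0 < d -> 0 < dl -> (0 < #|V|)%N ->
  T \subset [set v | reduced G f d dl zeta i (f v)] ->
  thick G (d / 2) (4 * dl) (4 * dl * #|V|%:R) (cls f i) T.
Proof.
move=> d0 dl0 V0 sT T' sT' cT'; set D := cls f i; set A := [set u in D | _].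
rewrite leNgt; apply/negP=> bigA.
have N0 : 0 < #|V|%:R :> R by rewrite ltr0n.
have A0 : 0 < #|A|%:R :> R by apply: le_lt_trans bigA; rewrite !mulr_ge0 // ltW.
have T0 : 0 < #|T'|%:R :> R by apply: lt_le_trans cT'; rewrite !mulr_gt0.
pose big j := dl * #|cls f j|%:R <= #|T' :&: cls f j|%:R.
have splitT : \sum_j #|T' :&: cls f j|%:R = #|T'|%:R :> R.
  rewrite -natr_sum; congr (_%:R); rewrite -sum1_card (partition_big f xpredT) //=.
  by apply: eq_bigr => j _; rewrite -sum1_card; apply: eq_bigl => v; rewrite !inE.
have total : \sum_j #|cls f j|%:R = #|V|%:R :> R.
  by rewrite card_cls; congr (_%:R); apply: eq_card => v; rewrite inE.
have bigsum : 3 / 4 * #|T'|%:R <= \sum_(j | big j) #|T' :&: cls f j|%:R :> R.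
  have : \sum_(j | ~~ big j) #|T' :&: cls f j|%:R <= dl * #|V|%:R.
    apply: (@le_trans _ _ (\sum_(j | ~~ big j) dl * #|cls f j|%:R)).
      by apply: ler_sum => j; rewrite -ltNge => /ltW.
    rewrite -total mulr_sumr [leRHS](bigID big) /= lerDr.
    by apply: sumr_ge0 => j _; rewrite mulr_ge0 // ltW.
  have : \sum_(j | big j) #|T' :&: cls f j|%:R + \sum_(j | ~~ big j) #|T' :&: cls f j|%:R = #|T'|%:R :> R.
    by rewrite -splitT [RHS](bigID big).
  move: cT'; lra.
have dle j : big j -> #|T' :&: cls f j|%:R * (d * (3 / 4 * #|A|%:R)) <=
    \sum_(u in A) #|nbr G u :&: (T' :&: cls f j)|%:R.
  move=> bj; have [T0j|[v vT]] := set_0Vmem (T' :&: cls f j).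
    by rewrite T0j cards0 mul0r; apply: sumr_ge0.
  have : reduced G f d dl zeta i j.
    move: vT; rewrite !inE => /andP[/(subsetP sT')/(subsetP sT)].
    by rewrite inE => + /eqP <-.
  case/and4P=> /forallP/(_ (T' :&: cls f j)); rewrite subsetIr -/(big j) bj /= -/D.
  set B := [set u in D | _] => cB _ _ _.
  have cAB : 3 / 4 * #|A|%:R <= #|A :\: B|%:R :> R.
    have : (#|A| <= #|A :\: B| + #|B|)%N.
      by rewrite -(cardsID B A) addnC leq_add2l subset_leq_card ?subsetIr.
    by rewrite -(ler_nat R) natrD; lra.
  apply: (@le_trans _ _ (\sum_(u in A :\: B) #|nbr G u :&: (T' :&: cls f j)|%:R)).
    apply: (@le_trans _ _ (#|A :\: B|%:R * (d * #|T' :&: cls f j|%:R))).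
      have : 3 / 4 * #|A|%:R * (d * #|T' :&: cls f j|%:R) <= #|A :\: B|%:R * (d * #|T' :&: cls f j|%:R).
        by apply: ler_wpM2r => //; rewrite mulr_ge0 // ltW.
      lra.
    apply: sumr_ge_const => u; rewrite !inE -/D => /andP[uB /andP[uD _]].
    by move: uB; rewrite uD -leNgt.
  rewrite [leRHS](big_setID B) /= lerDr; exact: sumr_ge0.
have le1 : \sum_(u in A) #|nbr G u :&: T'|%:R <= #|A|%:R * (d / 2 * #|T'|%:R).
  by apply: sumr_le_const => u; rewrite inE => /andP[_ /ltW].
have le2 : \sum_(j | big j) \sum_(u in A) #|nbr G u :&: (T' :&: cls f j)|%:R
    <= \sum_(u in A) #|nbr G u :&: T'|%:R :> R.
  rewrite exchange_big /=; apply: ler_sum => u _.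
  rewrite -(_ : \sum_j #|nbr G u :&: (T' :&: cls f j)|%:R = #|nbr G u :&: T'|%:R); last first.
    rewrite -natr_sum; congr (_%:R); rewrite -sum1_card (partition_big f xpredT) //=.
    by apply: eq_bigr => j _; rewrite -sum1_card; apply: eq_bigl => v; rewrite !inE andbA.
  by rewrite [leRHS](bigID big) /= lerDl; apply: sumr_ge0 => j _; exact: ler0n.
have le3 : (\sum_(j | big j) #|T' :&: cls f j|%:R) * (d * (3 / 4 * #|A|%:R)) <=
   \sum_(j | big j) \sum_(u in A) #|nbr G u :&: (T' :&: cls f j)|%:R.
  by rewrite mulr_suml; apply: ler_sum => j; exact: dle.
have le4 : 3 / 4 * #|T'|%:R * (d * (3 / 4 * #|A|%:R)) <=
  (\sum_(j | big j) #|T' :&: cls f j|%:R) * (d * (3 / 4 * #|A|%:R)).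
  by apply: ler_wpM2r bigsum; have := mulr_gt0 d0 A0; lra.
have := le_trans le4 (le_trans le3 (le_trans le2 le1)).
have : 0 < d * #|A|%:R * #|T'|%:R by rewrite !mulr_gt0.
lra.
Qed.

Lemma sumr_ge_term (R : realType) (Y : finType) (F : Y -> R) (y : Y) :
  (forall i, 0 <= F i) -> F y <= \sum_i F i.
Proof. by move=> F0; rewrite (bigD1 y) //= lerDl; apply: sumr_ge0 => i _. Qed.

(** The size threshold of [reduced_nbrs_thick], enlarged by what [k] exposed coordinates can
    consume. *)
Definition sees (R : realType) (V K : finType) (G : rel V) (f : V -> K) (d dl zeta : R) (k : nat)
    (i : K) (F : {set V}) : bool :=
  4 * dl * #|V|%:R <= (d / 2) ^+ k * #|F :&: [set v | reduced G f d dl zeta i (f v)]|%:R.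

(** An application of [tuple_choice_weighted] whose tests are the vertices and the sets of vertices
    of [G]. With initial weights [#|V|%:R^-1] and [(2 ^+ #|V|)^-1] the total is 2, so every single
    test yields one of the last two bounds. *)
Lemma absorbers (R : realType) (V X K : finType) (G : rel V) (f : V -> K) (lab : X -> K)
    (av : K -> {set V}) (I : seq X) (k Kc : nat) (cons : X -> seq ({set V} * bitseq))
    (d dl zeta gamma p Lam : R) :
  symmetric G -> 0 < d <= 1 -> 0 < dl -> 0 < gamma <= 1 -> 0 < p <= 1 -> p <= (gamma / 4) ^+ k -> 1 <= Lam ->
  k%:R * (8 * dl) <= Lam^-1 -> Kc%:R * (k%:R * (8 * dl)) <= p / 8 ->
  (forall i, av i \subset cls f i) -> uniq I ->
  (forall x, x \in I -> #|cls f (lab x)|%:R - #|av (lab x)|%:R + (k * count (fun x' => lab x' == lab x) I)%:R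
     <= gamma / 4 * #|cls f (lab x)|%:R) ->
  (forall x, x \in I -> 16 * k.+1%:R ^+ 2 <= p * #|cls f (lab x)|%:R) ->
  (forall x, x \in I -> (size (cons x) <= Kc)%N) ->
  (forall x Tm, x \in I -> Tm \in cons x ->
     exists2 c, thick G (d / 2) (4 * dl) c (cls f (lab x)) Tm.1 & c <= (d / 2) ^+ k * #|Tm.1|%:R) ->
  exists s : X -> seq V, [/\
    {in I, forall x, [/\ tuple_in (av (lab x)) k (s x), uniq (s x) &
       forall Tm, Tm \in cons x -> (d / 2) ^+ count id Tm.2 * #|Tm.1|%:R <= #|cnb G Tm.1 Tm.2 (s x)|%:R]},
    {in I &, forall x y, x != y -> [disjoint s x & s y]},
    forall v, (1 / 2) ^+ count (fun x => all (fun u => G u v) (s x)) I <=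
      2 * #|V|%:R * (1 - p / 4) ^+
        count (fun x => gamma / 2 * #|cls f (lab x)|%:R <= #|nbr G v :&: cls f (lab x)|%:R) I &
    forall F : {set V}, Lam ^+ count (fun x => sees G f d dl zeta k (lab x) F &&
        [forall v in F, ~~ all (fun u => G u v) (s x)]) I <= 2 * 2 ^+ #|V| * 4 ^+ size I].
Proof.
move=> sG /andP[d0 d1] dl0 /andP[g0 g1] /andP[p0 p1] pg L1 kdlL KcP avs uI pool big cK cT.
have L0 : 0 < Lam by apply: lt_le_trans L1.
have d20 : 0 < d / 2 <= 1 by lra.
have [V0|V0] := posnP #|V|.
  have noV (v : V) : False by have := card0_eq V0 v; rewrite inE.
  have I0 x : x \in I -> False.
    move=> xI; have := big x xI.
    have -> : #|cls f (lab x)| = 0%N by apply/eqP; rewrite -leqn0 -V0 max_card.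
    rewrite mulr0; apply/negP; rewrite -ltNge mulr_gt0 // exprn_gt0 //.
  exists (fun=> [::]); split.
  - by move=> x /I0.
  - by move=> x y /I0.
  - by move=> v; have := noV v.
  - have -> : I = [::] by case: (I) I0 => // x s /(_ x (mem_head _ _)).
    by move=> F; rewrite /= V0 !expr0 !mulr1 ler1n.
have N0 : 0 < #|V|%:R :> R by rewrite ltr0n.
pose good x s := uniq s && all (fun Tm : {set V} * bitseq =>
   (d / 2) ^+ count id Tm.2 * #|Tm.1|%:R <= #|cnb G Tm.1 Tm.2 s|%:R) (cons x).
pose ry x v := gamma / 2 * #|cls f (lab x)|%:R <= #|nbr G v :&: cls f (lab x)|%:R.
pose hit (x : X) v s := all (fun u => G u v) s.
pose rz x F := sees G f d dl zeta k (lab x) F.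
pose bad (x : X) (F : {set V}) s := [forall v in F, ~~ all (fun u => G u v) s].
pose avx x := av (lab x).
pose cap x := (k * count (fun x' => ~~ [disjoint avx x & avx x']) I)%N.
have cap_le x : (cap x <= k * count (fun x' => lab x' == lab x) I)%N.
  rewrite leq_mul2l; apply/orP; right; apply: sub_count => x' /pred0Pn[v /andP[/= v1 v2]].
  have := subsetP (avs _) _ v1; have := subsetP (avs _) _ v2.
  by rewrite !inE => /eqP<- /eqP<-.
have step x (U : {set V}) : x \in I -> (#|U :&: avx x| <= cap x)%N -> let W := avx x :\: U in
    [/\ (0 < #|W|)%N, sumk W k (fun s => (~~ good x s)%:R) <= p / 4 * #|W|%:R ^+ k,
     forall y, ry x y -> p * #|W|%:R ^+ k <= sumk W k (fun s => (hit x y s)%:R) &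
     forall z, rz x z -> sumk W k (fun s => (bad x z s)%:R) <= Lam^-1 * #|W|%:R ^+ k].
  move=> xI cU W; set D := cls f (lab x).
  have WD : W \subset D by apply: subset_trans (subsetDl _ _) (avs _).
  have cW : (1 - gamma / 4) * #|D|%:R <= #|W|%:R.
    have h1 : (#|avx x| <= #|W| + k * count (fun x' => lab x' == lab x) I)%N.
      rewrite -(cardsID U (avx x)) addnC leq_add2l setIC.
      exact: leq_trans cU (cap_le x).
    move: h1 (pool x xI); rewrite -(ler_nat R) natrD -/(avx x) -/D; lra.
  have bigx : 16 * k.+1%:R ^+ 2 <= p * #|D|%:R := big x xI.
  have k10 : 0 < k.+1%:R ^+ 2 :> R by rewrite exprn_gt0.
  have D0 : 0 < #|D|%:R :> R.
    by rewrite -(pmulr_rgt0 _ p0); apply: lt_le_trans bigx; rewrite mulr_gt0.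
  have W2 : #|D|%:R <= 2 * #|W|%:R :> R.
    have : gamma * #|D|%:R <= 1 * #|D|%:R by rewrite ler_pM2r.
    lra.
  have W0 : 0 < #|W|%:R :> R by lra.
  have Wk0 : 0 < #|W|%:R ^+ k :> R by rewrite exprn_gt0.
  have eW : 4 * dl * #|D|%:R <= 8 * dl * #|W|%:R by have := ler_wpM2l (ltW dl0) W2; lra.
  have k8 : 0 <= k%:R * (8 * dl) by rewrite !mulr_ge0 // ltW.
  split; first by rewrite -(ltr_nat R).
  - apply: (@le_trans _ _ (sumk W k (fun s => (~~ uniq s)%:R + \sum_(Tm <- cons x)
       (#|cnb G Tm.1 Tm.2 s|%:R < (d / 2) ^+ count id Tm.2 * #|Tm.1|%:R)%R%:R))).
      apply: sumk_le => s _; rewrite /good; case: (uniq s) => /=; last first.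
        by rewrite lerDl; apply: sumr_ge0.
      rewrite add0r; elim: (cons x) => [|Tm l IH]; first by rewrite big_nil.
      rewrite big_cons /= ltNge; case: ((d / 2) ^+ _ * _ <= _) => /=; first by rewrite add0r.
      by rewrite lerDl; apply: sumr_ge0.
    rewrite sumkD.
    have u1 : sumk W k (fun s => (~~ uniq s)%:R) <= p / 8 * #|W|%:R ^+ k.
      apply: le_trans (sumk_uniq (theta := #|W|%:R^-1) k _ _) _; rewrite ?invr_ge0 ?mulVf ?gt_eqF //.
      rewrite ler_pM2r // ler_pdivrMr //.
      have : k%:R ^+ 2 <= k.+1%:R ^+ 2 :> R by rewrite ler_pXn2r ?nnegrE ?ler_nat.
      have := ler_wpM2l (ltW p0) W2; lra.
    have u2 (l : seq ({set V} * bitseq)) : {subset l <= cons x} ->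
        sumk W k (fun s => \sum_(Tm <- l)
       (#|cnb G Tm.1 Tm.2 s|%:R < (d / 2) ^+ count id Tm.2 * #|Tm.1|%:R)%R%:R)
       <= (size l)%:R * (k%:R * (8 * dl)) * #|W|%:R ^+ k.
      elim: l => [|Tm l IH] sl.
        rewrite (eq_sumk (h := fun=> 0)) ?sumk_const ?mulr0 ?mul0r // => s _; exact: big_nil.
      rewrite (eq_sumk (h := fun s => (#|cnb G Tm.1 Tm.2 s|%:R < (d / 2) ^+ count id Tm.2 * #|Tm.1|%:R)%R%:R
        + \sum_(Tm <- l) (#|cnb G Tm.1 Tm.2 s|%:R < (d / 2) ^+ count id Tm.2 * #|Tm.1|%:R)%R%:R)); last first.
        by move=> s _; rewrite big_cons.
      rewrite sumkD /= -natr1.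
      have [c th cle] := cT x Tm xI (sl _ (mem_head _ _)).
      have := sumk_cnb (k := k) Tm.2 d20 (_ : 0 <= 8 * dl) (thick_sub WD eW th) (subxx _) cle.
      have := IH (fun y yl => sl y (mem_behead (s := _ :: _) yl)).
      by move=> h1 /(_ (mulr_ge0 (ler0n _ _) (ltW dl0))) h2; lra.
    have := u2 (cons x) (fun y => id).
    have : (size (cons x))%:R * (k%:R * (8 * dl)) * #|W|%:R ^+ k <= p / 8 * #|W|%:R ^+ k.
      rewrite ler_pM2r //; apply: le_trans KcP; apply: ler_wpM2r => //.
      by rewrite ler_nat cK.
    lra.
  - move=> v ryv; rewrite /hit (sumk_all R W k (fun u => G u v)).
    apply: (@le_trans _ _ ((gamma / 4 * #|W|%:R) ^+ k)).
      by rewrite exprMn ler_pM2r.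
    have WleD : #|W|%:R <= #|D|%:R :> R by rewrite ler_nat subset_leq_card.
    have g4 : 0 <= gamma / 4 by rewrite divr_ge0 // ltW.
    have lo : gamma / 4 * #|W|%:R <= #|[set u in W | G u v]|%:R.
      have : (#|nbr G v :&: D| <= #|[set u in W | G u v]| + #|D :\: W|)%N.
        apply: leq_trans (leq_card_setU _ _); apply: subset_leq_card; apply/subsetP=> u /setIP[uv uD].
        apply/setUP; case: (boolP (u \in W)) => uW; [left | right].
          by apply/setIdP; split=> //; move: uv; rewrite inE sG.
        by apply/setDP.
      have : (#|D :\: W| + #|W| = #|D|)%N by rewrite cardsD (setIidPr WD) subnK // subset_leq_card.
      move/(congr1 (fun k => k%:R : R)); rewrite natrD -(ler_nat R) natrD.
      have := ler_wpM2l g4 WleD; move: ryv; rewrite /ry -/D; lra.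
    by rewrite lerXn2r // nnegrE // mulr_ge0.
  - move=> F rzF; apply: (@le_trans _ _ (k%:R * (8 * dl) * #|W|%:R ^+ k)); last by rewrite ler_pM2r.
    set T := F :&: [set v | reduced G f d dl zeta (lab x) (f v)].
    have th : thick G (d / 2) (4 * dl) (4 * dl * #|V|%:R) D T.
      by apply: (reduced_nbrs_thick (zeta := zeta)) => //; exact: subsetIr.
    have := sumk_cnb (k := k) (nseq k true) d20 (mulr_ge0 (ler0n R 8) (ltW dl0)) (thick_sub WD eW th) (subxx _) rzF.
    apply: le_trans; apply: sumk_le => s /andP[/eqP sk sW]; rewrite /bad ler_nat.
    case: forallP => //= noF; rewrite lt0b.
    (* A bad tuple has no common neighbour in [F], an extreme case of the small common
       neighbourhoods bounded by [sumk_cnb]. *)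
    have -> : cnb G T (nseq k true) s = set0.
      apply/setP=> v; rewrite in_cnb -sk mask_true // [RHS]inE; apply/negbTE.
      apply/negP=> /andP[/setIP[vF _]]; apply/negP; exact: implyP (noF v) vF.
    rewrite cards0 mulr_gt0 ?exprn_gt0 ?divr_gt0 //.
    rewrite -(pmulr_rgt0 _ (_ : 0 < (d / 2) ^+ k)) ?exprn_gt0 ?divr_gt0 //.
    by apply: lt_le_trans rzF; rewrite !mulr_gt0.
have pp : 0 < p <= 1 by rewrite p0.
have allI : all (mem I) I by apply/allP.
have a0 (v : V) : 0 <= #|V|%:R^-1 :> R by rewrite invr_ge0.
have b0 (F : {set V}) : 0 <= (2 ^+ #|V|)^-1 :> R by rewrite invr_ge0 exprn_ge0.
have c0 x : x \in I -> (#|set0 :&: avx x| + k * count (fun x' => ~~ [disjoint avx x & avx x']) I <= cap x)%N.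
  by rewrite set0I cards0.
have g40 : 0 < 1 - p / 4 by clear -p0 p1; lra.
have [s [sI sd sPhi]] := tuple_choice_weighted pp L1 step uI allI a0 b0 c0.
have tot : \sum_(v : V) #|V|%:R^-1 + \sum_(F : {set V}) (2 ^+ #|V|)^-1 = 2 :> R.
  have cP : #|{set V}| = (2 ^ #|V|)%N by have := card_powerset [set: V]; rewrite powersetT !cardsT.
  have e1 : \sum_(v : V) #|V|%:R^-1 = #|V|%:R * #|V|%:R^-1 :> R by rewrite sumr_const mulr_natl.
  have e2 : \sum_(F : {set V}) (2 ^+ #|V|)^-1 = #|{set V}|%:R * (2 ^+ #|V|)^-1 :> R.
    by rewrite sumr_const mulr_natl.
  by rewrite e1 e2 cP natrX !divff ?gt_eqF ?exprn_gt0.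
rewrite tot in sPhi.
have sub x : x \in I -> uniq (s x) /\ (forall Tm, Tm \in cons x ->
    (d / 2) ^+ count id Tm.2 * #|Tm.1|%:R <= #|cnb G Tm.1 Tm.2 (s x)|%:R).
  by move=> /sI[_ /andP[us /allP h]].
exists s; split=> [x xI|//|v|F].
- have [us h] := sub x xI; split=> //.
  have [/andP[sz /allP sa] _] := sI x xI; rewrite /tuple_in sz; apply/allP=> u /sa.
  by rewrite /= inE => /andP[].
- set h' := count _ I; set rel := count _ I.
  pose F v := #|V|%:R^-1 * ((1 / 2) ^+ count (fun x => ry x v && hit x v (s x)) I / (1 - p / 4) ^+ count (ry^~ v) I).
  have F0 w : 0 <= F w.
    apply: mulr_ge0; first by rewrite invr_ge0.
    by apply: divr_ge0; apply: exprn_ge0; [rewrite divr_ge0 | exact: ltW].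
  have := sumr_ge_term v F0.
  set S1 := \sum_i F i; move=> leF.
  have {leF} : F v <= 2.
    apply: le_trans leF (le_trans _ sPhi); rewrite lerDl; apply: sumr_ge0 => F' _.
    apply: mulr_ge0; first by rewrite invr_ge0 exprn_ge0.
    by apply: divr_ge0; apply: exprn_ge0 => //; exact: ltW.
  rewrite /F -/rel ler_pdivrMl // ler_pdivrMr ?exprn_gt0 // => le.
  apply: le_trans (_ : (1 / 2) ^+ count (fun x => ry x v && hit x v (s x)) I <= _).
    apply: ler_wiXn2l; [by rewrite divr_ge0 | by rewrite ler_pdivrMr // mul1r ler1n | ].
    by apply: sub_count => x /= /andP[].
  by apply: le_trans le _; rewrite (mulrC #|V|%:R).
- set cn := count _ I.
  pose B F := (2 ^+ #|V|)^-1 * (Lam ^+ count (fun x => rz x F && bad x F (s x)) I / 4 ^+ size I).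
  have B0 w : 0 <= B w.
    apply: mulr_ge0; first by rewrite invr_ge0 exprn_ge0.
    by apply: divr_ge0; apply: exprn_ge0 => //; exact: ltW.
  have leF := sumr_ge_term F B0.
  have {leF} : B F <= 2.
    apply: le_trans leF (le_trans _ sPhi); rewrite lerDr; apply: sumr_ge0 => v _.
    apply: mulr_ge0; first by rewrite invr_ge0.
    by apply: divr_ge0; apply: exprn_ge0; [rewrite divr_ge0 | exact: ltW].
  rewrite /B ler_pdivrMl ?exprn_gt0 // ler_pdivrMr ?exprn_gt0 // => le.
  by apply: le_trans le _; rewrite (mulrC 2).
Qed.

(** * Greedy embedding and absorption *)

(* Vertices outside [I0] are embedded in the order [pos], after [E0]. A vertex [z] starts with [base z]
   candidates and keeps a [d]-fraction of them for each embedded neighbour, except for [loss] many,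
   which are taken by vertices embedded in the cluster of [z] after the first neighbour of [z];
   [win z] contains all of these. *)
Section Greedy.
Variables (R : realType) (VH V K : finType) (H : rel VH) (G : rel V) (h : VH -> K) (av : K -> {set V}).
Variables (I0 E0 : {set VH}) (phi0 : VH -> V) (pos : VH -> nat) (base : VH -> R) (win : rel VH).
Variables (d : R) (Delta : nat) (cc ee th : K -> R).
Hypotheses (sH : symmetric H) (iH : irreflexive H) (sG : symmetric G) (iG : irreflexive G) (d01 : 0 < d <= 1).
Hypotheses (av_dis : forall i j, i != j -> [disjoint av i & av j]) (pos_inj : injective pos).
Hypotheses (EI0 : [disjoint E0 & I0]) (degH : forall z, (#|nbr H z| <= Delta)%N).
Hypothesis reg : forall y z, H y z -> y \notin I0 -> z \notin I0 ->
  forall T : {set V}, T \subset av (h z) -> cc (h z) <= #|T|%:R ->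
  #|[set v in av (h y) | #|nbr G v :&: T|%:R < d * #|T|%:R]|%:R <= ee (h y).
Hypotheses (cc_th : forall i, cc i <= th i) (ee_th : forall i, Delta%:R * ee i < th i).
Hypotheses (phi0_inj : {in E0 &, injective phi0}) (phi0_av : {in E0, forall u, phi0 u \in av (h u)}).
Hypothesis phi0_hom : {in E0 &, forall u v, H u v -> G (phi0 u) (phi0 v)}.
Hypotheses (base0 : forall z, 0 <= base z) (ee0 : forall i, 0 <= ee i).

Let rest := ~: (I0 :|: E0).
Let before t : {set VH} := [set u | (u \in E0) || (u \notin I0) && (pos u < t)%N].
Let cand (E : {set VH}) (phi : VH -> V) z : {set V} :=
  [set v in av (h z) | [forall y in E, H z y ==> G v (phi y)]] :\: phi @: E.
Let kk (E : {set VH}) z := #|nbr H z :&: E|.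
Let loss (E : {set VH}) z := #|[set y in E | (h y == h z) && win z y]|.

Hypothesis pre_cand : forall z, z \in rest -> (0 < kk E0 z)%N ->
  d ^+ kk E0 z * base z <= #|cand E0 phi0 z|%:R + (loss E0 z)%:R.
Hypothesis base_av : forall z, z \in rest ->
  base z + #|[set u in before (pos z) | h u == h z]|%:R <= #|av (h z)|%:R.
Hypothesis win_near : forall y z, y \in rest -> z \in rest -> h y = h z -> (pos y < pos z)%N ->
  (0 < kk (before (pos y)) z)%N -> win z y.
Hypothesis th_loss : forall z, z \in rest -> th (h z) + (loss (before (pos z)) z)%:R <= d ^+ Delta * base z.

(** The candidate bound is recorded only from the first embedded neighbour on. Until then [base_av]
    provides it, whatever has been used in the cluster. *)
Let inv t (phi : VH -> V) := [/\ {in before t &, injective phi}, {in before t, forall u, phi u \in av (h u)},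
  {in E0, phi =1 phi0}, {in before t &, forall u v, H u v -> G (phi u) (phi v)} &
  forall z, z \in rest -> z \notin before t -> (0 < kk (before t) z)%N ->
    d ^+ kk (before t) z * base z <= #|cand (before t) phi z|%:R + (loss (before t) z)%:R].

Let restP z : reflect (z \notin I0 /\ z \notin E0) (z \in rest).
Proof. by rewrite inE in_setU negb_or; apply: andP. Qed.

Let before_sub t z : z \in rest -> z \notin before t -> before t \subset before (pos z).
Proof.
move=> /restP[zI zE]; rewrite inE (negbTE zE) zI /= -leqNgt => tz.
apply/subsetP=> u; rewrite !inE => /orP[->//|/andP[-> ut]] /=.
by rewrite (leq_trans ut tz) orbT.
Qed.

Let inv_all t phi z : inv t phi -> z \in rest -> z \notin before t ->
  d ^+ kk (before t) z * base z <= #|cand (before t) phi z|%:R + (loss (before t) z)%:R.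
Proof.
move=> [inj pav _ _ pinv] zr zt; case: (posnP (kk (before t) z)) => k0; last exact: pinv.
rewrite k0 expr0 mul1r.
have cE : cand (before t) phi z = av (h z) :\: phi @: before t.
  congr (_ :\: _); apply/setP=> v; rewrite inE; case: (v \in av _) => //=.
  apply/forall_inP=> y yt; apply/implyP=> Hzy; have := cards0_eq k0.
  by move/setP/(_ y); rewrite !inE Hzy /= => h0; move: yt; rewrite inE h0.
rewrite cE; apply: (@le_trans _ _ #|av (h z) :\: phi @: before t|%:R); last by rewrite lerDl.
have : (#|av (h z)| <= #|av (h z) :\: phi @: before t| + #|[set u in before (pos z) | h u == h z]|)%N.
  rewrite -(cardsID (phi @: before t)) addnC leq_add2l.
  apply: (@leq_trans #|phi @: [set u in before (pos z) | h u == h z]|); last exact: leq_imset_card.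
  apply: subset_leq_card; apply/subsetP=> v /setIP[va /imsetP[u ut ev]].
  apply/imsetP; exists u => //; rewrite inE (subsetP (before_sub zr zt) _ ut) /=.
  apply/negPn/negP=> /av_dis/pred0P/(_ v); rewrite /= va andbT => /negP; apply.
  by rewrite ev pav.
by have := base_av zr; rewrite -(ler_nat R) natrD; lra.
Qed.

Let th_cand t phi z : inv t phi -> z \in rest -> z \notin before t -> th (h z) <= #|cand (before t) phi z|%:R.
Proof.
move=> iv zr zt; have h1 := inv_all iv zr zt; have h2 := th_loss zr.
have h3 : (loss (before t) z)%:R <= (loss (before (pos z)) z)%:R :> R.
  rewrite ler_nat; apply: subset_leq_card; 
    apply/subsetP=> y /setIdP[yt yh]; apply/setIdP; split=> //.
    exact: subsetP (before_sub zr zt) _ yt.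
have h4 : d ^+ Delta * base z <= d ^+ kk (before t) z * base z.
  apply: ler_wpM2r => //; case/andP: d01 => d0 d1; apply: ler_wiXn2l => //; first exact: ltW.
  by apply: leq_trans (degH z); apply: subset_leq_card; exact: subsetIl.
lra.
Qed.

Let inv_step t phi : inv t phi -> exists phi', inv t.+1 phi'.
Proof.
move=> iv; have [inj pav p0 hom pinv] := iv.
case: (pickP [pred y | (y \in rest) && (pos y == t)]) => [y /andP[yr /eqP yt] | none]; last first.
  suff e : before t.+1 = before t by exists phi; rewrite /inv e.
  apply/setP=> u; rewrite !inE ltnS leq_eqVlt; case: eqP => //= ut.
  have := none u; rewrite /= ut eqxx andbT !inE.
  by case: (u \in E0); case: (u \in I0).
have [yI yE] := restP _ yr.
have yb : y \notin before t by rewrite inE (negbTE yE) yt ltnn andbF.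
have e : before t.+1 = y |: before t.
  apply/setP=> u; rewrite !inE ltnS leq_eqVlt; case: (eqVneq u y) => [->|ne] /=.
    by rewrite yt eqxx yI orbT.
  by rewrite -yt (inj_eq pos_inj) (negbTE ne).
set E := before t in inj pav hom pinv yb e.
set C := cand E phi y.
pose low z := [set v in av (h y) | #|nbr G v :&: cand E phi z|%:R < d * #|cand E phi z|%:R].
pose todo := [set z in nbr H y | (z \in rest) && (z \notin E)].
have low_card z : z \in todo -> #|low z|%:R <= ee (h y).
  move=> /setIdP[]; rewrite inE => Hyz /andP[zr zE].
  have [zI _] := restP _ zr; apply: (reg Hyz yI zI).
    by apply/subsetP=> v; rewrite !inE => /andP[_ /andP[]].
  apply: le_trans (cc_th _) _; exact: (th_cand iv zr zE).
(* At most [Delta * ee (h y)] images are unsuitable for some unembedded neighbour of [y], fewer than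
   the [th (h y)] candidates of [y]. *)
have [v vC vgood] : exists2 v, v \in C & forall z, z \in todo -> v \notin low z.
  have : (#|\bigcup_(z in todo) low z| < #|C|)%N.
    rewrite -(ltr_nat R); apply: lt_le_trans (th_cand iv yr yb).
    apply: le_lt_trans (ee_th (h y)).
    apply: (@le_trans _ _ (\sum_(z in todo) #|low z|%:R)).
      rewrite -natr_sum ler_nat; elim/big_rec2: _ => [|z m n _ le]; first by rewrite cards0.
      by apply: leq_trans (leq_card_setU _ _) _; rewrite leq_add2l.
    apply: le_trans (sumr_le_const low_card) _; apply: ler_wpM2r => //.
    rewrite ler_nat; apply: leq_trans (degH y); apply: subset_leq_card; apply/subsetP=> z.
    by case/setIdP.
  case: (boolP (C \subset \bigcup_(z in todo) low z)) => [/subset_leq_card|/subsetPn[v vC vn] _].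
    by rewrite ltnNge => ->.
  exists v => // z zt; apply: contra vn => vz; apply/bigcupP; by exists z.
have /setDP[/setIdP[vav /forall_inP vadj] vimg] := vC.
pose phi' u := if u == y then v else phi u.
have phi'E u : u \in E -> phi' u = phi u.
  by move=> uE; rewrite /phi'; case: eqVneq => // uy; rewrite uy (negbTE yb) in uE.
have phi'y : phi' y = v by rewrite /phi' eqxx.
have fresh u : u \in E -> phi u != v.
  by move=> uE; apply: contraNneq vimg => <-; apply: imset_f.
exists phi'; rewrite /inv e; split.
- move=> u w; rewrite !in_setU1 => /predU1P[->|uE] /predU1P[->|wE] //.
  + by rewrite phi'y (phi'E w) // => /esym/eqP; rewrite (negbTE (fresh _ wE)).
  + by rewrite phi'y (phi'E u) // => /eqP; rewrite (negbTE (fresh _ uE)).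
  + by rewrite !phi'E //; exact: inj.
- by move=> u; rewrite in_setU1 => /predU1P[->|uE]; rewrite ?phi'y ?phi'E //; exact: pav.
- move=> u uE0; rewrite phi'E ?p0 // /E inE uE0 //.
- move=> u w; rewrite !in_setU1 => /predU1P[->|uE] /predU1P[->|wE].
  + by rewrite iH.
  + by move=> Hyw; rewrite phi'y phi'E //; exact: implyP (vadj _ wE) Hyw.
  + by rewrite sH phi'y phi'E // sG => Hyw; exact: implyP (vadj _ uE) Hyw.
  + by rewrite !phi'E //; exact: hom.
move=> z zr; rewrite in_setU1 negb_or => /andP[zy zE] kpos.
have [zI zE0] := restP _ zr.
have lossS : (loss E z <= loss (y |: E) z)%N.
  by apply: subset_leq_card; apply/subsetP=> u /setIdP[uE ?]; apply/setIdP; rewrite in_setU1 uE orbT.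
have old := inv_all iv zr zE; rewrite -/E in old.
have [d0 d1] := andP d01.
have candE w : w \in cand E phi z -> w != v -> (H z y -> G w v) -> w \in cand (y |: E) phi' z.
  move=> /setDP[/setIdP[wav /forall_inP wadj] wimg] wv wGv; apply/setDP; split.
    apply/setIdP; split=> //; apply/forall_inP=> u; rewrite in_setU1 => /predU1P[->|uE].
      by rewrite phi'y; apply/implyP.
    by rewrite phi'E //; exact: wadj.
  apply: contra wimg => /imsetP[u]; rewrite in_setU1 => /predU1P[->|uE] ew.
    by rewrite ew phi'y eqxx in wv.
  by rewrite ew phi'E // imset_f.
case: (boolP (H z y)) => Hzy.
  have ek : kk (y |: E) z = (kk E z).+1.
    rewrite /kk setIUr (_ : nbr H z :&: [set y] = [set y]).
      rewrite cardsU1 inE (negbTE yb) andbF //.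
    by apply/setP=> u; rewrite !inE; case: eqVneq => [->|]; rewrite ?Hzy ?andbF.
  have zt : z \in todo by apply/setIdP; split; [rewrite inE sH | rewrite zr zE].
  have := vgood z zt; rewrite inE vav /= -leNgt => vlow.
  have : (#|nbr G v :&: cand E phi z| <= #|cand (y |: E) phi' z|)%N.
    apply: subset_leq_card; apply/subsetP=> w /setIP[]; rewrite inE => vw wC.
    apply: candE => //; last by rewrite sG.
    by apply: contraTneq vw => ->; rewrite iG.
  rewrite -(ler_nat R) => le1; move: lossS; rewrite -(ler_nat R) => le2.
  have le3 : d * (loss E z)%:R <= (loss E z)%:R by rewrite ler_piMl.
  have := ler_wpM2l (ltW d0) old; rewrite ek exprS mulrDr mulrA; lra.
have ek : kk (y |: E) z = kk E z.
  by congr #|pred_of_set _|; apply/setP=> u; rewrite !inE; case: eqVneq => [->|]; rewrite ?(negbTE Hzy).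
rewrite ek; rewrite ek in kpos.
(* A non-neighbour [z] of [y] can lose only [v] itself. This forces [h y = h z], and then [y] is
   counted in the loss of [z]. *)
case: (boolP (v \in cand E phi z)) => vz; last first.
  apply: le_trans old _; apply: lerD; rewrite ler_nat //; apply: subset_leq_card; apply/subsetP=> w wC.
  by apply: candE => //; [apply: contraNneq vz => <- | rewrite (negbTE Hzy)].
have hyz : h y = h z.
  apply/eqP/negPn/negP=> /av_dis/pred0P/(_ v); rewrite /= vav.
  by have /setDP[/setIdP[->]] := vz.
have posyz : (pos y < pos z)%N.
  rewrite ltn_neqAle (inj_eq pos_inj) eq_sym zy yt /= leqNgt.
  by apply: contra zE => zlt; rewrite inE zI zlt orbT.
have wzy : win z y by apply: win_near => //; rewrite yt.
have l1 : (loss E z < loss (y |: E) z)%N.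
  apply: proper_card; apply/properP; split.
    by apply/subsetP=> u /setIdP[uE ?]; apply/setIdP; rewrite in_setU1 uE orbT.
  exists y; first by rewrite inE in_setU1 eqxx hyz eqxx wzy.
  by rewrite inE (negbTE yb).
have l2 : (#|cand E phi z| <= (#|cand (y |: E) phi' z|).+1)%N.
  rewrite (cardsD1 v) vz add1n ltnS; apply: subset_leq_card; apply/subsetP=> w /setD1P[wv wC].
  by apply: candE => //; rewrite (negbTE Hzy).
apply: le_trans old _; rewrite -!natrD ler_nat; move: l1 l2; clear; lia.
Qed.

Lemma greedy_embedding : exists phi : VH -> V,
  [/\ {in ~: I0 &, injective phi}, {in ~: I0, forall u, phi u \in av (h u)}, {in E0, phi =1 phi0} &
     {in ~: I0 &, forall u v, H u v -> G (phi u) (phi v)}].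
Proof.
have b0 : before 0 = E0 by apply/setP=> u; rewrite inE ltn0 andbF orbF.
have [t [phi iv]] : exists t phi, inv (\max_u (pos u)).+1 phi /\ t = t :> nat.
  exists 0%N; suff : forall t, exists phi, inv t phi by move=> /(_ (\max_u (pos u)).+1)[phi]; exists phi.
  elim=> [|t [phi /inv_step //]]; exists phi0; rewrite /inv b0; split=> // z zr _; exact: pre_cand.
have [[inj pav p0 hom _] _] := iv.
have sub u : u \in ~: I0 -> u \in before (\max_u (pos u)).+1.
  by rewrite !inE => ->; rewrite ltnS leq_bigmax orbT.
exists phi; split.
- by move=> u v /sub uE /sub vE; exact: inj.
- by move=> u /sub; exact: pav.
- exact: p0.
- by move=> u v /sub uE /sub vE; exact: hom.
Qed.

End Greedy.

(* A set violating Hall's condition has more than [tau1 * m] elements by [hits], so the clusters which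
   it meets substantially are in the range of robust expansion. Since almost every [x] whose cluster
   sees them has a neighbour in the set ([covers]), its neighbourhood is larger than the set itself
   or contains almost all of [I]; in the latter case the set almost exhausts [W], but a vertex [x]
   outside the neighbourhood has [tau2 * m] neighbours in [Z], hence one in the set. *)
Section AbsorbingMatching.
Variables (R : realType) (V X K : finType) (G : rel V) (f : V -> K) (lab : X -> K).
Variables (d dl zeta gamma nu sigma tau1 tau2 lam : R) (bad : rel K) (k : nat).
Variables (I : {set X}) (Z W : {set V}) (adj : X -> V -> bool).
Hypotheses (sG : symmetric G) (rb : reduced_bound G f d dl zeta bad).
Hypotheses (d0 : 0 < d) (dl0 : 0 < dl) (nu0 : 0 < nu) (g0 : 0 < gamma) (V0 : (0 < #|V|)%N).
Hypotheses (min_deg : forall v, gamma * #|V|%:R <= #|nbr G v|%:R).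
Hypotheses (rob : robust_expander G nu sigma).
Hypotheses (dnu : dl + 2 * d <= nu ^+ 2 / 4) (dg : dl + 2 * d <= gamma / 2) (dl1 : dl <= 1).
Hypotheses (s0 : 0 < sigma) (sg : sigma <= gamma / 8) (dls : dl <= sigma).

Let N : R := #|V|%:R.
Let m : R := #|I|%:R.
Let Gs := blowup G f d dl zeta.

Hypotheses (lam0 : 0 < lam) (lnu : 10 * lam <= nu) (ltau1 : 8 * lam <= tau1) (stau1 : 4 * sigma <= tau1)
  (nug : nu <= gamma / 2) (ltau2 : dl + 2 * lam <= tau2).
Hypotheses (ZW : Z \subset W) (cW : #|W| = #|I|) (WZ : #|W|%:R - #|Z|%:R <= 2 * lam * m).
Hypothesis Zcls : forall i, #|Z :&: cls f i|%:R * N <= m * #|cls f i|%:R.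
Hypothesis hits : forall v, tau1 * m <= #|[set x in I | adj x v]|%:R.
Hypothesis covers : forall F : {set V},
  #|[set x in I | sees G f d dl zeta k (lab x) F && [forall v in F, ~~ adj x v]]|%:R <= lam * m.
Hypothesis reserve : forall x, x \in I -> tau2 * m <= #|[set v in Z | adj x v]|%:R.
Hypothesis types : forall Q : pred K,
  m * (#|[set u | Q (f u)]|%:R - lam * N) <= #|[set x in I | Q (lab x)]|%:R * N.
Hypothesis sees_ok : 4 * dl * N <= (d / 2) ^+ k * (lam * nu / 2 * m).

Lemma absorbing_hall (S : {set V}) : S \subset W ->
  (#|S| <= #|rel_img (fun v x => adj x v && (x \in I)) S|)%N.
Proof.
have [-> _|/set0Pn[v0 v0S] SW] := eqVneq S set0; first by rewrite cards0.
set NS := rel_img _ S; rewrite leqNgt; apply/negP=> small.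
have {}small : #|NS|%:R < #|S|%:R :> R by rewrite ltr_nat.
have dl0' := dl0; have nu0' := nu0; have lam0' := lam0.
have N0 : 0 < N by rewrite ltr0n.
have NSP x v : x \in I -> v \in S -> adj x v -> x \in NS.
  by move=> xI vS xv; rewrite inE; apply/existsP; exists v; rewrite vS xv xI.
have NSI : NS \subset I by apply/subsetP=> x; rewrite inE => /existsP[v /and3P[]].
have Sm : #|S|%:R <= m by rewrite /m -cW ler_nat subset_leq_card.
have m0 : 0 < m by apply: lt_le_trans Sm; apply: le_lt_trans small.
have bigS : tau1 * m < #|S|%:R.
  apply: le_lt_trans small; apply: le_trans (hits v0) _; rewrite ler_nat.
  by apply: subset_leq_card; apply/subsetP=> x /setIdP[xI xv]; apply: NSP xv.
have SZ : #|S|%:R - 2 * lam * m <= #|S :&: Z|%:R.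
  have : (#|S| <= #|S :&: Z| + #|W :\: Z|)%N.
    by rewrite -(cardsID Z S) leq_add2l subset_leq_card // setSD.
  rewrite -(ler_nat R) natrD; have := cardsID Z W; rewrite (setIidPr ZW).
  by move/(congr1 (fun k => k%:R : R)); rewrite natrD; move: WZ; lra.
(* The quota of cluster [i] in [Z] is [m * #|cls f i|%:R / N]; a cluster is big when [S] contains at
   least the fraction [lam] of this quota. *)
pose big i := lam * m * #|cls f i|%:R <= #|S :&: Z :&: cls f i|%:R * N.
pose T := [set u | big (f u)].
have cT : #|S :&: Z|%:R * N <= m * #|T|%:R + lam * m * N.
  have -> : #|S :&: Z|%:R = \sum_i #|S :&: Z :&: cls f i|%:R :> R.
    rewrite -natr_sum; congr (_%:R); rewrite -sum1_card (partition_big f xpredT) //=.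
    by apply: eq_bigr => j _; rewrite -sum1_card; apply: eq_bigl => v; rewrite !inE.
  have totN : \sum_i #|cls f i|%:R = N.
    by rewrite card_cls; congr (_%:R); apply: eq_card => v; rewrite inE.
  have -> : lam * m * N = \sum_i lam * m * #|cls f i|%:R by rewrite -mulr_sumr totN.
  rewrite -(card_cls R f big) mulr_suml mulr_sumr [X in _ <= X + _]big_mkcond -big_split /=.
  apply: ler_sum => i _.
  case: (boolP (big i)) => [_|]; last by rewrite add0r -ltNge => /ltW.
  apply: (@le_trans _ _ (m * #|cls f i|%:R)); last by rewrite lerDl !mulr_ge0 // ltW.
  apply: le_trans (Zcls i); apply: ler_wpM2r; first exact: ltW.
  by rewrite ler_nat subset_leq_card // setSI // subsetIr.
have Tlb : #|S|%:R * N <= m * (#|T|%:R + 3 * lam * N).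
  have : (#|S|%:R - 2 * lam * m) * N <= #|S :&: Z|%:R * N by rewrite ler_pM2r.
  lra.
pose D := rnbr Gs (nu / 2) T.
pose Q i := nu / 2 * N <= #|[set v | reduced G f d dl zeta i (f v)] :&: T|%:R.
have DQ : D = [set u | Q (f u)] by [].
(* The big clusters adjacent to [i] have [nu / 2 * N] vertices, so [S] has at least
   [lam * nu / 2 * m] vertices in them, which is the threshold of [sees_ok]. *)
have seesD i : Q i -> sees G f d dl zeta k i S.
  move=> Qi; rewrite /sees; apply: le_trans sees_ok _; apply: ler_wpM2l; first by rewrite exprn_ge0 // divr_ge0 // ltW.
  rewrite -(ler_pM2r N0); set Ni := [set v | _] in Qi *.
  have : lam * m * (nu / 2 * N) <= lam * m * #|Ni :&: T|%:R by rewrite ler_pM2l // mulr_gt0.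
  have : lam * m * #|Ni :&: T|%:R <= #|S :&: Ni|%:R * N.
    have -> : Ni :&: T = [set v | reduced G f d dl zeta i (f v) && big (f v)] by apply/setP=> v; rewrite !inE.
    rewrite -(card_cls R f (fun j => reduced G f d dl zeta i j && big j)) mulr_sumr.
    apply: le_trans (_ : \sum_(j | reduced G f d dl zeta i j && big j) #|S :&: Z :&: cls f j|%:R * N <= _).
      by apply: ler_sum => j /andP[_].
    rewrite -mulr_suml; apply: ler_wpM2r; first exact: ltW.
    rewrite -natr_sum ler_nat -[leqRHS]sum1_card.
    rewrite [leqRHS](partition_big f (fun j => reduced G f d dl zeta i j)) /=; last first.
      by move=> v; rewrite !inE => /andP[].
    rewrite big_mkcondr /=; apply: leq_sum => j rij; case: ifP => // _.
    rewrite -sum1_card; rewrite [leqLHS]big_mkcond [leqRHS]big_mkcond; apply: leq_sum => v _.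
    rewrite !inE; case: (v \in S) => //=; case: (v \in Z) => //=; case: eqP => [->|_] //=.
    by rewrite rij.
  lra.
have NSlb : m * (#|D|%:R - 2 * lam * N) <= #|NS|%:R * N.
  have h1 := types Q; have h2 := covers S.
  have h3 : (#|[set x in I | Q (lab x)]| <= #|NS| +
     #|[set x in I | sees G f d dl zeta k (lab x) S && [forall v in S, ~~ adj x v]]|)%N.
    apply: leq_trans (leq_card_setU _ _); apply: subset_leq_card; apply/subsetP=> x /setIdP[xI Qx].
    apply/setUP; case: (boolP (x \in NS)) => [|xN]; [by left | right].
    apply/setIdP; split=> //; rewrite seesD //=; apply/forall_inP=> v vS.
    by apply: contra xN; apply: NSP.
  move: h3; rewrite -(ler_nat R) natrD => h3; rewrite -DQ in h1.
  have : #|[set x in I | Q (lab x)]|%:R * N <= (#|NS|%:R + lam * m) * N.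
    by rewrite ler_pM2r //; lra.
  lra.
have h5 := blowup_expands rb d0 dl0 nu0 g0 V0 rob dnu dg dl1 (S := T).
have Tsig : sigma * N <= #|T|%:R.
  rewrite -(ler_pM2l m0).
  have : tau1 * m * N <= #|S|%:R * N by rewrite ler_pM2r // ltW.
  have : 4 * sigma * (m * N) <= tau1 * (m * N) by rewrite ler_pM2r // mulr_gt0.
  have : 8 * lam * (m * N) <= tau1 * (m * N) by rewrite ler_pM2r // mulr_gt0.
  have : 0 < sigma * (m * N) by rewrite !mulr_gt0.
  lra.
(* In the middle range, compared with [m * #|T|%:R / N], the set [NS] is larger by
   [(nu / 2 - 2 * lam) * m] and [S] by at most [3 * lam * m]; hence the condition
   [10 * lam <= nu]. *)
have [mid|large] := leP (#|T|%:R : R) ((1 - sigma) * N).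
  have := h5 _; rewrite -/N Tsig mid => /(_ isT) h6.
  have : m * (#|T|%:R + nu / 2 * N) <= m * #|D|%:R by rewrite ler_pM2l.
  have : 10 * lam * (m * N) <= nu * (m * N) by rewrite ler_pM2r // mulr_gt0.
  have : #|NS|%:R * N < #|S|%:R * N by rewrite ltr_pM2r.
  lra.
have tD : typical G f d dl zeta gamma \subset D.
  apply/subsetP=> u; rewrite inE inE => hu.
  have := cardI_lb (nbr Gs u) T; rewrite -(ler_nat R) !natrD -/N => h.
  have : sigma * N <= gamma / 8 * N by rewrite ler_pM2r.
  have : nu * N <= gamma / 2 * N by rewrite ler_pM2r.
  have : 0 < gamma * N by rewrite mulr_gt0.
  by move: hu; rewrite -/Gs -/N; lra.
have cD : (1 - dl) * N <= #|D|%:R.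
  have := card_typical rb d0 dl0 V0 min_deg dg.
  have := cardsC (typical G f d dl zeta gamma); move/(congr1 (fun k => k%:R : R)); rewrite natrD -/N.
  have := subset_leq_card tD; rewrite -(ler_nat R); lra.
have NSm : m * (1 - dl - 2 * lam) <= #|NS|%:R.
  rewrite -(ler_pM2r N0); apply: le_trans NSlb.
  have : m * ((1 - dl) * N) <= m * #|D|%:R by rewrite ler_pM2l.
  lra.
(* The [tau2 * m] partners of [y] in [Z] avoid [S], but [S] is larger than [NS] and so leaves less
   than [(dl + 2 * lam) * m] of [W] free. *)
have [y yI yN] : exists2 y, y \in I & y \notin NS.
  apply/subsetPn; apply/negP=> /subset_leq_card; rewrite -(ler_nat R) -/m => h.
  by have := lt_le_trans small Sm; rewrite ltNge h.
have := reserve yI; apply/negP; rewrite -ltNge.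
have cs : (#|[set v in Z | adj y v]| + #|S| <= #|W|)%N.
  rewrite -(cardsID S W) (setIidPr SW) addnC leq_add2l; apply: subset_leq_card; apply/subsetP=> v.
  case/setIdP=> vZ yv; apply/setDP; split; first exact: subsetP ZW _ vZ.
  by apply: contra yN => vS; apply: NSP yv.
move: cs; rewrite cW -(ler_nat R) natrD -/m => cs.
have : (dl + 2 * lam) * m <= tau2 * m by rewrite ler_pM2r.
lra.
Qed.

End AbsorbingMatching.

(** * Homomorphisms along the bandwidth order *)

Section Balls.
Variables (T : finType) (H : rel T) (Delta : nat).
Hypotheses (sH : symmetric H) (degH : forall z, (#|nbr H z| <= Delta)%N).

Fixpoint ball (k : nat) (x : T) : {set T} :=
  if k is k'.+1 then \bigcup_(y in ball k' x) (y |: nbr H y) else [set x].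

Lemma ballP k x z : reflect (exists2 y, y \in ball k x & (z == y) || H y z) (z \in ball k.+1 x).
Proof.
apply: (iffP bigcupP) => [[y yb]|[y yb h]]; first by rewrite in_setU1 inE; exists y.
by exists y; rewrite // in_setU1 inE.
Qed.

Lemma ball_card k x : (#|ball k x| <= Delta.+1 ^ k)%N.
Proof.
elim: k => [|k IH] /=; first by rewrite cards1.
apply: (@leq_trans (\sum_(y in ball k x) Delta.+1)).
  apply: (@leq_trans (\sum_(y in ball k x) #|y |: nbr H y|)).
    elim/big_rec2: _ => [|z a b _ le]; first by rewrite cards0.
    by apply: leq_trans (leq_card_setU _ _) _; rewrite leq_add2l.
  apply: leq_sum => y _; rewrite cardsU1; have := degH y; case: (_ \notin _); lia.
by rewrite sum_nat_const expnSr leq_mul2r IH orbT.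
Qed.

Lemma ball_step k x y z : y \in ball k x -> H y z -> z \in ball k.+1 x.
Proof. by move=> yb yz; apply/ballP; exists y; rewrite // yz orbT. Qed.

Lemma ball_sub k x y : y \in ball k x -> y \in ball k.+1 x.
Proof. by move=> yb; apply/ballP; exists y; rewrite // eqxx. Qed.

Lemma ball_front k x y z : (x == y) || H x y -> z \in ball k y -> z \in ball k.+1 x.
Proof.
move=> xy; elim: k z => [|k IH] z.
  by move=> /set1P ->; apply/ballP; exists x; rewrite ?inE // eq_sym.
by move=> /ballP[w wb wz]; apply/ballP; exists w => //; apply: IH.
Qed.

Lemma ball_sym k x y : y \in ball k x -> x \in ball k y.
Proof.
elim: k y => [|k IH] y; first by rewrite !inE eq_sym.
by move=> /ballP[w wb wy]; apply: (ball_front _ (IH _ wb)); rewrite sH.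
Qed.

(** Greedy choice: each chosen vertex forbids its ball, which has at most [Delta.+1 ^ k]
    vertices. *)
Lemma spaced_subset k (S : {set T}) (r : nat) : (r * Delta.+1 ^ k <= #|S|)%N ->
  exists I : {set T}, [/\ I \subset S, #|I| = r & {in I &, forall x y, x != y -> y \notin ball k x}].
Proof.
elim: r S => [|r IH] S.
  by move=> _; exists set0; rewrite sub0set cards0; split=> // x y; rewrite inE.
rewrite mulSn => leS.
have : (0 < #|S|)%N by apply: leq_trans leS; rewrite addn_gt0 expn_gt0.
case/card_gt0P=> x xS.
have [|I [IS cI spI]] := IH (S :\: ball k x).
  rewrite cardsD; have := subset_leq_card (subsetIr S (ball k x)); have := ball_card k x; lia.
have xI : x \notin I.
  apply/negP=> /(subsetP IS); rewrite inE => /andP[/negP[]].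
  by elim: k {leS IH IS cI spI} => [|k IHk]; [rewrite inE | apply: ball_sub].
have Ib y : y \in I -> y \notin ball k x by move=> /(subsetP IS); rewrite inE => /andP[].
exists (x |: I); split.
- by rewrite subUset sub1set xS (subset_trans IS (subsetDl _ _)).
- by rewrite cardsU1 xI cI add1n.
- move=> y z; rewrite !in_setU1 => /orP[/eqP->|yI] /orP[/eqP->|zI]; rewrite ?eqxx //.
  + by move=> _; exact: Ib.
  + by move=> _; apply: contra (Ib _ yI); exact: ball_sym.
  + exact: spI.
Qed.

Lemma ball_dist k (pos : T -> nat) l x y : (forall u v, H u v -> (pos u <= pos v + l)%N) ->
  y \in ball k x -> (pos y <= pos x + k * l)%N.
Proof.
move=> hp; elim: k y => [|k IH] y; first by rewrite inE => /eqP->; lia.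
move=> /ballP[w /IH wl /orP[/eqP->|]]; first by rewrite mulSn; lia.
by rewrite sH => /hp; rewrite mulSn; lia.
Qed.

End Balls.

Section Links.
Variables (K : finType) (g : rel K).
Hypothesis sg : symmetric g.

Definition share (s t : K * K) : bool := (s.1 == t.1) || (s.2 == t.2).

(* A state [(a, b)] sends one colour class to [a] and the other to [b]; a walk of odd length from
   [a] to [b'] lets us change one coordinate at a time until the state is [(a', b')]. *)
Lemma link_states (a b a' b' : K) (p : seq K) j : size p = j.*2 -> g a b -> g a' b' ->
  path g a (rcons p b') ->
  exists s : nat -> K * K, [/\ s 0%N = (a, b), s j.*2.+2 = (a', b'), forall i, g (s i).1 (s i).2 &
    forall i, share (s i) (s i.+1)].
Proof.
move=> sp gab gab' pp; pose q i := nth a (a :: rcons p b') i.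
have q0 : q 0%N = a by [].
have qlast : q j.*2.+1 = b' by rewrite /q /= nth_rcons sp ltnn eqxx.
have gq i : (i < j.*2.+1)%N -> g (q i) (q i.+1).
  by move=> lti; have /pathP := pp => /(_ a i); rewrite size_rcons sp; apply.
(* After [(a, b)] the states are consecutive vertices of the walk, written in alternating order so
   that each step replaces the older vertex. The odd length makes [b'] arrive in the second
   coordinate, and [a'] is put in last. *)
exists (fun i => if i == 0%N then (a, b) else if (i <= j.*2.+1)%N then
   (if odd i then (q i.-1, q i) else (q i, q i.-1)) else (a', b')); split=> //.
- by rewrite ltnn.
- move=> i /=; case: (eqVneq i 0%N) => // i0; case: (leqP i j.*2.+1) => // le.
  have gi : g (q i.-1) (q i) by have := gq i.-1; rewrite prednK ?lt0n //; apply.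
  by case: (odd i) => //=; rewrite sg.
- move=> i; rewrite /share /=; case: (eqVneq i 0%N) => [->|i0] /=; first by rewrite q0 eqxx.
  case: (leqP i j.*2.+1) => le; last by rewrite ltnNge (ltnW le) /= eqxx.
  case: (ltnP i j.*2.+1) => le2; first by case: (odd i) => /=; rewrite eqxx ?orbT.
  have -> : i = j.*2.+1 by apply/eqP; rewrite eqn_leq le.
  by rewrite /= odd_double /= qlast eqxx orbT.
Qed.

End Links.

(* Each type [e] has two sides of capacity [t e / 2]. The larger class of a block goes to the less
   loaded side, so the two sides never differ by more than one block. *)
Lemma block_allocation (E : finType) (t : E -> nat) (x y : nat -> nat) (s B : nat) :
  (forall b, x b + y b <= s)%N ->
  (\sum_(b < B) (x b + y b) + 4 * s * #|E| < \sum_e t e)%N ->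
  exists a : nat -> E * bool, (forall b, (b < B)%N -> (0 < t (a b).1)%N) /\
    forall e,
    (2 * (\sum_(b < B | (a b).1 == e) (if (a b).2 then x b else y b)) <= t e)%N /\
    (2 * (\sum_(b < B | (a b).1 == e) (if (a b).2 then y b else x b)) <= t e)%N.
Proof.
move=> xys tot.
pose l1 (a : nat -> E * bool) k e := (\sum_(b < k | (a b).1 == e) (if (a b).2 then x b else y b))%N.
pose l2 (a : nat -> E * bool) k e := (\sum_(b < k | (a b).1 == e) (if (a b).2 then y b else x b))%N.
suff H k : (k <= B)%N -> exists a : nat -> E * bool, (forall b, (b < k)%N -> (0 < t (a b).1)%N) /\
    forall e, [/\ (2 * l1 a k e <= t e)%N, (2 * l2 a k e <= t e)%N, (l1 a k e <= l2 a k e + s)%N &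
    (l2 a k e <= l1 a k e + s)%N].
  have [a [pa ha]] := H B (leqnn _); exists a; split=> // e.
  by have [] := ha e.
have [e0 _] : exists e : E, true.
  case: (pickP (fun _ : E => true)) => [e _|E0]; first by exists e.
  by move: tot; rewrite [X in (_ < X)%N]big_pred0.
elim: k => [_|k IH ltk].
  by exists (fun=> (e0, true)); split=> // e; rewrite /l1 /l2 !big_ord0.
have [a [pa ha]] := IH (ltnW ltk).
have sumE : (\sum_e (l1 a k e + l2 a k e) = \sum_(b < k) (x b + y b))%N.
  rewrite [RHS](partition_big (fun b : 'I_k => (a b).1) xpredT) //=; apply: eq_bigr => e _.
  by rewrite /l1 /l2 -big_split /=; apply: eq_bigr => b _; case: ifP => _; rewrite // addnC.
(* Otherwise every type would be filled up to [4 * s], against [tot]. This margin absorbs the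
   imbalance of at most [s] between the sides and the new block. *)
have [e he] : exists e, (l1 a k e + l2 a k e + 4 * s < t e)%N.
  apply/existsP; apply: contraLR tot; rewrite negb_exists => /forallP h.
  rewrite -leqNgt; apply: (@leq_trans (\sum_e (l1 a k e + l2 a k e + 4 * s))).
    by apply: leq_sum => e _; rewrite leqNgt h.
  rewrite big_split /= sumE sum_nat_const (mulnC #|_|) leq_add2r.
  by rewrite -(subnKC (ltnW ltk)) big_split_ord leq_addr.
pose o := (l1 a k e <= l2 a k e)%N == (y k <= x k)%N.
pose a' b := if b == k then (e, o) else a b.
have a'E b : (b < k)%N -> a' b = a b by move=> lt; rewrite /a' ltn_eqF.
have a'k : a' k = (e, o) by rewrite /a' eqxx.
have L1 e' : l1 a' k.+1 e' = (l1 a k e' + (if e == e' then (if o then x k else y k) else 0))%N.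
  rewrite /l1 big_mkcond big_ord_recr /= a'k /= [X in (_ = X + _)%N]big_mkcond; congr (_ + _)%N.
  by apply: eq_bigr => b _ /=; rewrite a'E ?ltn_ord.
have L2 e' : l2 a' k.+1 e' = (l2 a k e' + (if e == e' then (if o then y k else x k) else 0))%N.
  rewrite /l2 big_mkcond big_ord_recr /= a'k /= [X in (_ = X + _)%N]big_mkcond; congr (_ + _)%N.
  by apply: eq_bigr => b _ /=; rewrite a'E ?ltn_ord.
exists a'; split.
  move=> b; rewrite ltnS leq_eqVlt => /orP[/eqP->|lt]; last by rewrite a'E // pa.
  by rewrite /a' eqxx /=; apply: leq_trans he.
move=> e'; rewrite L1 L2; have := ha e'; case: eqVneq => [<-|_]; last by rewrite !addn0.
have xy := xys k; rewrite /o; move: (l1 a k e) (l2 a k e) (x k) (y k) (t e) he xy => u1 u2 xk yk te he xy [h1 h2 h3 h4].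
by case: (leqP u1 u2) => c1; case: (leqP yk xk) => c2 /=; split; move: c1 c2 he xy h1 h2 h3 h4; clear; lia.
Qed.

Lemma seq_with_counts (E : finType) (c : E -> nat) :
  exists ts : seq E, forall P : pred E, count P ts = (\sum_(e | P e) c e)%N.
Proof.
exists (flatten [seq nseq (c e) e | e <- enum E]) => P.
rewrite count_flatten -map_comp sumnE big_map big_enum /= [RHS]big_mkcond.
by apply: eq_bigr => e _ /=; rewrite count_nseq; case: (P e); rewrite ?mul1n ?mul0n.
Qed.

Section States.
Variables (K : finType) (g : rel K) (Q L : nat) (e : nat -> K * K).
Hypotheses (L0 : (0 < L)%N) (LQ : (L < Q)%N).
Hypothesis links : forall b, exists s : nat -> K * K, [/\ s 0%N = e b, s L = e b.+1,
  forall i, g (s i).1 (s i).2 & forall i, share (s i) (s i.+1)].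

Lemma share_refl (s : K * K) : share s s.
Proof. by rewrite /share eqxx. Qed.

Lemma schedule_states : exists st : nat -> K * K, [/\ forall t, g (st t).1 (st t).2,
  forall t, share (st t) (st t.+1) & forall t, (t %% Q < Q - L)%N -> st t = e (t %/ Q)%N].
Proof.
have [s hs] := choice links.
have Q0 : (0 < Q)%N by apply: leq_trans LQ.
(* The truncated subtraction is 0 in the first [Q - L] slots of a block, where the state is
   constant. The link ends, at index [L], in the first slot of the next block. *)
pose st t := s (t %/ Q)%N (t %% Q - (Q - L))%N.
have stE t : (t %% Q < Q - L)%N -> st t = e (t %/ Q)%N.
  by move=> h; rewrite /st (eqP (ltnW h)); case: (hs (t %/ Q)%N).
exists st; split=> // t; first by rewrite /st; case: (hs (t %/ Q)%N).
have [s0 sL _ ss] := hs (t %/ Q)%N.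
have ltQ := ltn_pmod t Q0.
have tE : (t.+1 = t %/ Q * Q + (t %% Q).+1)%N by rewrite addnS -divn_eq.
case: (ltnP (t %% Q)%N.+1 Q) => h.
  have e1 : (t.+1 %/ Q = t %/ Q)%N by rewrite tE divnMDl // (divn_small h) addn0.
  have e2 : (t.+1 %% Q = (t %% Q).+1)%N by rewrite tE modnMDl (modn_small h).
  rewrite /st e1 e2; case: (leqP (Q - L) (t %% Q)%N) => h2; first by rewrite subSn.
  by rewrite (eqP (h2 : ((t %% Q)%N.+1 - _ == 0)%N)) (eqP (ltnW h2)) share_refl.
have e0 : ((t %% Q).+1 = Q)%N by apply/eqP; rewrite eqn_leq ltQ.
have e1 : (t.+1 %/ Q = (t %/ Q)%N.+1)%N by rewrite tE e0 -mulSnr mulnK.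
have e2 : (t.+1 %% Q = 0)%N by rewrite tE e0 -mulSnr modnMl.
rewrite /st e1 e2 sub0n; have [-> _ _ _] := hs (t %/ Q)%N.+1; rewrite -sL.
have -> : L = (t %% Q - (Q - L))%N.+1 by move: e0 LQ L0; clear; lia.
by rewrite [X in share (s _ X) _](_ : _ = (t %% Q - (Q - L))%N) //; move: e0 LQ L0; clear; lia.
Qed.

End States.

Section Schedule.
Variables (T K : finType) (H : rel T) (c : T -> bool) (pos : T -> nat) (l : nat).
Hypotheses (sH : symmetric H) (cH : forall u v, H u v -> c u != c v) (l0 : (0 < l)%N).
Hypothesis posH : forall u v, H u v -> (pos u <= pos v + l)%N.

(** Slots have length [l], the bound on the stretch of an edge, so an edge stays in one slot or
    joins consecutive ones. *)
Definition slot u := (pos u %/ l)%N.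
Definition scheduled (st : nat -> K * K) u := if c u then (st (slot u)).1 else (st (slot u)).2.

Lemma slot_near u v : H u v -> (slot u <= (slot v).+1)%N.
Proof.
move=> /posH h; apply: leq_trans (leq_div2r l h) _.
by rewrite divnDr // divnn l0 addn1.
Qed.

(** The ends of an edge have different colours and read different coordinates of equal or
    consecutive states. A coordinate common to the two states turns these values into the two
    entries of a single state. *)
Lemma scheduled_hom (g : rel K) (st : nat -> K * K) : symmetric g ->
  (forall t, g (st t).1 (st t).2) -> (forall t, share (st t) (st t.+1)) ->
  forall u v, H u v -> g (scheduled st u) (scheduled st v).
Proof.
move=> sg gst sst.
suff main u v : H u v -> c u -> g (scheduled st u) (scheduled st v).
  move=> u v Huv; case: (boolP (c u)) => cu; first exact: main.
  rewrite sg; apply: main; first by rewrite sH.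
  by have := cH Huv; case: (c u) cu; case: (c v).
move=> Huv cu; have := cH Huv; rewrite /scheduled cu; case: (c v) => //= _.
have h1 := slot_near Huv; have h2 : (slot v <= (slot u).+1)%N by apply: slot_near; rewrite sH.
have [->|ne] := eqVneq (slot u) (slot v); first exact: gst.
case: (ltnP (slot u) (slot v)) => lt.
  have -> : slot v = (slot u).+1 by apply/eqP; rewrite eqn_leq h2.
  by have /orP[/eqP ->|/eqP <-] := sst (slot u); apply: gst.
have -> : slot u = (slot v).+1 by apply/eqP; rewrite eqn_leq h1 ltn_neqAle eq_sym ne.
by have /orP[/eqP <-|/eqP ->] := sst (slot v); apply: gst.
Qed.

Hypotheses (pos_inj : injective pos) (pos_lt : forall u, (pos u < #|T|)%N).

Lemma pos_card_le a b : (#|[set u | (a <= pos u < b)%N]| <= b - a)%N.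
Proof.
rewrite cardE -(size_map pos) -[leqRHS](size_iota a); apply: uniq_leq_size.
  by rewrite map_inj_uniq ?enum_uniq.
move=> x /mapP[u]; rewrite mem_enum inE mem_iota => /andP[au ub] ->.
by rewrite au subnKC ?ub // ltnW // (leq_ltn_trans au).
Qed.

Lemma pos_card a b : (a <= b <= #|T|)%N -> #|[set u | (a <= pos u < b)%N]| = (b - a)%N.
Proof.
move=> /andP[ab bn]; apply/eqP; rewrite eqn_leq pos_card_le /=.
have h1 := pos_card_le 0 a; have h2 := pos_card_le b #|T|.
set A := [set u | (a <= pos u < b)%N].
have : (#|T| <= #|[set u | (0 <= pos u < a)%N]| + #|A| + #|[set u | (b <= pos u < #|T|)%N]|)%N.
  have sub : [set: T] \subset [set u | (0 <= pos u < a)%N] :|: A :|: [set u | (b <= pos u < #|T|)%N].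
    apply/subsetP=> u _; rewrite !inE pos_lt andbT /=.
    by case: (ltnP (pos u) a) => //= _; case: (ltnP (pos u) b).
  have := subset_leq_card sub; rewrite cardsT => h; apply: leq_trans h _.
  have h3 := leq_card_setU ([set u | (0 <= pos u < a)%N] :|: A) [set u | (b <= pos u < #|T|)%N].
  have h4 := leq_card_setU [set u | (0 <= pos u < a)%N] A.
  by apply: leq_trans h3 _; rewrite leq_add2r; exact: h4.
move: h1 h2 ab bn; move: #|A| #|[set u | (0 <= pos u < a)%N]| #|[set u | (b <= pos u < #|T|)%N]| #|T|.
by move=> x y z t; clear; lia.
Qed.

End Schedule.

Lemma subset_of_sizes (V K : finType) (f : V -> K) (A : {set V}) (z : K -> nat) :
  (forall i, (z i <= #|A :&: cls f i|)%N) ->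
  exists Z : {set V}, Z \subset A /\ forall i, #|Z :&: cls f i| = z i.
Proof.
move=> hz.
have /choice[B hB] : forall i, exists B : {set V}, B \subset A :&: cls f i /\ #|B| = z i.
  move=> i; have [B [BA cB]] : exists B : {set V}, B \subset A :&: cls f i /\ #|B| = z i.
    exists [set x in take (z i) (enum (A :&: cls f i))]; split.
      by apply/subsetP=> x; rewrite inE => /mem_take; rewrite mem_enum.
    rewrite cardsE; have /card_uniqP-> : uniq (take (z i) (enum (A :&: cls f i))) by rewrite take_uniq ?enum_uniq.
    by rewrite size_takel // -cardE.
  by exists B.
exists [set v | v \in B (f v)]; split.
  by apply/subsetP=> v; rewrite inE => vB; have [/subsetP/(_ _ vB)/setIP[]] := hB (f v).
move=> i; have [BA <-] := hB i; apply: eq_card => v; rewrite !inE.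
case: eqVneq => [->|ne]; first by rewrite andbT.
rewrite andbF; apply/esym/negP => /(subsetP BA); by rewrite !inE (negbTE ne) andbF.
Qed.

(** Each type [(f u, f (g u))] is repeated in proportion to its number of vertices [u], rounded
    down. As [g] permutes [T], first and second coordinates are both distributed like [T]. Rounding
    costs at most one block per type. *)
Lemma initial_types (R : realType) (V K : finType) (f : V -> K) (T : {set V}) (g : V -> V) (kap s : R) :
  0 < kap -> 0 < s -> {in T &, injective g} -> {in T, forall u, g u \in T} ->
  exists ts : seq (K * K), [/\
    forall e, e \in ts -> exists2 u, u \in T & (f u, f (g u)) = e,
    forall i, s * (count (fun e => e.1 == i) ts)%:R <= kap * #|cls f i|%:R,
    forall i, s * (count (fun e => e.2 == i) ts)%:R <= kap * #|cls f i|%:R,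
    s * (size ts)%:R <= kap * #|T|%:R &
    forall P : pred K, kap * #|[set u in T | P (f u)]|%:R - s * (#|K| * #|K|)%:R <=
      s * (count (fun e => P e.2) ts)%:R].
Proof.
move=> k0 s0 ginj gT.
pose t e := #|[set u in T | (f u, f (g u)) == e]|.
pose n0 e := Num.truncn (kap * (t e)%:R / s).
have [ts hts] := seq_with_counts n0.
have x0 e : 0 <= kap * (t e)%:R / s by rewrite divr_ge0 ?mulr_ge0 // ltW.
have n0_le e : s * (n0 e)%:R <= kap * (t e)%:R.
  by rewrite mulrC -ler_pdivlMr //; have /andP[] := truncn_itv (x0 e).
have n0_ge e : kap * (t e)%:R - s <= s * (n0 e)%:R.
  have /andP[_] := truncn_itv (x0 e); rewrite -/(n0 e) ltr_pdivrMr // -natr1; lra.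
have sum_t (P : pred (K * K)) : (\sum_(e | P e) t e)%N = #|[set u in T | P (f u, f (g u))]|.
  rewrite -sum1_card (partition_big (fun u => (f u, f (g u))) P) /=; last by move=> u; rewrite inE => /andP[].
  apply: eq_bigr => e Pe; rewrite /t -sum1_card; apply: eq_bigl => u; rewrite !inE.
  by case: eqVneq => [->|_]; rewrite ?andbF ?Pe ?andbT.
have ub (P : pred (K * K)) : s * (count P ts)%:R <= kap * #|[set u in T | P (f u, f (g u))]|%:R.
  rewrite hts -sum_t !natr_sum !mulr_sumr; exact: ler_sum.
have img (P : pred K) : #|[set u in T | P (f (g u))]| = #|[set u in T | P (f u)]|.
  have gTT : g @: T = T.
    apply/eqP; rewrite eqEcard; apply/andP; split; last by rewrite card_in_imset.
    by apply/subsetP=> _ /imsetP[u uT ->]; exact: gT.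
  rewrite -(card_in_imset (f := g) (D := [set u in T | P (f (g u))])); last first.
    by move=> u v /setIdP[uT _] /setIdP[vT _]; exact: ginj.
  apply: eq_card => v; rewrite inE; apply/imsetP/andP => [[u /setIdP[uT Pu] ->]|[vT Pv]].
    by rewrite gT.
  by move: vT; rewrite -{1}gTT => /imsetP[u uT ev]; exists u; rewrite // inE uT -ev.
exists ts; split.
- move=> e ets.
  have : (0 < count (pred1 e) ts)%N by rewrite -has_count has_pred1.
  rewrite hts big_pred1_eq => ne; have : (0 < t e)%N.
    rewrite lt0n; apply: contraTneq ne => te; rewrite /n0 te mulr0 mul0r.
    by rewrite -leqNgt (_ : Num.truncn 0 = 0%N) // ?truncn0.
  by case/card_gt0P=> u /setIdP[uT /eqP eu]; exists u.
- move=> i; apply: le_trans (ub _) _; rewrite ler_pM2l // ler_nat; apply: subset_leq_card.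
  by apply/subsetP=> u; rewrite !inE => /andP[].
- move=> i; apply: le_trans (ub _) _; rewrite ler_pM2l // (img (pred1 i)) ler_nat; apply: subset_leq_card.
  by apply/subsetP=> u; rewrite !inE => /andP[].
- rewrite -(count_predT ts); apply: le_trans (ub _) _; rewrite ler_pM2l // ler_nat.
  by apply: subset_leq_card; apply/subsetP=> u; rewrite !inE => /andP[].
- move=> P; rewrite -img -(sum_t (fun e => P e.2)) hts !natr_sum !mulr_sumr.
  apply: (@le_trans _ _ (\sum_(e : K * K | P e.2) (kap * (t e)%:R - s))).
    rewrite sumrB lerD2l lerN2 sumr_const -[leLHS]mulr_natr ler_pM2l // ler_nat -card_prod.
    exact: max_card.
  by apply: ler_sum => e _.
Qed.

(** Each block uses its majority colour, which has at least half of the middle positions;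
    [spaced_subset] then finds [r] sites. The margins of five slots separate sites of different
    blocks and keep their neighbours clear of the links. *)
Lemma absorber_sites (T : finType) (H : rel T) (c : T -> bool) (pos : T -> nat) (l Q L Delta r N0 : nat) :
  symmetric H -> (forall z, (#|nbr H z| <= Delta)%N) -> injective pos ->
  (forall u, (pos u < #|T|)%N) -> (0 < l)%N -> (forall u v, H u v -> (pos u <= pos v + l)%N) ->
  (N0 * (Q * l) <= #|T|)%N -> (L + 10 < Q)%N -> (2 * (r * Delta.+1 ^ 4) <= (Q - L - 10) * l)%N ->
  exists (maj : nat -> bool) (I : {set T}), [/\
    {in I, forall x, [/\ (slot pos l x %/ Q < N0)%N, (5 <= slot pos l x %% Q)%N,
       (slot pos l x %% Q + L + 5 < Q)%N & c x = maj (slot pos l x %/ Q)%N]},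
    {in I &, forall x y, x != y -> y \notin ball H 4 x} &
    forall P : pred nat, #|[set x in I | P (slot pos l x %/ Q)%N]| = (r * count P (iota 0 N0))%N].
Proof.
move=> sH degH pinj plt l0 pH N0n LQ rle; set sl := slot pos l.
have Q0 : (0 < Q)%N by apply: leq_trans LQ.
pose inter b beta := [set u | (b * Q + 5 <= sl u < b * Q + (Q - L - 5))%N && (c u == beta)].
have slP b j j' u : (b * Q + j <= sl u < b * Q + j')%N = ((b * Q + j) * l <= pos u < (b * Q + j') * l)%N.
  by rewrite /sl /slot leq_divRL // ltn_divLR.
have cI b : (b < N0)%N -> (#|inter b true| + #|inter b false| = (Q - L - 10) * l)%N.
  move=> bN; rewrite -cardsUI (_ : inter b true :&: inter b false = set0) ?cards0 ?addn0; last first.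
    by apply/setP=> u; rewrite !inE; case: (c u); rewrite ?andbF.
  rewrite (_ : _ :|: _ = [set u | ((b * Q + 5) * l <= pos u < (b * Q + (Q - L - 5)) * l)%N]); last first.
    by apply/setP=> u; rewrite !inE slP; case: (c u); rewrite /= ?andbT ?andbF ?orbF.
  rewrite pos_card //; first by rewrite -mulnBl; congr (_ * _)%N; lia.
  apply/andP; split; first by rewrite leq_mul2r; apply/orP; right; lia.
  apply: leq_trans N0n; rewrite mulnA leq_mul2r; apply/orP; right.
  apply: (@leq_trans (b.+1 * Q)); first by rewrite mulSn; lia.
  by rewrite leq_mul2r bN orbT.
have /choice[sel hsel] : forall b, exists BI : bool * {set T}, (b < N0)%N ->
    [/\ BI.2 \subset inter b BI.1, #|BI.2| = r & {in BI.2 &, forall x y, x != y -> y \notin ball H 4 x}].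
  move=> b; case: (ltnP b N0) => bN; last by exists (true, set0).
  have [beta hb] : exists beta, (r * Delta.+1 ^ 4 <= #|inter b beta|)%N.
    have := cI b bN; case: (leqP (r * Delta.+1 ^ 4) #|inter b true|) => h1; first by exists true.
    case: (leqP (r * Delta.+1 ^ 4) #|inter b false|) => h2; first by exists false.
    move: h1 h2 rle; move: #|inter b true| #|inter b false| (r * _)%N ((Q - L - 10) * l)%N => x y z t.
    by clear; lia.
  by have [I [h1 h2 h3]] := spaced_subset sH degH hb; exists (beta, I).
pose I := [set x | (sl x %/ Q < N0)%N && (x \in (sel (sl x %/ Q)%N).2)].
have interP b beta x : x \in inter b beta -> [/\ (sl x %/ Q = b)%N, (5 <= sl x %% Q)%N,
    (sl x %% Q + L + 5 < Q)%N & c x = beta].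
  rewrite inE => /andP[/andP[h1 h2] /eqP->].
  have e : sl x = (b * Q + (sl x - b * Q))%N by rewrite subnKC //; apply: leq_trans h1; exact: leq_addr.
  have lt : (sl x - b * Q < Q)%N by move: h1 h2; clear; lia.
  have -> : (sl x %/ Q = b)%N by rewrite e divnMDl // (divn_small lt) addn0.
  have -> : (sl x %% Q = sl x - b * Q)%N by rewrite {1}e modnMDl (modn_small lt).
  by split=> //; move: h1 h2 LQ; clear; lia.
have inI x b : (b < N0)%N -> x \in (sel b).2 -> x \in inter b (sel b).1.
  by move=> bN; have [/subsetP h _ _] := hsel b bN; exact: h.
have IP x : x \in I -> (sl x %/ Q < N0)%N /\ x \in inter (sl x %/ Q)%N (sel (sl x %/ Q)%N).1.
  by rewrite inE => /andP[bN xs]; split=> //; exact: inI.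
exists (fun b => (sel b).1), I; split.
- by move=> x /IP[bN /interP[_ h1 h2 h3]].
- suff main x y : x \in I -> y \in I -> (sl x %/ Q <= sl y %/ Q)%N -> x != y -> y \notin ball H 4 x.
    move=> x y xI yI ne; case: (leqP (sl x %/ Q)%N (sl y %/ Q)%N) => h; first exact: main.
    by apply: contra (main y x yI xI (ltnW h) _); [exact: ball_sym | rewrite eq_sym].
  move=> xI yI; rewrite leq_eqVlt => /orP[/eqP e|lt] ne.
    have xs : x \in (sel (sl x %/ Q)%N).2 by move: (xI); rewrite /I in_set => /andP[].
    have ys : y \in (sel (sl x %/ Q)%N).2 by move: (yI); rewrite /I in_set -e => /andP[].
    by have [_ _ sp] := hsel _ (IP x xI).1; apply: sp.
  apply/negP=> /(ball_dist sH pH).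
  have [_ ] := IP x xI; rewrite inE => /andP[+ _]; rewrite slP => /andP[_ hx].
  have [_ ] := IP y yI; rewrite inE => /andP[+ _]; rewrite slP => /andP[hy _].
  apply/negP; rewrite -ltnNge; apply: leq_trans hy; rewrite mulnDl.
  have : ((sl x %/ Q).+1 * Q * l <= sl y %/ Q * Q * l)%N by rewrite !leq_mul2r lt !orbT.
  move: hx; rewrite mulSn !mulnDl => hx.
  have : ((Q - L - 5) * l <= Q * l)%N by rewrite leq_mul2r; apply/orP; right; lia.
  move: hx; move: ((Q - L - 5) * l)%N (sl x %/ Q * Q * l)%N (sl y %/ Q * Q * l)%N (Q * l)%N => a1 a2 a3 a4.
  by move: l0; clear; lia.
- move=> P; rewrite -sum1_card.
  pose bI (x : T) : 'I_N0.+1 := inord (sl x %/ Q)%N.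
  rewrite (partition_big bI xpredT) //=.
  transitivity (\sum_(b < N0.+1) (if (b < N0)%N && P b then r else 0)%N)%N.
    apply: eq_bigr => b _.
    transitivity #|[set x in I | P (sl x %/ Q)%N && (bI x == b)]|.
      by rewrite -sum1_card; apply: eq_bigl => x; rewrite !in_set -!andbA.
    case: (boolP ((b < N0)%N && P b)) => [/andP[bN Pb]|nb].
      have [h1 h2 _] := hsel b bN; rewrite -h2; apply: eq_card => x; rewrite !in_set.
      apply/andP/idP => [[/andP[xN xs] /andP[Px /eqP e]]|xs].
        have e' : (sl x %/ Q = b)%N by rewrite -e inordK // ltnS ltnW.
        by rewrite -e'.
      have [e _ _ _] := interP _ _ _ (inI _ _ bN xs).
      have eb : bI x == b by rewrite /bI e inord_val.
      by rewrite eb e bN xs Pb.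
    apply: eq_card0 => x; rewrite !in_set; apply: contraNF nb => /andP[/andP[xN xs] /andP[Px /eqP e]].
    by have e' : (sl x %/ Q = b)%N by [rewrite -e inordK // ltnS ltnW]; rewrite -e' xN.
  rewrite big_ord_recr /= ltnn addn0 -sum1_count [X in (r * X)%N]big_mkcond.
  rewrite [RHS]big_distrr [RHS](big_nth 0%N) size_iota big_mkord; apply: eq_bigr => b _.
  by rewrite nth_iota ?ltn_ord // add0n /=; case: (P b); rewrite ?muln1 ?muln0.
Qed.

Lemma card_fibers (T : finType) (A : {set T}) (F : T -> nat) (B : nat) :
  (forall u, u \in A -> (F u < B)%N) -> #|A| = (\sum_(b < B) #|[set u in A | F u == b]|)%N.
Proof.
case: B => [|B] hF.
  rewrite big_ord0; apply/eqP; rewrite cards_eq0; apply/eqP/setP=> u; rewrite inE.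
  by apply/negP=> /hF.
rewrite -sum1_card (partition_big (fun u => inord (F u) : 'I_B.+1) xpredT) //=.
apply: eq_bigr => b _; rewrite -sum1_card; apply: eq_bigl => u; rewrite inE.
case: (boolP (u \in A)) => //= uA; apply/eqP/eqP => [<-|->]; last exact: inord_val.
by rewrite inordK // hF.
Qed.

Lemma card_cls_all (V K : finType) (f : V -> K) (A : {set V}) : (\sum_i #|A :&: cls f i| = #|A|)%N.
Proof.
rewrite -[RHS]sum1_card (partition_big f xpredT) //=; apply: eq_bigr => i _.
by rewrite -sum1_card; apply: eq_bigl => v; rewrite !inE.
Qed.

(* [kap] is the proportion of the initial blocks, which occupy the positions below [J0] and contain
   the absorbing set [I]; [eta] bounds the part of a cluster used by the links between blocks, and
   [lam * iota_] the part of [V] lost to rounding and to exceptional clusters; [lab x] is the cluster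
   to which the neighbours of [x] in [I] are sent, and [Z] is the set kept free for [I]. *)
Lemma schedule_exists (R : realType) (V T K : finType) (G : rel V) (f : V -> K) (H : rel T)
  (c : T -> bool) (pos : T -> nat) (d dl zeta gamma nu sigma : R) (bad : rel K)
  (Delta l Q j r : nat) (kap lam eta iota_ : R)
  (L := j.*2.+2) (N : R := #|V|%:R) (s := (Q * l)%N) (KK : R := #|K|%:R * #|K|%:R)
  (sG : symmetric G) (rb : reduced_bound G f d dl zeta bad)
  (d0 : 0 < d) (dl0 : 0 < dl) (nu0 : 0 < nu) (g0 : 0 < gamma) (V0 : (0 < #|V|)%N)
  (min_deg : forall v, gamma * #|V|%:R <= #|nbr G v|%:R)
  (rob : robust_expander G nu sigma)
  (dnu : dl + 2 * d <= nu ^+ 2 / 4) (dg : dl + 2 * d <= gamma / 2) (dl1 : dl <= 1)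
  (s0 : 0 < sigma) (sg : sigma <= gamma / 8) (dls : dl <= sigma)
  (TV : #|T| = #|V|) (sH : symmetric H) (degH : forall z, (#|nbr H z| <= Delta)%N)
  (cH : forall u v, H u v -> c u != c v) (posI : injective pos) (pos_lt : forall u, (pos u < #|T|)%N)
  (l0 : (0 < l)%N) (posH : forall u v, H u v -> (pos u <= pos v + l)%N)
  (j0 : (0 < j)%N) (walk : 1 <= sigma + (j.*2.-1)%:R * (nu / 2))
  (LQ : (L + 10 < Q)%N) (rQ : (2 * (r * Delta.+1 ^ 4) <= (Q - L - 10) * l)%N)
  (rs : (r <= s)%N) (Drs : (Delta * r <= s)%N)
  (kap0 : 0 < kap) (kap1 : kap <= 1 / 8) (eta0 : 0 < eta) (eta1 : eta <= 1 / 16) (lam0 : 0 < lam <= 1)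
  (iota0 : 0 < iota_) (iota_le : iota_ * (2 * s%:R) <= r%:R * kap)
  (link_small : ((#|V| %/ s).+1 * (L * l))%:R <= eta * zeta * N)
  (types_small : s%:R * KK <= kap * (lam - dl) * N) (half_small : s%:R * KK <= kap * (1 / 2 - dl) * N)
  (slack : dl * N + 2 * eta * N + 2 * #|K|%:R + 4 * s%:R * KK + 1 <= lam * iota_ * N)
  (perm_nu : kap + lam * iota_ <= nu / 2) (perm_g : kap + lam * iota_ <= gamma / 4) :
  exists (h : T -> K) (I : {set T}) (lab : T -> K) (Z : {set V}) (J0 : nat),
  [/\ [/\ forall u v, H u v -> reduced G f d dl zeta (h u) (h v),
      forall x, x \in I -> forall y, H x y -> h y = lab x,
      {in I &, forall x y, x != y -> y \notin ball H 4 x},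
      forall u, zeta * N <= #|cls f (h u)|%:R &
      forall x z, x \in I -> z \in ball H 2 x -> (pos z < J0)%N],
    [/\ forall i, zeta * N <= #|cls f i|%:R ->
        #|[set u | (u \notin I) && (pos u < J0)%N && (h u == i)]|%:R <= (2 * kap + eta) * #|cls f i|%:R &
      forall i, zeta * N <= #|cls f i|%:R ->
        #|[set u | (u \notin I) && (h u == i)]|%:R + eta * #|cls f i|%:R <= #|cls f i :\: Z|%:R],
    [/\ forall i, #|Z :&: cls f i|%:R * N <= #|I|%:R * #|cls f i|%:R,
      #|I|%:R - #|Z|%:R <= 2 * lam * #|I|%:R & (#|Z| <= #|I|)%N],
    [/\ forall P : pred K, #|I|%:R * (#|[set u | P (f u)]|%:R - lam * N) <= #|[set x in I | P (lab x)]|%:R * N,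
      forall i, (Delta * #|[set x in I | lab x == i]|)%:R <= kap * #|cls f i|%:R,
      iota_ * N <= #|I|%:R & #|I|%:R <= kap * N] &
    forall x, x \in I -> exists v, v \in typical G f d dl zeta gamma /\ f v = lab x ].
Proof.

(* Types of the initial blocks and the absorbing set *)
have N0 : 0 < N by rewrite ltr0n.
have [e0 lam1] := andP lam0.
set T0 := typical G f d dl zeta gamma.
have cT0 : N - #|T0|%:R <= dl * N.
  have := card_typical rb d0 dl0 V0 min_deg dg; have := cardsC T0.
  by move/(congr1 (fun k => k%:R : R)); rewrite natrD -/N -/T0; lra.
have permOK := blowup_perm rb d0 dl0 nu0 g0 V0 rob dnu dg dl1 sg.
have slack' := slack.
have KK0 : 0 <= KK by rewrite mulr_ge0.
have pn : (kap + lam * iota_) * N <= nu / 2 * N by rewrite ler_pM2r.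
have pg : (kap + lam * iota_) * N <= gamma / 4 * N by rewrite ler_pM2r.
have sR0 : 0 <= 4 * s%:R * KK :> R by rewrite !mulr_ge0.
have eN0 : 0 < eta * N by rewrite mulr_gt0.
have kN0 : 0 < kap * N by rewrite mulr_gt0.
have K0 : 0 <= #|K|%:R :> R by [].
have dlN : dl * N <= lam * iota_ * N by move: slack' KK0 sR0 K0 eN0; clear; lra.
have [|||g [ginj gT0 gGs]] := permOK T0 _ _; [by [] | by move: cT0 dlN pn kN0; clear; lra | by move: cT0 dlN pg kN0; clear; lra | ].
have Q0 : (0 < Q)%N by apply: leq_trans LQ.
have sgt0 : (0 < s)%N by rewrite muln_gt0 Q0.
have sR : 0 < s%:R :> R by rewrite ltr0n.
have [ts [ts_in ts1 ts2 ts_size ts_P]] := initial_types f kap0 sR ginj gT0.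
have T0N : #|T0|%:R <= N by rewrite /N ler_nat max_card.
set N0' := size ts in ts_size.
have ts_sizeN : s%:R * N0'%:R <= kap * N by apply: le_trans ts_size _; rewrite ler_pM2l.
have N0s : (N0' * s <= #|T|)%N.
  rewrite TV -(ler_nat R) natrM mulrC; apply: le_trans ts_sizeN _.
  by rewrite ger_pMl // (le_trans kap1) // ler_pdivrMr // mul1r ler1n.
have [maj [I [I_slot I_far I_count]]] := absorber_sites c sH degH posI pos_lt l0 posH N0s LQ rQ.
pose sl u := slot pos l u; pose bk u := (sl u %/ Q)%N; pose nl u := (sl u %% Q < Q - L)%N.
have [u00 u00T] : exists u, u \in T0.
  apply/card_gt0P; rewrite -(ltr_nat R).
  have : kap * (1 / 2 - dl) * N <= kap * (1 / 2) * N by rewrite ler_pM2r // ler_pM2l //; move: dl0; clear; lra.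
  have : dl * N <= 1 / 2 * N.
    have : 0 <= kap * (1 / 2 - dl) * N by apply: le_trans half_small; rewrite mulr_ge0.
    rewrite -mulrA pmulr_rge0 // pmulr_lge0 // => h.
    by apply: ler_wpM2r; [exact: ltW | move: h; clear; lra].
  by move: cT0 N0; clear; lra.
pose ee0 := (f u00, f (g u00)).
pose ty b := nth ee0 ts b.
have tyE (P : pred (K * K)) : count (fun b => P (ty b)) (iota 0 N0') = count P ts.
  by rewrite -(count_map ty) -/(mkseq ty _) mkseq_nth.
pose lab x := (ty (bk x)).2.
have cardI (P : pred K) : #|[set x in I | P (lab x)]| = (r * count (fun e => P e.2) ts)%N.
  by rewrite -(tyE (fun e => P e.2)) -(I_count (fun b => P (ty b).2)).
have mE : #|I| = (r * N0')%N.
  have := cardI predT; rewrite (eq_count (a2 := predT)) // count_predT -/N0' => <-.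
  by apply: eq_card => x; rewrite inE andbT.
set m : R := #|I|%:R.
have mER : m = r%:R * N0'%:R by rewrite /m mE natrM.
have r0 : 0 <= r%:R :> R by [].
have mk : m <= kap * N.
  by apply: le_trans ts_sizeN; rewrite mER ler_wpM2r // ler_nat.
have miota : iota_ * N <= m.
  have h := ts_P predT; rewrite (eq_count (a2 := predT)) // count_predT -/N0' in h.
  have e : [set u in T0 | predT (f u)] = T0 by apply/setP=> u; rewrite inE andbT.
  rewrite e natrM -/KK in h.
  have h1 : kap * ((1 - dl) * N) <= kap * #|T0|%:R by rewrite ler_pM2l //; move: cT0; clear; lra.
  have h2 : kap * N / 2 <= s%:R * N0'%:R by move: half_small h h1; clear; lra.
  rewrite -(ler_pM2r (_ : 0 < 2 * s%:R)) ?mulr_gt0 //.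
  have : iota_ * (2 * s%:R) * N <= r%:R * kap * N by rewrite ler_pM2r.
  have : r%:R * (kap * N / 2) <= r%:R * (s%:R * N0'%:R) by rewrite ler_wpM2l.
  by rewrite mER; clear; lra.
have m0 : 0 < m by apply: lt_le_trans miota; rewrite mulr_gt0.

(* The reserved set and the load of the initial blocks *)
have mN : m <= N by apply: le_trans mk _; rewrite ger_pMl // (le_trans kap1) // ler_pdivrMr // mul1r ler1n.
(* Proportional shares of [(1 - lam) * m] instead of [m]: the difference [lam * m] pays for all
   later losses. *)
pose z0 i := Num.truncn ((1 - lam) * m * #|cls f i|%:R / N).
have z0x i : 0 <= (1 - lam) * m * #|cls f i|%:R / N.
  by rewrite divr_ge0 ?mulr_ge0 ?subr_ge0 // ltW.
have z0_le i : (z0 i)%:R * N <= (1 - lam) * m * #|cls f i|%:R.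
  by rewrite -ler_pdivlMr //; have /andP[] := truncn_itv (z0x i).
have z0_ge i : (1 - lam) * m * #|cls f i|%:R <= ((z0 i)%:R + 1) * N.
  by rewrite -ler_pdivrMr //; have /andP[_ /ltW] := truncn_itv (z0x i); rewrite -natr1.
have lm0 : (1 - lam) * m <= m by rewrite ger_pMl //; move: e0; clear; lra.
have z0_cls i : (z0 i)%:R * N <= m * #|cls f i|%:R.
  by apply: le_trans (z0_le i) _; rewrite ler_wpM2r.
have [i|Z [_ cZ]] := @subset_of_sizes V K f setT z0.
  rewrite setTI -(ler_nat R) -(ler_pM2r N0); apply: le_trans (z0_cls i) _.
  by rewrite mulrC; apply: ler_wpM2l.
have totcls : \sum_i #|cls f i|%:R = N :> R.
  by rewrite card_cls; congr (_%:R); apply: eq_card => v; rewrite inE.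
have ZE : #|Z|%:R = \sum_i (z0 i)%:R :> R.
  by rewrite -(card_cls_all f) natr_sum; apply: eq_bigr => i _; rewrite cZ.
have Zup : #|Z|%:R <= (1 - lam) * m.
  rewrite -(ler_pM2r N0) ZE mulr_suml -[X in _ <= _ * X]totcls mulr_sumr; exact: ler_sum.
have Zlo : (1 - lam) * m - #|K|%:R <= #|Z|%:R.
  rewrite lerBlDr -(ler_pM2r N0) -[X in _ * X <= _]totcls mulr_sumr.
  apply: le_trans (ler_sum _ (fun i _ => z0_ge i)) _.
  by rewrite -mulr_suml big_split /= -ZE sumr_const.
have KmL : #|K|%:R <= lam * m.
  have : lam * (iota_ * N) <= lam * m by rewrite ler_pM2l.
  have : 0 < dl * N by rewrite mulr_gt0.
  by move: slack' sR0 eN0 dlN K0; clear; lra.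
(* Orients the type so that the colour opposite to that of the sites, hence every neighbour of a
   site, goes to the second entry of [ty b], which is [lab]. *)
pose e1 b := if maj b then ty b else ((ty b).2, (ty b).1).
pose side (e : K * K) u := if c u then e.1 else e.2.
have bkE u : bk u = (pos u %/ s)%N by rewrite /bk /sl /slot -divnMA mulnC.
have bk_card b (P : pred T) : (#|[set u | (bk u == b) && P u]| <= s)%N.
  have sub : [set u | (bk u == b) && P u] \subset [set u | (b * s <= pos u < b.+1 * s)%N].
    apply/subsetP=> u; rewrite !inE => /andP[/eqP <- _].
    by rewrite bkE leq_divM ltn_ceil.
  apply: leq_trans (subset_leq_card sub) _; apply: leq_trans (pos_card_le posI _ _) _.
  by rewrite mulSn addnK.
pose init i := #|[set u | [&& u \notin I, (bk u < N0')%N, nl u & side (e1 (bk u)) u == i]]|.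
have init_le i : (init i)%:R <= 2 * kap * #|cls f i|%:R.
  have h1 : (init i <= s * (count (fun e => e.1 == i) ts + count (fun e => e.2 == i) ts))%N.
    rewrite /init (card_fibers (F := bk) (B := N0')); last by move=> u; rewrite inE => /and4P[].
    rewrite -(tyE (fun e => e.1 == i)) -(tyE (fun e => e.2 == i)) -!sum1_count.
    rewrite ![X in (_ <= s * (X + _))%N]big_mkcond [X in (_ <= s * (_ + X))%N]big_mkcond -big_split /=.
    rewrite big_distrr (big_nth 0%N) size_iota big_mkord; apply: leq_sum => b _ /=.
    rewrite nth_iota // add0n.
    set A := [set u in _ | _].
    have sA : A \subset [set u | (bk u == b) && (u \notin I)].
      by apply/subsetP=> u; rewrite !inE => /andP[/and4P[-> _ _ _] ->].
    case: (boolP (((ty b).1 == i) || ((ty b).2 == i))) => [hb|].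
      apply: leq_trans (subset_leq_card sA) (leq_trans (bk_card b _) _).
      by case/orP: hb => ->; rewrite -[leqLHS]muln1 leq_mul2l; apply/orP; right; case: (_ == i).
    rewrite negb_or => /andP[n1 n2]; suff -> : A = set0 by rewrite cards0.
    apply/setP=> u; rewrite in_set0; apply/negP=> /setIdP[]; rewrite inE => /and4P[_ _ _ hu] /eqP eb.
    move: hu; rewrite eb /e1 /side; case: (maj b); case: (c u) => /=; rewrite ?(negbTE n1) ?(negbTE n2) //.
  move: h1; rewrite -(ler_nat R) natrM natrD mulrDr => h1.
  by have := ts1 i; have := ts2 i; move: h1; clear; lra.
have sum_init : (\sum_i init i <= N0' * s - #|I|)%N.
  pose A := [set u | (u \notin I) && (bk u < N0')%N].
  apply: (@leq_trans #|A|).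
    rewrite -(card_cls_all (fun u => side (e1 (bk u)) u) A); apply: leq_sum => i _.
    by apply: subset_leq_card; apply/subsetP=> u; rewrite !inE => /and4P[-> -> _ ->].
  have Isub : I \subset [set u | (bk u < N0')%N] by apply/subsetP=> x /I_slot[h _ _ _]; rewrite inE.
  have -> : A = [set u | (bk u < N0')%N] :\: I by apply/setP=> u; rewrite !inE.
  rewrite cardsD (setIidPr Isub); apply: leq_sub2r.
  rewrite (card_fibers (F := bk) (B := N0')); last by move=> u; rewrite inE.
  rewrite -[X in (_ <= X * s)%N](card_ord N0') -sum_nat_const; apply: leq_sum => b _.
  rewrite (eq_card (B := [set u | (bk u == b) && (bk u < N0')%N])) ?bk_card // => u.
  by rewrite !inE andbC.

(* Capacities left for the main blocks *)
pose gi i := (Num.truncn (2 * eta * #|cls f i|%:R)).+1.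
(* Of the gap [2 * eta], one half is for the link slots and the other is the free room claimed in
   the conclusion. *)
have gi_itv i : 2 * eta * #|cls f i|%:R <= (gi i)%:R <= 2 * eta * #|cls f i|%:R + 1.
  have x0 : 0 <= 2 * eta * #|cls f i|%:R by rewrite !mulr_ge0 // ltW.
  by have /andP[h1 h2] := truncn_itv x0; rewrite (ltW h2) /gi -natr1 lerD2r h1.
pose z i := (#|T0 :&: cls f i| - (z0 i + init i + gi i))%N.
have [i|U [UT0 cU]] := @subset_of_sizes V K f T0 z; first exact: leq_subr.
have mN0 : (#|I| <= N0' * s)%N by rewrite mE mulnC leq_mul2l rs orbT.
(* The set [I] needs no room in the schedule and [Z] takes at most [(1 - lam) * m], which leaves the
   surplus [lam * m]; by [slack] it covers the atypical vertices, the gaps and the rounding. *)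
have cUlb : N - dl * N + lam * m - N0'%:R * s%:R - 2 * eta * N - #|K|%:R <= #|U|%:R.
  have e1' : #|U|%:R = \sum_i (z i)%:R :> R.
    by rewrite -(card_cls_all f) natr_sum; apply: eq_bigr => i _; rewrite cU.
  have le1 : \sum_i (#|T0 :&: cls f i|%:R - (z0 i)%:R - (init i)%:R - (2 * eta * #|cls f i|%:R + 1)) <= #|U|%:R :> R.
    rewrite e1'; apply: ler_sum => i _; have /andP[_ hg] := gi_itv i.
    have : (#|T0 :&: cls f i| <= z i + (z0 i + init i + gi i))%N by rewrite /z addnC -leq_subLR.
    by rewrite -(ler_nat R) !natrD; move: hg; clear; lra.
  apply: le_trans le1; rewrite !sumrB big_split /= -mulr_sumr totcls sumr_const -ZE.
  have -> : \sum_i #|T0 :&: cls f i|%:R = #|T0|%:R :> R by rewrite -natr_sum card_cls_all.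
  have : \sum_i (init i)%:R <= N0'%:R * s%:R - m.
    by rewrite -natr_sum -natrM -natrB // ler_nat.
  by move: cT0 Zup; clear; lra.
have ts_N : N0'%:R * s%:R <= kap * N by rewrite mulrC.
have lamm : lam * (iota_ * N) <= lam * m by rewrite ler_pM2l.
have NU : N - #|U|%:R <= kap * N.
  by move: cUlb ts_N lamm slack' dlN KK0 sR0 K0 eN0; clear; lra.
have li0 : 0 < lam * iota_ * N by rewrite !mulr_gt0.
have [||pi [piI piU piG]] := permOK U UT0; [by move: NU pn li0; clear; lra | by move: NU pg li0; clear; lra | ].

(* Allocation of the main blocks to edges of the reduced graph *)
pose t e := #|[set u in U | (f u, f (pi u)) == e]|.
have sum_t (P : pred (K * K)) : (\sum_(e | P e) t e)%N = #|[set u in U | P (f u, f (pi u))]|.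
  rewrite -sum1_card (partition_big (fun u => (f u, f (pi u))) P) /=; last by move=> u; rewrite inE => /andP[].
  apply: eq_bigr => e Pe; rewrite /t -sum1_card; apply: eq_bigl => u; rewrite !inE.
  by case: eqVneq => [->|_]; rewrite ?andbF ?Pe ?andbT.
pose B := (#|T| %/ s).+1.
pose xc b := #|[set u | (bk u == N0' + b)%N && (nl u && c u)]|.
pose yc b := #|[set u | (bk u == N0' + b)%N && (nl u && ~~ c u)]|.
have xy b : (xc b + yc b = #|[set u | (bk u == N0' + b)%N && nl u]|)%N.
  have dis : [set u | (bk u == N0' + b)%N && (nl u && c u)] :&: [set u | (bk u == N0' + b)%N && (nl u && ~~ c u)] = set0.
    by apply/setP=> u; rewrite !inE; case: (c u); rewrite ?andbF.
  rewrite /xc /yc -cardsUI dis cards0 addn0.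
  by apply: eq_card => u; rewrite !inE; case: (c u); rewrite /= ?andbT ?andbF ?orbF.
have bkB u : (bk u < B)%N by rewrite bkE /B ltnS leq_div2r // ltnW.
have sumxy : (\sum_(b < B) (xc b + yc b) <= #|T| - N0' * s)%N.
  apply: leq_trans (pos_card_le posI (N0' * s) #|T|).
  pose A := [set u | (N0' <= bk u)%N && nl u].
  rewrite (eq_bigr (fun b : 'I_B => #|[set u in A | (bk u - N0' == b)%N]|)); last first.
    move=> b _; rewrite xy; apply: eq_card => u; rewrite !inE.
    case: (leqP N0' (bk u)) => h /=; first by rewrite -[(bk u - N0' == b)%N](eqn_add2l N0') subnKC // andbC.
    by rewrite (_ : (bk u == _) = false) //; apply/negbTE; rewrite neq_ltn (leq_trans h) ?leq_addr.
  rewrite -(card_fibers (F := fun u => (bk u - N0')%N)); last first.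
    by move=> u _; apply: leq_ltn_trans (leq_subr _ _) (bkB u).
  apply: subset_leq_card; apply/subsetP=> u; rewrite !inE => /andP[h _].
  by rewrite pos_lt andbT (leq_trans _ (leq_divM (pos u) s)) // leq_mul2r -bkE h orbT.
have [| |a [a_pos a_load]] := @block_allocation (K * K)%type t xc yc s B.
- by move=> b; rewrite xy; exact: bk_card.
- have -> : (\sum_e t e)%N = #|U| by rewrite sum_t; apply: eq_card => u; rewrite inE andbT.
  rewrite card_prod -(ltr_nat R) natrD !natrM.
  have : (\sum_(b < B) (xc b + yc b))%:R <= N - N0'%:R * s%:R :> R.
    by rewrite /N -natrM -TV -natrB // ler_nat.
  by rewrite -[Q%:R * l%:R]natrM -/s -/KK; move: cUlb lamm slack' K0; clear; lra.

(* Links between consecutive blocks and the homomorphism *)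
pose e b := if (b < N0')%N then e1 b else if (b - N0' < B)%N then
  (if (a (b - N0')%N).2 then (a (b - N0')%N).1 else ((a (b - N0')%N).1.2, (a (b - N0')%N).1.1)) else ee0.
have rsym := reduced_sym G f d dl zeta.
have swapOK (e' : K * K) (o : bool) : (exists u w, [/\ u \in T0, w \in T0, e' = (f u, f w) & reduced G f d dl zeta (f u) (f w)]) ->
   exists u w, [/\ u \in T0, w \in T0, (if o then e' else (e'.2, e'.1)) = (f u, f w) & reduced G f d dl zeta (f u) (f w)].
  move=> [u [w [uT wT -> ruw]]]; case: o; first by exists u, w.
  by exists w, u; split=> //; rewrite rsym.
have eOK b : exists u w, [/\ u \in T0, w \in T0, e b = (f u, f w) & reduced G f d dl zeta (f u) (f w)].
  rewrite /e; case: ltnP => hb.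
    apply: swapOK; have /ts_in[u uT eu] : ty b \in ts by apply: mem_nth.
    by exists u, (g u); split=> //; [exact: gT0 | exact: gGs].
  case: ltnP => hb2; last by exists u00, (g u00); split=> //; [exact: gT0 | exact: gGs].
  apply: swapOK; have := a_pos _ hb2; rewrite /t => /card_gt0P[u /setIdP[uU /eqP eu]].
  exists u, (pi u); split=> //; [exact: subsetP UT0 _ uU | exact: subsetP UT0 _ (piU _ uU) | exact: piG].
(* With [j.*2.-1] steps of growth the walk has [j.*2] inner vertices, the even number required by
   [link_states]. *)
have walkOK := blowup_walk rb d0 dl0 nu0 g0 V0 min_deg rob dnu dg dl1 s0 sg dls walk.
have links b : exists st : nat -> K * K, [/\ st 0%N = e b, st L = e b.+1,
    forall i, reduced G f d dl zeta (st i).1 (st i).2 & forall i, share (st i) (st i.+1)].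
  have [u1 [w1 [u1T w1T -> r1]]] := eOK b; have [u2 [w2 [u2T w2T -> r2]]] := eOK b.+1.
  have [p [sp pp]] := walkOK _ _ u1T w2T.
  apply: (link_states rsym (p := map f p) (j := j)) => //.
    by rewrite size_map sp prednK // double_gt0.
  by rewrite -map_rcons path_map.
have [st [st_red st_share st_e]] := schedule_states (isT : 0 < L)%N (leq_trans (leq_addr 10 L.+1) LQ : (L < Q)%N) links.
pose h := scheduled c pos l st.
have h_nl u : nl u -> h u = side (e (bk u)) u.
  by move=> nu_; rewrite /h /scheduled /side (st_e _ nu_).
have zeta_l i : zeta * N <= #|cls f i|%:R -> eta * zeta * N <= eta * #|cls f i|%:R.
  by move=> hi; rewrite -mulrA ler_pM2l.

(* Loads of the links and of the main blocks *)
pose LK := [set u | ~~ nl u].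
have cLK : #|LK|%:R <= eta * zeta * N.
  apply: le_trans link_small; rewrite ler_nat (card_fibers (F := bk) (B := B)) // -TV -/B.
  rewrite -[X in (_ <= X * _)%N](card_ord B) -sum_nat_const; apply: leq_sum => b _.
  have sub : [set u in LK | bk u == b] \subset [set u | ((b * Q + (Q - L)) * l <= pos u < b.+1 * Q * l)%N].
    apply/subsetP=> u; rewrite !inE /nl -leqNgt => /andP[h1 /eqP eb].
    rewrite -leq_divRL // -ltn_divLR // -/(slot pos l u) -/(sl u) (divn_eq (sl u) Q) -/(bk u) eb.
    by rewrite leq_add2l h1 mulSn addnC ltn_add2r ltn_pmod.
  apply: leq_trans (subset_leq_card sub) _; apply: leq_trans (pos_card_le posI _ _) _.
  rewrite -mulnBl leq_mul2r; apply/orP; right; rewrite mulSn; move: LQ; clear; lia.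
pose main i := #|[set u | [&& (N0' <= bk u)%N, nl u & h u == i]]|.
have img i : (#|[set u in U | f (pi u) == i]| <= #|U :&: cls f i|)%N.
  rewrite -(card_in_imset (f := pi) (D := [set u in U | f (pi u) == i])); last first.
    by move=> u v /setIdP[uU _] /setIdP[vU _]; exact: piI.
  apply: subset_leq_card; apply/subsetP=> _ /imsetP[u /setIdP[uU fu] ->].
  by rewrite inE piU // inE.
(* Cluster [i] receives at most half of the types with first entry [i] and half of those with second
   entry [i]; since [pi] permutes [U], each family has at most [#|U :&: cls f i|] members. *)
have main_le i : (main i <= #|U :&: cls f i|)%N.
  pose w1 b := if (a b).2 then xc b else yc b; pose w2 b := if (a b).2 then yc b else xc b.
  have h1 : (main i <= \sum_(b < B | (a b).1.1 == i) w1 b + \sum_(b < B | (a b).1.2 == i) w2 b)%N.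
    rewrite /main (card_fibers (F := fun u => (bk u - N0')%N) (B := B)); last first.
      by move=> u _; apply: leq_ltn_trans (leq_subr _ _) (bkB u).
    rewrite [X in (_ <= X + _)%N]big_mkcond [X in (_ <= _ + X)%N]big_mkcond -big_split /=.
    apply: leq_sum => b _; pose st' := if (a b).2 then (a b).1 else ((a b).1.2, (a b).1.1).
    have sub : [set u in [set u | [&& (N0' <= bk u)%N, nl u & h u == i]] | (bk u - N0')%N == b] \subset
        (if st'.1 == i then [set u | (bk u == N0' + b)%N && (nl u && c u)] else set0) :|:
        (if st'.2 == i then [set u | (bk u == N0' + b)%N && (nl u && ~~ c u)] else set0).
      apply/subsetP=> u /setIdP[]; rewrite inE => /and3P[hb hnl /eqP hu] /eqP eb.
      have ebk : bk u = (N0' + b)%N by rewrite -eb subnKC.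
      have est : e (bk u) = st' by rewrite /e ltnNge hb /= eb ltn_ord.
      move: hu; rewrite h_nl // est /side; case cu: (c u) => hu.
        by apply/setUP; left; rewrite hu eqxx inE ebk eqxx hnl cu.
      by apply/setUP; right; rewrite hu eqxx inE ebk eqxx hnl cu.
    apply: leq_trans (subset_leq_card sub) _; apply: leq_trans (leq_card_setU _ _) _.
    rewrite /w1 /w2 /st' /xc /yc; case: (a b).2 => /=; last rewrite addnC.
      by apply: leq_add; case: ifP; rewrite ?cards0.
    by apply: leq_add; case: ifP; rewrite ?cards0.
  have part (w : nat -> nat) (P : pred (K * K)) : (\sum_(b < B | P (a b).1) w b =
     \sum_(e | P e) \sum_(b < B | (a b).1 == e) w b)%N.
    rewrite (partition_big (fun b : 'I_B => (a b).1) P) //=; apply: eq_bigr => e' Pe.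
    by apply: eq_bigl => b; case: eqVneq => [->|_]; rewrite ?Pe ?andbT ?andbF.
  have h2 : (2 * \sum_(b < B | (a b).1.1 == i) w1 b <= #|U :&: cls f i|)%N.
    rewrite (part w1 (fun e => e.1 == i)) big_distrr /=.
    apply: (@leq_trans (\sum_(e | e.1 == i) t e)); first by apply: leq_sum => e' _; case: (a_load e').
    by rewrite sum_t; apply: subset_leq_card; apply/subsetP=> u; rewrite !inE.
  have h3 : (2 * \sum_(b < B | (a b).1.2 == i) w2 b <= #|U :&: cls f i|)%N.
    rewrite (part w2 (fun e => e.2 == i)) big_distrr /=.
    apply: (@leq_trans (\sum_(e | e.2 == i) t e)); first by apply: leq_sum => e' _; case: (a_load e').
    by rewrite sum_t; exact: img.
  move: h1 h2 h3; move: (main i) #|_ :&: _| (\sum_(b < B | _) _)%N (\sum_(b < B | _) _)%N => n1 n2 n3 n4.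
  by clear; lia.
have z0k i : (z0 i)%:R <= kap * #|cls f i|%:R.
  rewrite -(ler_pM2r N0); apply: le_trans (z0_cls i) _.
  have : m * #|cls f i|%:R <= kap * N * #|cls f i|%:R by rewrite ler_wpM2r.
  by clear; lra.
have init_pos i u : u \notin I -> (bk u < N0')%N -> nl u -> h u == i ->
    u \in [set u | [&& u \notin I, (bk u < N0')%N, nl u & side (e1 (bk u)) u == i]].
  by move=> uI ub un; rewrite h_nl // /e ub => hu; rewrite inE uI ub un hu.
have posbk u : (pos u < N0' * s)%N = (bk u < N0')%N by rewrite bkE ltn_divLR.
have split_slot x : sl x = (bk x * Q + sl x %% Q)%N by exact: divn_eq.

(* Verification of the required properties *)
exists h, I, lab, Z, (N0' * s)%N; split.
- split.
  + by move=> u v; apply: (scheduled_hom sH cH l0 posH rsym).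
  + move=> x0 xI y0 Hxy; have [xb x5 xL cx] := I_slot x0 xI.
    have n1 : (sl y0 <= (sl x0).+1)%N by apply: (slot_near l0 posH); rewrite sH.
    have n2 : (sl x0 <= (sl y0).+1)%N by apply: (slot_near l0 posH).
    (* A neighbour is at most one slot away, so the margins keep it in the same block and outside
       the link. *)
    pose w := (sl y0 - bk x0 * Q)%N.
    have x5' : (5 <= sl x0 %% Q)%N := x5; have xL' : (sl x0 %% Q + L + 5 < Q)%N := xL.
    have [ew lw] : sl y0 = (bk x0 * Q + w)%N /\ (w < Q - L)%N.
      have := split_slot x0; rewrite /w; move: n1 n2 x5' xL'; move: (sl y0) (sl x0) (bk x0 * Q)%N (sl x0 %% Q)%N.
      by move=> p1 p2 p3 p4; clear; lia.
    have wQ : (w < Q)%N by apply: leq_trans lw (leq_subr _ _).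
    have by0 : bk y0 = bk x0 by rewrite /bk ew divnMDl // (divn_small wQ) addn0.
    have ny : nl y0 by rewrite /nl ew modnMDl (modn_small wQ).
    have xb' : (bk x0 < N0')%N := xb.
    rewrite h_nl // by0 /e xb' /e1 /side /lab -/(bk x0).
    by have := cH _ _ Hxy; rewrite cx -/(sl x0) -/(bk x0); case: (maj (bk x0)); case: (c y0).
  + exact: I_far.
  + move=> u; have := st_red (sl u); rewrite /reduced => /and4P[_ _ z1 z2].
    by rewrite /h /scheduled -/(sl u); case: (c u).
  + move=> x0 z1 xI zb; have [xb x5 xL cx] := I_slot x0 xI.
    have := ball_dist sH posH zb; have : (pos x0 < (sl x0).+1 * l)%N by rewrite ltn_ceil.
    rewrite split_slot => h1 h2; apply: leq_ltn_trans h2 _.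
    apply: (@leq_trans ((bk x0).+1 * Q * l)); last first.
      by rewrite /s mulnA leq_mul2r leq_mul2r; apply/orP; right; apply/orP; right.
    have xL' : (sl x0 %% Q + L + 5 < Q)%N := xL.
    apply: (@leq_trans ((bk x0 * Q + sl x0 %% Q).+1 * l + 2 * l)); first by rewrite ltn_add2r.
    by rewrite -mulnDl leq_mul2r; apply/orP; right; rewrite mulSn; move: xL'; clear; lia.
- split=> i hi; have hz := zeta_l i hi.
  + have : (#|[set u | (u \notin I) && (pos u < N0' * s)%N && (h u == i)]| <= init i + #|LK|)%N.
      apply: leq_trans (leq_card_setU _ _); apply: subset_leq_card; apply/subsetP=> u; rewrite inE posbk.
      move=> /andP[/andP[uI ub] hu]; apply/setUP; case: (boolP (nl u)) => hn; last by right; rewrite inE.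
      by left; exact: init_pos.
    by rewrite -(ler_nat R) natrD; move: cLK (init_le i) hz; clear; lra.
  have : (#|[set u | (u \notin I) && (h u == i)]| <= init i + z i + #|LK|)%N.
    rewrite -cU; apply: leq_trans (_ : init i + main i + #|LK| <= _)%N; last first.
      by rewrite leq_add2r leq_add2l.
    have sub : [set u | (u \notin I) && (h u == i)] \subset
       [set u | [&& u \notin I, (bk u < N0')%N, nl u & side (e1 (bk u)) u == i]] :|:
       [set u | [&& (N0' <= bk u)%N, nl u & h u == i]] :|: LK.
      apply/subsetP=> u; rewrite inE => /andP[uI hu].
      case: (boolP (nl u)) => hn; last by apply/setUP; right; rewrite inE.
      apply/setUP; left; apply/setUP; case: (ltnP (bk u) N0') => hb; first by left; exact: init_pos.
      by right; rewrite inE hb hn.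
    apply: leq_trans (subset_leq_card sub) _; apply: leq_trans (leq_card_setU _ _) _.
    by rewrite leq_add2r; exact: leq_card_setU.
  have cD : #|cls f i :\: Z|%:R = #|cls f i|%:R - (z0 i)%:R :> R.
    have h0 := cardsID Z (cls f i); rewrite setIC cZ in h0.
    by rewrite -h0 natrD addrC addKr.
  rewrite -(ler_nat R) !natrD cD => hle; have /andP[hg _] := gi_itv i.
  have hT : #|T0 :&: cls f i|%:R <= #|cls f i|%:R :> R by rewrite ler_nat subset_leq_card // subsetIr.
  have c00 : 0 <= #|cls f i|%:R :> R by [].
  have ek1 : kap * #|cls f i|%:R <= 1 / 8 * #|cls f i|%:R by rewrite ler_wpM2r.
  have ek2 : eta * #|cls f i|%:R <= 1 / 16 * #|cls f i|%:R by rewrite ler_wpM2r.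
  (* If [z i] was truncated to 0, the typical part may be tiny, but then the initial blocks and the
     links alone use less than half of the cluster. *)
  case: (leqP #|T0 :&: cls f i| (z0 i + init i + gi i)) => hz2.
    have zi0 : (z i)%:R = 0 :> R by rewrite /z (eqP hz2).
    by move: hle cLK (init_le i) hz (z0k i) zi0 ek1 ek2 c00; clear; lra.
  have zi : (z i)%:R + (z0 i)%:R + (init i)%:R + (gi i)%:R = #|T0 :&: cls f i|%:R :> R.
    have zE : (z i + (z0 i + init i + gi i) = #|T0 :&: cls f i|)%N by rewrite subnK // ltnW.
    by rewrite -zE !natrD !addrA.
  by move: hle cLK hz zi hg hT; clear; lra.
- split=> [i||].
  + by rewrite cZ.
  + by move: Zlo KmL; rewrite -/m; clear; lra.
  + by rewrite -(ler_nat R) -/m (le_trans Zup).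
- split=> // [P|i].
  + rewrite -/m cardI natrM.
    set A := #|[set u | P (f u)]|%:R; set ct := (count _ ts)%:R : R.
    have [neg|pos_] := leP (A - lam * N) 0.
      apply: (@le_trans _ _ 0); first by rewrite mulr_ge0_le0 // ltW.
      by rewrite !mulr_ge0.
    have hA : A - dl * N <= #|[set u in T0 | P (f u)]|%:R.
      have : (#|[set u | P (f u)]| <= #|[set u in T0 | P (f u)]| + #|~: T0|)%N.
        apply: leq_trans (leq_card_setU _ _); apply: subset_leq_card; apply/subsetP=> u.
        by rewrite !inE => ->; case: (_ <= _).
      rewrite -(ler_nat R) natrD -/A; have := cardsC T0; move/(congr1 (fun k => k%:R : R)).
      by rewrite natrD -/N; move: cT0; clear; lra.
    have h1 : kap * (A - lam * N) <= s%:R * ct.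
      have := ts_P P; rewrite natrM -/KK -/ct.
      have : kap * (A - dl * N) <= kap * #|[set u in T0 | P (f u)]|%:R by rewrite ler_pM2l.
      by move: types_small; clear; lra.
    rewrite -(ler_pM2l sR) mER.
    have h2 : r%:R * (s%:R * N0'%:R) * (A - lam * N) <= r%:R * (kap * N) * (A - lam * N).
      by apply: ler_wpM2r; [exact: ltW | exact: ler_wpM2l].
    have h3 : r%:R * N * (kap * (A - lam * N)) <= r%:R * N * (s%:R * ct).
      by apply: ler_wpM2l => //; rewrite mulr_ge0 // ltW.
    by move: h2 h3; clear; lra.
  + rewrite (cardI (pred1 i)) mulnA natrM; apply: le_trans (ts2 i).
    by apply: ler_wpM2r; rewrite // ler_nat.
- move=> x0 xI; have [xb _ _ _] := I_slot x0 xI.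
  have /ts_in[u uT eu] : ty (bk x0) \in ts by apply: mem_nth.
  by exists (g u); split; [exact: gT0 | rewrite /lab -eu].
Qed.

(** * Embedding into robust expanders *)

Lemma mem_mask_nth (V : eqType) (m : bitseq) (s : seq V) x0 i :
  (i < size s)%N -> nth false m i -> nth x0 s i \in mask m s.
Proof.
elim: m s i => [|b m IH] [|u s] [|i] //=; rewrite ?nth_nil //.
  by move=> _ ->; rewrite mem_head.
by move=> lt mi; case: b; rewrite /= ?inE IH ?orbT.
Qed.

Lemma card_cls_in (V K : finType) (f : V -> K) (A : {set V}) (P : pred K) :
  (\sum_(i | P i) #|A :&: cls f i| = #|[set v in A | P (f v)]|)%N.
Proof.
rewrite -[RHS]sum1_card (partition_big f P) /=; last by move=> v; rewrite inE => /andP[].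
apply: eq_bigr => i Pi; rewrite -sum1_card; apply: eq_bigl => v; rewrite !inE.
by case: eqVneq => [->|]; rewrite ?Pi ?andbT ?andbF.
Qed.

(** [C0] to [C12] are conclusions of [schedule_exists]; the numerical hypotheses after them are met
    by the constants chosen in [robust_expanders_contain]. *)
Lemma embed_with_absorbers (R : realType) (V T K : finType) (G : rel V) (f : V -> K) (H : rel T)
  (c : T -> bool) (pos : T -> nat) (d dl zeta gamma nu sigma : R) (bad : rel K)
  (Delta l e0 Lh J0 : nat) (kap lam eta iota_ p tau1 tau2 : R)
  (h : T -> K) (I : {set T}) (lab : T -> K) (Z : {set V})
  (N : R := #|V|%:R) (m : R := #|I|%:R) (D2 := d / 2)
  (sG : symmetric G) (iG : irreflexive G) (rb : reduced_bound G f d dl zeta bad)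
  (d0 : 0 < d <= 1) (dl0 : 0 < dl) (nu0 : 0 < nu) (g0 : 0 < gamma <= 1) (V0 : (0 < #|V|)%N)
  (min_deg : forall v, gamma * #|V|%:R <= #|nbr G v|%:R)
  (rob : robust_expander G nu sigma)
  (dnu : dl + 2 * d <= nu ^+ 2 / 4) (dg : dl + 2 * d <= gamma / 2) (dl1 : dl <= 1)
  (s0 : 0 < sigma) (sg : sigma <= gamma / 8)
  (TV : #|T| = #|V|) (sH : symmetric H) (iH : irreflexive H) (degH : forall z, (#|nbr H z| <= Delta)%N)
  (cH : forall u v, H u v -> c u != c v) (posI : injective pos)
  (posH : forall u v, H u v -> (pos u <= pos v + l)%N)
  (C1 : forall u v, H u v -> reduced G f d dl zeta (h u) (h v))
  (C2 : forall x, x \in I -> forall y, H x y -> h y = lab x)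
  (C3 : {in I &, forall x y, x != y -> y \notin ball H 4 x})
  (C0 : forall u, zeta * N <= #|cls f (h u)|%:R)
  (C4 : forall x z, x \in I -> z \in ball H 2 x -> (pos z < J0)%N)
  (C5 : forall i, zeta * N <= #|cls f i|%:R ->
        #|[set u | (u \notin I) && (pos u < J0)%N && (h u == i)]|%:R <= (2 * kap + eta) * #|cls f i|%:R)
  (C6 : forall i, zeta * N <= #|cls f i|%:R ->
        #|[set u | (u \notin I) && (h u == i)]|%:R + eta * #|cls f i|%:R <= #|cls f i :\: Z|%:R)
  (C7 : forall i, #|Z :&: cls f i|%:R * N <= m * #|cls f i|%:R)
  (C8 : m - #|Z|%:R <= 2 * lam * m)
  (C9 : forall P : pred K, m * (#|[set u | P (f u)]|%:R - lam * N) <= #|[set x in I | P (lab x)]|%:R * N)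
  (C10 : forall i, (Delta * #|[set x in I | lab x == i]|)%:R <= kap * #|cls f i|%:R)
  (C11 : iota_ * N <= m) (C11' : m <= kap * N)
  (C12 : forall x, x \in I -> exists v, v \in typical G f d dl zeta gamma /\ f v = lab x)
  (zeta0 : 0 < zeta) (kap0 : 0 < kap) (kapg : 2 * kap <= gamma / 4) (kap8 : kap <= 1 / 8)
  (lam0 : 0 < lam) (eta0 : 0 < eta) (iota0 : 0 < iota_)
  (p0 : 0 < p <= 1) (pE : p <= (gamma / 4) ^+ Delta)
  (lam_g : 8 * lam <= gamma) (lnu : 10 * lam <= nu) (ltau1 : 8 * lam <= tau1) (stau1 : 4 * sigma <= tau1)
  (nug : nu <= gamma / 2) (ltau2 : dl + 2 * lam <= tau2) (tau2E : tau2 <= D2 ^+ Delta * (gamma / 4))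
  (dlD : dl <= D2 ^+ Delta / 2) (dlt : 4 * dl <= tau2 * iota_)
  (dlL : Delta%:R * (8 * dl) <= (2 ^+ e0)^-1) (dlp : (1 + Delta.+1 ^ 2)%:R * (Delta%:R * (8 * dl)) <= p / 8)
  (bigp : 16 * Delta.+1%:R ^+ 2 <= p * (zeta * N))
  (q1 : Delta.+1%:R * dl + 2 * kap + eta <= D2 ^+ Delta / 8) (q2 : 1 <= D2 ^+ Delta / 8 * (zeta * N))
  (q3 : Delta.+1%:R * dl <= D2 ^+ Delta * eta / 2) (q4 : 1 + l%:R <= D2 ^+ Delta * eta / 2 * (zeta * N))
  (Lh0 : (0 < Lh)%N) (LhE : (1 - p / 4) ^+ Lh <= 1 / 4) (tau1E : tau1 * (8 * Lh%:R) <= gamma)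
  (mbig : 8 * Lh%:R <= gamma * (iota_ * N))
  (pow_big : forall q : nat, tau1 * (iota_ * N) <= q%:R -> 2 * N < 2 ^+ q)
  (e0E : 2 <= (e0%:R * lam - 2) * iota_) (sees_ok : 4 * dl <= D2 ^+ Delta * (lam * nu / 2 * iota_)) :
  exists psi : T -> V, injective psi /\ forall u v, H u v -> G (psi u) (psi v).
Proof.
have [d00 d1] := andP d0; have [g00 g1] := andP g0; have [p00 p1] := andP p0.
have N0 : 0 < N by rewrite ltr0n.
have D20 : 0 < D2 <= 1 by rewrite /D2; move: d00 d1; clear; lra.
have [D20' D21] := andP D20.
have Dk0 : 0 < D2 ^+ Delta by rewrite exprn_gt0.
have m0 : 0 < m by apply: lt_le_trans C11; rewrite mulr_gt0.

(* Available vertices and the reserved set *)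
pose av i := cls f i :\: Z.
have Zc i : #|Z :&: cls f i|%:R <= kap * #|cls f i|%:R.
  rewrite -(ler_pM2r N0); apply: le_trans (C7 i) _.
  have : m * #|cls f i|%:R <= kap * N * #|cls f i|%:R by rewrite ler_wpM2r.
  by clear; lra.
have avE i : #|av i|%:R = #|cls f i|%:R - #|Z :&: cls f i|%:R :> R.
  have h0 := cardsID Z (cls f i); rewrite setIC in h0.
  by rewrite -h0 natrD addrC addKr.
have av_lb i : 7 / 8 * #|cls f i|%:R <= #|av i|%:R :> R.
  have : kap * #|cls f i|%:R <= 1 / 8 * #|cls f i|%:R by rewrite ler_wpM2r.
  by rewrite avE; move: (Zc i); clear; lra.
have avs i : av i \subset cls f i by exact: subsetDl.
have av_dis i j : i != j -> [disjoint av i & av j].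
  move=> ij; apply/pred0P=> v /=; apply/negP=> /andP[/(subsetP (avs i)) + /(subsetP (avs j))].
  by rewrite !inE => /eqP -> /eqP e; rewrite e eqxx in ij.
pose Nb i := [set v | reduced G f d dl zeta i (f v)].
have Nb_lb x : x \in I -> gamma / 2 * N <= #|Nb (lab x)|%:R.
  by move=> /C12[v [+ <-]]; rewrite inE.
have zcls x : x \in I -> zeta * N <= #|cls f (lab x)|%:R.
  move=> xI; have : 0 < #|Nb (lab x)|%:R :> R.
    by apply: lt_le_trans (Nb_lb x xI); rewrite mulr_gt0 // divr_gt0.
  by rewrite ltr0n => /card_gt0P[v]; rewrite inE => /and4P[_ _].
pose Zx x := Z :&: Nb (lab x).
(* No cluster holds more than its quota of [Z], so the clusters not adjacent to [lab x] hold at most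
   [(1 - gamma / 2) * m] of it, while [Z] has at least [(1 - 2 * lam) * m] vertices. *)
have Zx_lb x : x \in I -> gamma / 4 * m <= #|Zx x|%:R.
  move=> xI; have hb := Nb_lb x xI.
  have h1 : #|Z :\: Nb (lab x)|%:R * N <= m * (N - #|Nb (lab x)|%:R).
    pose P i := ~~ reduced G f d dl zeta (lab x) i.
    have -> : N - #|Nb (lab x)|%:R = \sum_(i | P i) #|cls f i|%:R.
      have := card_sup (fun v => reduced G f d dl zeta (lab x) (f v)).
      rewrite card_cls => /(congr1 (fun k => k%:R : R)); rewrite natrD -/N -/(Nb _) => <-.
      by rewrite addrC addKr.
    have -> : #|Z :\: Nb (lab x)| = (\sum_(i | P i) #|Z :&: cls f i|)%N.
      by rewrite card_cls_in; apply: eq_card => v; rewrite !inE andbC.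
    by rewrite natr_sum mulr_suml mulr_sumr; apply: ler_sum => i _.
  have h2 : #|Z|%:R = #|Zx x|%:R + #|Z :\: Nb (lab x)|%:R :> R by rewrite -natrD cardsID.
  rewrite -(ler_pM2r N0).
  have h3 : (1 - 2 * lam) * m * N <= #|Z|%:R * N by rewrite ler_pM2r //; move: C8; clear; lra.
  have h4 : gamma / 2 * N * m <= #|Nb (lab x)|%:R * m by rewrite ler_pM2r.
  have h5 : 8 * lam * (N * m) <= gamma * (N * m) by rewrite ler_pM2r // mulr_gt0.
  have h6 : #|Z|%:R * N = #|Zx x|%:R * N + #|Z :\: Nb (lab x)|%:R * N by rewrite h2 mulrDl.
  by move: h1 h3 h4 h5 h6; clear; lra.

(* Constraints on the images of the neighbourhoods *)
pose S2 x := [set z | [exists y in nbr H x, H z y]].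
have S2P x z : reflect (exists2 y, H x y & H z y) (z \in S2 x).
  rewrite inE; apply: (iffP existsP) => [[y /andP[]]|[y h1 h2]]; first by rewrite inE; exists y.
  by exists y; rewrite inE h1.
have S2ball x z : z \in S2 x -> z \in ball H 2 x.
  move=> /S2P[y xy zy]; apply: (ball_step (y := y)); last by rewrite sH.
  by apply: (ball_step (y := x)); rewrite ?inE.
pose nb x := enum (nbr H x).
have szn x : (size (nb x) <= Delta)%N by rewrite -cardE.
pose msk x z := [seq H z y | y <- nb x].
(* The first constraint makes [x] keep partners in [Z]; the others leave each second neighbour [z]
   enough candidates after its neighbours in [nbr H x], marked by [msk x z], are embedded. *)
pose cons x := (Zx x, nseq Delta true) :: [seq (av (h z), msk x z) | z <- enum (S2 x)].
have h_adj x z : x \in I -> z \in S2 x -> reduced G f d dl zeta (lab x) (h z).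
  by move=> xI /S2P[y xy zy]; rewrite -(C2 _ xI _ xy); apply: C1; rewrite sH.
have count_I (P : pred T) : count P (enum I) = #|[set x in I | P x]|.
  by rewrite -sum1_count big_enum_cond -sum1_card; apply: eq_bigl => x; rewrite inE.
have pool x : x \in enum I -> #|cls f (lab x)|%:R - #|av (lab x)|%:R +
    (Delta * count (fun x' => lab x' == lab x) (enum I))%:R <= gamma / 4 * #|cls f (lab x)|%:R.
  move=> _; rewrite count_I avE; have h1 := C10 (lab x); have h2 := Zc (lab x).
  have : 2 * kap * #|cls f (lab x)|%:R <= gamma / 4 * #|cls f (lab x)|%:R by rewrite ler_wpM2r.
  by move: h1 h2; clear; lra.
have bigc x : x \in enum I -> 16 * Delta.+1%:R ^+ 2 <= p * #|cls f (lab x)|%:R.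
  by rewrite mem_enum => xI; apply: le_trans bigp _; rewrite ler_pM2l // zcls.
have cKc x : x \in enum I -> (size (cons x) <= 1 + Delta.+1 ^ 2)%N.
  move=> _; rewrite /= size_map -cardE add1n ltnS; apply: leq_trans (ball_card degH 2 x).
  by apply: subset_leq_card; apply/subsetP=> z; exact: S2ball.
have thk x Tm : x \in enum I -> Tm \in cons x ->
     exists2 c, thick G (d / 2) (4 * dl) c (cls f (lab x)) Tm.1 & c <= (d / 2) ^+ Delta * #|Tm.1|%:R.
  rewrite mem_enum inE => xI /orP[/eqP-> /=|/mapP[z zS ->] /=].
    exists (4 * dl * N); first by apply: (reduced_nbrs_thick (zeta := zeta)) => //; exact: subsetIr.
    apply: (@le_trans _ _ (tau2 * m)).
      apply: (@le_trans _ _ (tau2 * iota_ * N)); first by rewrite ler_pM2r.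
      rewrite -mulrA; apply: ler_wpM2l => //.
      by move: ltau2 dl0 lam0; clear; lra.
    apply: (@le_trans _ _ (D2 ^+ Delta * (gamma / 4 * m))); last by rewrite ler_pM2l // Zx_lb.
    by rewrite mulrA ler_pM2r.
  rewrite mem_enum in zS; have /and4P[lr _ _ _] := h_adj x z xI zS.
  exists (dl * #|cls f (h z)|%:R); first exact: low_regular_thick (ltW dl0) lr (avs _).
  apply: (@le_trans _ _ (D2 ^+ Delta * (1 / 2 * #|cls f (h z)|%:R))).
    have : dl * #|cls f (h z)|%:R <= D2 ^+ Delta / 2 * #|cls f (h z)|%:R by rewrite ler_wpM2r.
    by clear; lra.
  rewrite ler_pM2l //; have := av_lb (h z); have : 0 <= #|cls f (h z)|%:R :> R by [].
  by clear; lra.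
have L1 : 1 <= (2 ^+ e0 : R) by apply: exprn_ege1; rewrite ler1n.
have [s [sI sdis shit scov]] := absorbers zeta sG d0 dl0 g0 p0 pE L1 dlL dlp avs (enum_uniq I) pool bigc cKc thk.
have {sI}sI x : x \in I -> [/\ size (s x) = Delta, all (mem (av (lab x))) (s x), uniq (s x) &
    forall Tm, Tm \in cons x -> D2 ^+ count id Tm.2 * #|Tm.1|%:R <= #|cnb G Tm.1 Tm.2 (s x)|%:R].
  by move=> xI; have [|/andP[/eqP h1 h2] h3 h4] := sI x; rewrite ?mem_enum.
have {sdis}sdis x y : x \in I -> y \in I -> x != y -> [disjoint s x & s y].
  by move=> xI yI; apply: sdis; rewrite mem_enum.

(* Embedding of the neighbourhoods *)
pose E0 := [set y | [exists x in I, H x y]].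
have E0P y : reflect (exists2 x, x \in I & H x y) (y \in E0).
  by rewrite inE; apply: (iffP existsP) => [[x /andP[]]|[x h1 h2]]; exists x; rewrite ?h1.
have ball0 x : x \in ball H 0 x by rewrite inE.
(* Used with 2 to separate neighbourhoods, with 3 to exclude edges between them, and with 4 to give
   second neighbours a unique site. *)
have nsame x x' k : x \in I -> x' \in I -> x' \in ball H k x -> (k <= 4)%N -> x' = x.
  move=> xI x'I hb hk; apply/eqP; apply: contraT => ne.
  have /negP[] : x' \notin ball H 4 x by apply: C3; rewrite // eq_sym.
  have up q k0 : (q + k0 = 4)%N -> x' \in ball H k0 x -> x' \in ball H 4 x.
    elim: q k0 => [|q IHq] k0; first by move=> <-.
    by rewrite addSnnS => e hx; apply: IHq e _; exact: ball_sub.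
  exact: up (subnK hk) hb.
have [v0 _] : exists v0 : V, true by have /card_gt0P[v _] := V0; exists v.
pose owner y := odflt y [pick x in I | H x y].
have ownerE x y : x \in I -> H x y -> owner y = x.
  move=> xI xy; rewrite /owner; case: pickP => [x' /= /andP[x'I x'y]|/(_ x)]; last by rewrite /= xI xy.
  apply: (nsame x x' 2) => //; apply: (ball_step (y := y)); last by rewrite sH.
  exact: ball_step xy.
(* The tuple [s x] always has [Delta] entries; the neighbours of [x], in their enumeration, take the
   first ones. *)
pose phi0 y := nth v0 (s (owner y)) (index y (nb (owner y))).
have idx x y : x \in I -> H x y -> (index y (nb x) < size (s x))%N.
  move=> xI xy; have [-> _ _ _] := sI x xI; apply: leq_trans (szn x).
  by rewrite index_mem mem_enum inE.
have phi0E x y : x \in I -> H x y -> phi0 y = nth v0 (s x) (index y (nb x)).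
  by move=> xI xy; rewrite /phi0 (ownerE x).
have phi0s x y : x \in I -> H x y -> phi0 y \in s x.
  by move=> xI xy; rewrite (phi0E x) // mem_nth // idx.
have E0I : [disjoint E0 & I].
  apply/pred0P=> y /=; apply/negP=> /andP[/E0P[x xI xy] yI].
  have := nsame x y 1 xI yI (ball_step (ball0 x) xy) isT.
  by move=> e; rewrite e iH in xy.
have phi0_inj : {in E0 &, injective phi0}.
  move=> y y' /E0P[x xI xy] /E0P[x' x'I x'y'] e.
  have exx : x' = x.
    apply/eqP; apply: contraT => ne; have /pred0P/(_ (phi0 y')) := sdis x' x x'I xI ne.
    by rewrite /= phi0s // -e phi0s.
  rewrite exx in x'y'; move: e; rewrite (phi0E x) // (phi0E x y') //.
  have [_ _ us _] := sI x xI; move=> /eqP; rewrite nth_uniq ?idx // => /eqP.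
  have inn z : H x z -> z \in nb x by rewrite mem_enum inE.
  by move=> e; rewrite -(nth_index y (inn _ xy)) e nth_index // inn.
have phi0_av : {in E0, forall u, phi0 u \in av (h u)}.
  move=> y /E0P[x xI xy]; rewrite (C2 _ xI _ xy); have [_ /allP sa _ _] := sI x xI.
  by apply: sa; exact: phi0s.
(* Vacuous: an edge inside [E0] would join two neighbours of one [x], against the bipartition. *)
have phi0_hom : {in E0 &, forall u v, H u v -> G (phi0 u) (phi0 v)}.
  move=> y y' /E0P[x xI xy] /E0P[x' x'I x'y'] Hyy'.
  have e : x' = x.
    apply: (nsame x x' 3) => //; apply: (ball_step (y := y')); last by rewrite sH.
    by apply: (ball_step (y := y)) => //; exact: ball_step xy.
  rewrite e in x'y'; have := cH _ _ Hyy'; have := cH _ _ xy; have := cH _ _ x'y'.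
  by case: (c x); case: (c y); case: (c y').
have E0J y : y \in E0 -> (pos y < J0)%N.
  move=> /E0P[x xI xy]; apply: (C4 _ _ xI); apply: ball_sub; exact: ball_step (ball0 x) xy.
have E0nI y : y \in E0 -> y \notin I.
  by move=> yE; move/pred0P/(_ y): E0I; rewrite /= yE /= => ->.

(* Greedy embedding of the vertices outside [I] *)
have touched y z : y \in E0 -> H z y -> (exists2 x, x \in I & z \in S2 x) /\ (pos z < J0)%N.
  move=> /E0P[x xI xy] zy; have zS : z \in S2 x by apply/S2P; exists y.
  by split; [exists x | apply: (C4 _ _ xI); exact: S2ball].
(* Below [J0] so little of a cluster is used in total that half of it can be promised and everything
   may count as loss. Later only the gap [eta] is sure to be free, but the loss is confined to the
   last [l] positions. *)
pose base z : R := if (pos z < J0)%N then #|av (h z)|%:R / 2 else eta * #|cls f (h z)|%:R.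
pose win z y := (pos z < J0)%N || (pos z <= pos y + l)%N.
have [phi [phi_inj phi_av phi_E phi_hom]] : exists phi : T -> V, [/\ {in ~: I &, injective phi},
    {in ~: I, forall u, phi u \in av (h u)}, {in E0, phi =1 phi0} &
    {in ~: I &, forall u v, H u v -> G (phi u) (phi v)}].
  have cl0 i : 0 <= #|cls f i|%:R :> R by [].
  have qk : 2 * kap + eta <= 1 / 8.
    have : D2 ^+ Delta <= 1 by rewrite exprn_ile1 // ltW.
    have : 0 <= Delta.+1%:R * dl by rewrite mulr_ge0 // ltW.
    by move: q1; clear; lra.
  have c1 z : 1 <= D2 ^+ Delta / 8 * #|cls f (h z)|%:R.
    by apply: le_trans q2 _; rewrite ler_wpM2l // divr_ge0 // ltW.
  have c2 z : 1 + l%:R <= D2 ^+ Delta * eta / 2 * #|cls f (h z)|%:R.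
    by apply: le_trans q4 _; rewrite ler_wpM2l // divr_ge0 // mulr_ge0 ?ltW.
  apply: (greedy_embedding (pos := pos) (base := base) (win := win) (d := D2) (Delta := Delta)
    (cc := fun i => dl * #|cls f i|%:R) (ee := fun i => dl * #|cls f i|%:R)
    (th := fun i => Delta.+1%:R * dl * #|cls f i|%:R + 1)) => //.
  - move=> y z yz _ _ B sB cB; have /and4P[/forallP/(_ B) /implyP lr _ _ _] := C1 _ _ yz.
    apply: le_trans (lr _); last by rewrite cB (subset_trans sB).
    rewrite ler_nat; apply: subset_leq_card; apply/subsetP=> v; rewrite !inE => /andP[/andP[_ ->]] /=.
    move=> h1; apply: lt_le_trans h1 _; rewrite ler_wpM2r // /D2; by move: d00; clear; lra.
  - move=> i; rewrite -natr1 mulrDl mul1r mulrDl.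
    have : 0 <= Delta%:R * dl * #|cls f i|%:R by rewrite !mulr_ge0 // ltW.
    by clear; lra.
  - move=> i; rewrite -natr1 mulrDl mul1r mulrDl.
    have : 0 <= dl * #|cls f i|%:R by rewrite !mulr_ge0 // ltW.
    by clear; lra.
  - move=> z; rewrite /base; case: ifP => _; first by rewrite divr_ge0.
    by rewrite mulr_ge0 // ltW.
  - by move=> i; rewrite mulr_ge0 // ltW.
  - move=> z _ /card_gt0P[y]; rewrite inE => /andP[zy yE]; rewrite inE in zy.
    have [[x xI zS] zJ] := touched y z yE zy.
    (* All embedded neighbours of [z] belong to the same site [x], so a single constraint of
       [cons x] governs its candidates. *)
    have nE : nbr H z :&: E0 = [set y' in nbr H x | H z y'].
      apply/setP=> y'; rewrite !inE; apply/andP/andP=> [[zy' y'E]|[xy' zy']].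
        split=> //; have /E0P[x' x'I x'y'] : y' \in E0 by rewrite inE.
        suff <- : x' = x by [].
        apply: (nsame x x' 4) => //; apply: (ball_step (y := y')); last by rewrite sH.
        by apply: (ball_step (y := z)) => //; exact: S2ball.
      by split=> //; apply/existsP; exists x; rewrite xI.
    rewrite nE.
    have kE : #|[set y' in nbr H x | H z y']| = count id (msk x z).
      rewrite /msk count_map -sum1_count big_enum_cond -sum1_card; apply: eq_bigl => y'.
      by rewrite inE.
    have [_ _ _ /(_ (av (h z), msk x z)) /=] := sI x xI.
    rewrite inE orbC (map_f (fun z => (av (h z), msk x z))) ?mem_enum // kE => /(_ isT) hc.
    apply: (@le_trans _ _ (D2 ^+ count id (msk x z) * #|av (h z)|%:R)).
      rewrite ler_pM2l ?exprn_gt0 // /base zJ; have : 0 <= #|av (h z)|%:R :> R by [].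
      by clear; lra.
    apply: le_trans hc _; rewrite -natrD ler_nat.
    (* A common neighbour in [av (h z)] is either still free or the image of a vertex of [E0] with
       the same cluster, which the loss counts. *)
    set cd := _ :\: _; set ls := [set y in E0 | _].
    apply: (@leq_trans #|cd :|: phi0 @: ls|); last first.
      by apply: leq_trans (leq_card_setU _ _) _; rewrite leq_add2l leq_imset_card.
    apply: subset_leq_card; apply/subsetP=> v; rewrite in_cnb => /andP[vav /allP hv].
    rewrite inE; have [/imsetP[y' y'E ev]|vE] := boolP (v \in phi0 @: E0).
      rewrite orbC ev imset_f // inE y'E /win zJ andbT.
      apply: contraT => ne; have /pred0P/(_ v) := av_dis _ _ ne.
      by rewrite /= vav ev phi0_av.
    rewrite inE vE inE vav /=; apply/orP; left; apply/forall_inP=> y' y'E; apply/implyP=> zy'.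
    have : y' \in nbr H z :&: E0 by rewrite inE y'E inE zy'.
    rewrite nE inE inE => /andP[xy' _]; rewrite sG; apply: hv; rewrite (phi0E x) //.
    apply: mem_mask_nth; first exact: idx.
    have inn : y' \in nb x by rewrite mem_enum inE.
    by rewrite (nth_map y') ?index_mem // nth_index.
  - move=> z /[!inE] /norP[zI zE]; rewrite /base; case: ifP => zJ.
      have h5 := C5 (h z) (C0 z).
      have h6 : (2 * kap + eta) * #|cls f (h z)|%:R <= 1 / 8 * #|cls f (h z)|%:R by rewrite ler_wpM2r.
      have h7 : #|[set u in [set u | (u \in E0) || (u \notin I) && (pos u < pos z)%N] | h u == h z]|%:R
          <= #|[set u | (u \notin I) && (pos u < J0)%N && (h u == h z)]|%:R :> R.
        rewrite ler_nat; apply: subset_leq_card; apply/subsetP=> u.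
        rewrite [in X in X -> _]inE [in X in X -> _]inE [in X in _ -> X]inE => /andP[uz ->]; rewrite andbT.
        case/orP: uz => [uE|/andP[-> uz]]; first by rewrite E0nI // E0J.
        exact: ltn_trans uz zJ.
      have h8 := av_lb (h z); move: h5 h6 h7 h8 (cl0 (h z)); clear; lra.
    have h6 := C6 (h z) (C0 z); rewrite addrC; apply: le_trans h6; rewrite lerD2r ler_nat.
    apply: subset_leq_card; apply/subsetP=> u.
    rewrite [in X in X -> _]inE [in X in X -> _]inE [in X in _ -> X]inE => /andP[uz ->]; rewrite andbT.
    by case/orP: uz => [uE|/andP[-> //]]; rewrite E0nI.
  - move=> y z _ _ _ yz /card_gt0P[u /setIP[zu]]; rewrite [in X in X -> _]inE.
    rewrite inE in zu => /orP[uE|/andP[_ uy]]; first by have [_ zJ] := touched u z uE zu; rewrite /win zJ.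
    by apply/orP; right; apply: leq_trans (posH _ _ zu) _; rewrite leq_add2r ltnW.
  - move=> z _; rewrite /base; set ls := [set y in _ | _]; case: ifP => zJ.
      have h5 := C5 (h z) (C0 z).
      have h7 : #|ls|%:R <= #|[set u | (u \notin I) && (pos u < J0)%N && (h u == h z)]|%:R :> R.
        rewrite ler_nat; apply: subset_leq_card; apply/subsetP=> u.
        rewrite [in X in X -> _]inE [in X in X -> _]inE [in X in _ -> X]inE => /andP[uz /andP[-> _]].
        rewrite andbT; case/orP: uz => [uE|/andP[-> uz]]; first by rewrite E0nI // E0J.
        exact: ltn_trans uz zJ.
      have h8 := av_lb (h z); have h9 := c1 z.
      have ha : (Delta.+1%:R * dl + 2 * kap + eta) * #|cls f (h z)|%:R <=
        D2 ^+ Delta / 8 * #|cls f (h z)|%:R by rewrite ler_wpM2r.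
      have hb : D2 ^+ Delta * (7 / 8 * #|cls f (h z)|%:R) <= D2 ^+ Delta * #|av (h z)|%:R by rewrite ler_pM2l.
      have hd : 0 <= D2 ^+ Delta * #|cls f (h z)|%:R by rewrite mulr_ge0 // ltW.
      by move: h5 h7 h9 ha hb hd; clear; lra.
    have h7 : (#|ls| <= l)%N.
      apply: (@leq_trans #|[set u | ((pos z - l)%N <= pos u < pos z)%N]|).
        apply: subset_leq_card; apply/subsetP=> u.
        rewrite [in X in X -> _]inE [in X in X -> _]inE [in X in _ -> X]inE /win zJ /= leq_subLR.
        move=> /and3P[uz _ uw]; rewrite addnC uw /=.
        case/orP: uz => [uE|/andP[_ //]]; apply: leq_trans (E0J u uE) _.
        by rewrite leqNgt zJ.
      by apply: leq_trans (pos_card_le posI _ _) _; rewrite leq_subLR addnC -maxnE leq_maxr.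
    have {}h7 : #|ls|%:R <= l%:R :> R by rewrite ler_nat.
    have ha : Delta.+1%:R * dl * #|cls f (h z)|%:R <= D2 ^+ Delta * eta / 2 * #|cls f (h z)|%:R
      by rewrite ler_wpM2r.
    by move: ha h7 (c2 z); clear; lra.
pose W := ~: (phi @: ~: I).
have cW : #|W| = #|I|.
  have h1 := cardsC (phi @: ~: I); have h2 := cardsC I.
  rewrite card_in_imset // in h1; move: h1 h2; rewrite -TV /W; clear; lia.
have ZW : Z \subset W.
  apply/subsetP=> v vZ; rewrite inE; apply/negP=> /imsetP[u uI ev].
  by have := phi_av u uI; rewrite -ev inE vZ.
pose adj x v := [forall y in nbr H x, G (phi y) v].
have nI x y : x \in I -> H x y -> y \in ~: I.
  by move=> xI xy; rewrite inE E0nI //; apply/E0P; exists x.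
have adj_all x v : x \in I -> all (fun u => G u v) (s x) -> adj x v.
  move=> xI /allP sv; apply/forall_inP=> y; rewrite inE => xy.
  by rewrite phi_E; [apply: sv; exact: phi0s | apply/E0P; exists x].
have t10 : 0 < tau1 by move: stau1 s0; clear; lra.
have hits v : tau1 * m <= #|[set x in I | adj x v]|%:R.
  have := shit v; rewrite !count_I; set cnt := #|_|; set rel := #|_| => hpow.
  have le_cnt : (cnt <= #|[set x in I | adj x v]|)%N.
    apply: subset_leq_card; apply/subsetP=> x /[!inE] /andP[xI sv].
    by rewrite xI; exact: adj_all.
  apply: (@le_trans _ _ cnt%:R); last by rewrite ler_nat.
  have rel_lb : gamma / 4 * m <= rel%:R.
    pose P i := gamma / 2 * #|cls f i|%:R <= #|nbr G v :&: cls f i|%:R.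
    have h9 := C9 P; rewrite -/rel in h9.
    have hP : gamma / 2 * N <= #|[set u | P (f u)]|%:R.
      have e1 : #|nbr G v|%:R = \sum_i #|nbr G v :&: cls f i|%:R :> R.
        by rewrite -natr_sum card_cls_all.
      have e2 : N = \sum_i #|cls f i|%:R.
        by rewrite /N -natr_sum -cardsT -(card_cls_all f setT); congr (_%:R); apply: eq_bigr => i _; rewrite setTI.
      have e3 : #|[set u | P (f u)]|%:R = \sum_i (if P i then #|cls f i|%:R else 0) :> R.
        by rewrite -big_mkcond -(card_cls R f P).
      have : gamma * N <= \sum_i ((if P i then #|cls f i|%:R else 0) + gamma / 2 * #|cls f i|%:R).
        apply: le_trans (min_deg v) _; rewrite e1; apply: ler_sum => i _.
        case: ifPn => [_|]; last by rewrite -ltNge add0r => /ltW.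
        apply: ler_wpDr; first by rewrite mulr_ge0 // divr_ge0 // ltW.
        by rewrite ler_nat subset_leq_card // subsetIr.
      by rewrite big_split /= -e3 -mulr_sumr -e2; clear; lra.
    rewrite -(ler_pM2r N0); apply: le_trans h9.
    rewrite mulrAC [leLHS]mulrC ler_pM2l //.
    have : 8 * lam * N <= gamma * N by rewrite ler_pM2r.
    have : 0 < gamma * N by rewrite mulr_gt0.
    by move: hP; clear; lra.
  (* Each [Lh] relevant sites contribute a factor [1 / 4] to the bound of [shit]. One factor
     [2 ^+ q] outweighs [2 * N], and [(1 / 2) ^+ q] remains: at least [q] hits. *)
  pose q := (rel %/ Lh)%N.
  have L0 : 0 < Lh%:R :> R by rewrite ltr0n.
  have q_lb : tau1 * m <= q%:R.
    have h1 : rel%:R <= (q%:R + 1) * Lh%:R :> R.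
      by rewrite natr1 -natrM ler_nat ltnW // ltn_ceil.
    have h2 : 8 * Lh%:R <= gamma * m by apply: le_trans mbig _; rewrite ler_pM2l.
    have h3 : tau1 * (8 * Lh%:R) * m <= gamma * m by rewrite ler_pM2r.
    rewrite -(ler_pM2r L0); move: rel_lb h1 h2 h3; clear; lra.
  have h2N : 2 * N < 2 ^+ q.
    by apply: pow_big; apply: le_trans q_lb; rewrite ler_pM2l.
  apply: le_trans q_lb _; rewrite ler_nat leqNgt; apply/negP=> lt_cq.
  have p4 : 0 <= 1 - p / 4 <= 1 by move: p00 p1; clear; lra.
  have h4 : (1 - p / 4) ^+ rel <= (1 / 4) ^+ q.
    apply: (@le_trans _ _ ((1 - p / 4) ^+ (Lh * q))).
      by apply: ler_wiXn2l; [case/andP: p4 | case/andP: p4 | rewrite mulnC leq_trunc_div].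
    rewrite exprM; apply: lerXn2r => //; rewrite nnegrE ?divr_ge0 // exprn_ge0 //.
    by case/andP: p4.
  have h5 : (1 / 2) ^+ cnt < (2 : R) ^+ q * (1 / 4) ^+ q.
    apply: le_lt_trans hpow _; apply: (@le_lt_trans _ _ (2 * N * (1 / 4) ^+ q)).
      by rewrite ler_wpM2l // mulr_ge0.
    by rewrite ltr_pM2r // exprn_gt0 // divr_gt0.
  have e5 : 2 * (1 / 4) = 1 / 2 :> R by field.
  rewrite -exprMn e5 in h5.
  have : (1 / 2) ^+ q <= (1 / 2) ^+ cnt :> R by apply: ler_wiXn2l; rewrite ?(ltnW lt_cq) //; lra.
  by rewrite leNgt h5.
have iNm : iota_ * N <= m by [].
(* With [Lam = 2 ^+ e0], taking logarithms gives [e0 * cnt <= 1 + #|V| + 2 * #|I|]; as [I] has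
   linear size, [e0E] makes this at most [e0 * lam * m]. *)
have covers (F : {set V}) :
  #|[set x in I | sees G f d dl zeta Delta (lab x) F && [forall v in F, ~~ adj x v]]|%:R <= lam * m.
  have := scov F; rewrite count_I -cardE; set cnt := #|_| => hpow.
  apply: (@le_trans _ _ cnt%:R).
    rewrite ler_nat; apply: subset_leq_card; apply/subsetP=> x /[!inE] /and3P[xI -> /forall_inP h1].
    rewrite xI /=; apply/forall_inP=> v /h1; apply: contra; exact: adj_all.
  have {}hpow : (e0 * cnt <= 1 + #|V| + 2 * #|I|)%N.
    have : (2 ^+ (e0 * cnt) : R) <= 2 ^+ (1 + #|V| + 2 * #|I|).
      have e4 : (2 : R) ^+ 2 = 4 by rewrite expr2 -natrM.
      by rewrite exprM -addnA exprD (exprD _ #|V|) (exprM _ 2 #|I|) e4 expr1 mulrA.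
    by rewrite ler_eXn2l ?ltr1n.
  have {}hpow : e0%:R * cnt%:R <= 1 + N + 2 * m :> R.
    by move: hpow; rewrite -(ler_nat R) natrM -addnA natrD (natrD _ #|V|) (natrM _ 2 #|I|) addrA.
  have e00 : 0 < e0%:R :> R.
    rewrite lt0r ler0n andbT; apply/eqP=> e; move: e0E; rewrite e; move: iota0; clear; lra.
  rewrite leNgt; apply/negP=> lt_c.
  have h1 : e0%:R * (lam * m) < e0%:R * cnt%:R by rewrite ltr_pM2l.
  have h2 : (e0%:R * lam - 2) * iota_ * N <= (e0%:R * lam - 2) * m.
    rewrite -mulrA ler_wpM2l //; have : 0 < (e0%:R * lam - 2) * iota_ by move: e0E; clear; lra.
    by rewrite pmulr_lgt0 // => /ltW.
  have h3 : 2 * N <= (e0%:R * lam - 2) * iota_ * N by rewrite ler_pM2r.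
  have N1 : 1 <= N by rewrite ler1n.
  by move: hpow h1 h2 h3 N1; clear; lra.
have reserve x : x \in I -> tau2 * m <= #|[set v in Z | adj x v]|%:R.
  move=> xI; have [sz _ _ /(_ (Zx x, nseq Delta true)) /=] := sI x xI.
  rewrite inE eqxx count_nseq mul1n => /(_ isT) hc.
  apply: (@le_trans _ _ (D2 ^+ Delta * #|Zx x|%:R)).
    apply: (@le_trans _ _ (D2 ^+ Delta * (gamma / 4 * m))); last by rewrite ler_pM2l // Zx_lb.
    by rewrite mulrA ler_pM2r.
  apply: le_trans hc _; rewrite ler_nat; apply: subset_leq_card; apply/subsetP=> v.
  rewrite in_cnb mask_true ?sz // => /andP[/setIP[vZ _] sv].
  by rewrite inE vZ; exact: adj_all.
have sees_okm : 4 * dl * N <= (d / 2) ^+ Delta * (lam * nu / 2 * m).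
  apply: (@le_trans _ _ (D2 ^+ Delta * (lam * nu / 2 * iota_) * N)); first by rewrite ler_pM2r.
  by rewrite -!mulrA ler_pM2l // !ler_pM2l ?invr_gt0.
have WZ : #|W|%:R - #|Z|%:R <= 2 * lam * m by rewrite cW.
have /card_gt0P[t0 _] : (0 < #|T|)%N by rewrite TV.
have [g [g_inj gP]] := hall (fun=> t0) (absorbing_hall rb d00 dl0 nu0 g00 V0 min_deg rob dnu dg dl1 s0 sg
  lam0 lnu ltau1 stau1 nug ltau2 ZW cW WZ C7 hits covers reserve C9 sees_okm).
have gI : g @: W = I.
  apply/eqP; rewrite eqEcard card_in_imset // cW leqnn andbT.
  by apply/subsetP=> _ /imsetP[v /gP /andP[_ vI] ->].
pose psi u := if u \in I then odflt v0 [pick v in W | g v == u] else phi u.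
have psiI u : u \in I -> psi u \in W /\ g (psi u) = u.
  move=> uI; rewrite /psi uI; case: pickP => [v /andP[vW /eqP]//|].
  move: uI; rewrite -gI => /imsetP[v vW ->] /(_ v).
  by rewrite /= vW eqxx.
have psiN u : u \notin I -> psi u = phi u by rewrite /psi => /negPf->.
have sep u v : u \in I -> v \notin I -> psi u = psi v -> False.
  move=> /psiI[uW _] vI e; move: uW; rewrite e psiN // inE => /negP[].
  by apply: imset_f; rewrite inE.
have psi_adj u v : u \in I -> H u v -> G (psi u) (psi v).
  move=> uI uv; have vI := nI u v uI uv; rewrite inE in vI; have [uW e] := psiI u uI.
  have /andP[/forall_inP/(_ v)] := gP _ uW; rewrite e inE (psiN v) // (sG (psi u)) => h1 _; exact: h1.
exists psi; split=> [u v e|u v uv].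
  have [uI|uI] := boolP (u \in I); have [vI|vI] := boolP (v \in I).
  - by have [_ <-] := psiI u uI; have [_ <-] := psiI v vI; rewrite e.
  - by case: (sep u v uI vI e).
  - by case: (sep v u vI uI (esym e)).
  - by move: e; rewrite !psiN //; apply: phi_inj; rewrite inE.
have [uI|uI] := boolP (u \in I); first exact: psi_adj.
have [vI|vI] := boolP (v \in I); first by rewrite sG; apply: psi_adj; rewrite // sH.
by rewrite !psiN //; apply: phi_hom; rewrite ?inE.
Qed.

(** Lets a constant be chosen below finitely many positive bounds at once. *)
Lemma pos_lower_bound (R : realDomainType) (s : seq R) :
  all (fun y => 0 < y) s -> exists2 x, 0 < x & all (fun y => x <= y) s.
Proof.
elim: s => [_|y s IH /= /andP[y0 /IH[x x0 xs]]]; first by exists 1.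
exists (Num.min x y); first by rewrite lt_min x0.
rewrite ge_min lexx orbT /=; apply: sub_all xs => z; apply: le_trans.
by rewrite ge_min lexx.
Qed.

Lemma nat_upper_bound (R : realType) (s : seq R) : exists n : nat, all (fun y => y <= n%:R) s.
Proof.
elim: s => [|y s [n ns]]; first by exists 0%N.
exists (maxn n (Num.bound `|y|)); rewrite /=; apply/andP; split.
  apply: le_trans (ler_norm y) _; apply: le_trans (ltW (archi_boundP (normr_ge0 y))) _.
  by rewrite ler_nat leq_maxr.
by apply: sub_all ns => z zn; apply: le_trans zn _; rewrite ler_nat leq_maxl.
Qed.

Lemma pow_le_quarter (R : realType) (y : R) : 0 < y <= 1 ->
  exists2 n : nat, (0 < n)%N & (1 - y) ^+ n <= 1 / 4.
Proof.
move=> /andP[y0 y1]; have [n /= /andP[ny _]] := nat_upper_bound [:: 3 / y].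
(* Bernoulli's inequality in product form; [n * y >= 3] then gives the quarter. *)
have bern k : (1 - y) ^+ k * (1 + k%:R * y) <= 1.
  elim: k => [|k IH]; first by rewrite expr0 mul0r addr0 mulr1.
  apply: le_trans IH; rewrite exprSr -mulrA ler_wpM2l ?exprn_ge0 ?subr_ge0 //.
  rewrite -natr1; have : 0 <= k%:R * y * y by rewrite !mulr_ge0 // ltW.
  have : 0 <= y * y by rewrite mulr_ge0 // ltW.
  by clear; nra.
have n3 : 3 <= n%:R * y by rewrite -ler_pdivrMr.
exists n.
  by rewrite lt0n; apply/eqP=> e; move: n3; rewrite e mul0r; clear; lra.
have h0 : 0 <= (1 - y) ^+ n by rewrite exprn_ge0 // subr_ge0.
have h1 : (1 - y) ^+ n * 4 <= (1 - y) ^+ n * (1 + n%:R * y).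
  by rewrite ler_wpM2l //; move: n3; clear; lra.
by move: (le_trans h1 (bern n)); clear; lra.
Qed.

(** [2 ^+ q] is at least [(q / 2) ^+ 2], which is quadratic in [y]. *)
Lemma linear_lt_pow (R : realType) (x y : R) (q : nat) : 0 < x -> 8 / x ^+ 2 < y -> x * y <= q%:R ->
  2 * y < 2 ^+ q.
Proof.
move=> x0 ylb hq; have x2 : 0 < x ^+ 2 by rewrite exprn_gt0.
have y0 : 0 < y by apply: lt_trans ylb; rewrite divr_gt0.
have h1 : (q <= 2 * q./2.+1)%N by lia.
have h2 : q%:R / 2 <= 2 ^+ q./2 :> R.
  rewrite ler_pdivrMr // -natrX -natrM ler_nat mulnC; apply: leq_trans h1 _.
  by rewrite leq_mul2l /= ltn_expl.
have h3 : (q%:R / 2) ^+ 2 <= 2 ^+ q :> R.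
  apply: (@le_trans _ _ ((2 ^+ q./2) ^+ 2)); first by apply: lerXn2r => //; rewrite nnegrE ?divr_ge0 ?exprn_ge0.
  by rewrite -exprM ler_weXn2l ?ler1n //; lia.
apply: lt_le_trans h3; apply: (@lt_le_trans _ _ ((x * y / 2) ^+ 2)).
  rewrite ltr_pdivrMr // in ylb.
  have -> : (x * y / 2) ^+ 2 = y * (y * x ^+ 2) / 4 by field.
  have : y * 8 < y * (y * x ^+ 2) by rewrite ltr_pM2l.
  by clear; lra.
apply: lerXn2r; rewrite ?nnegrE ?divr_ge0 //; first by rewrite mulr_ge0 // ltW.
by rewrite ler_wpM2r // invr_ge0.
Qed.

(** [sigma] precedes [nu0] because [degree_condition_robust] produces an expansion rate that depends
    on [sigma]. *)
Lemma robust_expanders_contain (R : realType) (Delta : nat) (gamma : R) : 0 < gamma <= 1 ->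
  exists sigma : R, 0 < sigma <= 1 /\ forall nu0 : R, 0 < nu0 -> exists beta : R, 0 < beta /\ exists n0 : nat,
  forall (V T : finType) (G : rel V) (H : rel T) (c : T -> bool) (pos : T -> nat) (l : nat),
  (n0 <= #|V|)%N -> #|T| = #|V| -> symmetric G -> irreflexive G ->
  (forall v, gamma * #|V|%:R <= #|nbr G v|%:R) -> robust_expander G nu0 sigma ->
  symmetric H -> irreflexive H -> (forall z, (#|nbr H z| <= Delta)%N) -> (forall u v, H u v -> c u != c v) ->
  injective pos -> (forall u, (pos u < #|T|)%N) -> (0 < l)%N -> l%:R <= beta * #|V|%:R ->
  (forall u v, H u v -> (pos u <= pos v + l)%N) ->
  exists psi : T -> V, injective psi /\ forall u v, H u v -> G (psi u) (psi v).
Proof.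
move=> g01; have [g0 g1] := andP g01.
(* Lower bound for the chance that a vertex is adjacent to all [Delta] entries of a random tuple. *)
pose p := (gamma / 4) ^+ Delta.
have p0 : 0 < p <= 1 by rewrite /p exprn_gt0 ?divr_gt0 // exprn_ile1 //; move: g0 g1; clear; lra.
have [p00 p1] := andP p0.
have [Lh Lh0 LhE] : exists2 Lh : nat, (0 < Lh)%N & (1 - p / 4) ^+ Lh <= 1 / 4.
  by apply: pow_le_quarter; move: p00 p1; clear; lra.
have LhR : 1 <= Lh%:R :> R by rewrite ler1n.
have LhR0 : 0 < 8 * Lh%:R :> R by move: LhR; clear; lra.
(* There are [gamma / 4 * m] relevant sites, divided by [Lh]; a further factor 2 covers the
   rounding. *)
pose tau1 := gamma / (8 * Lh%:R).
have tau1E : tau1 * (8 * Lh%:R) <= gamma by rewrite divfK // gt_eqF.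
have t10 : 0 < tau1 by rewrite divr_gt0.
have t1g : tau1 <= gamma / 8.
  rewrite -(ler_pM2r LhR0); apply: le_trans tau1E _.
  have : gamma * 1 <= gamma * Lh%:R by rewrite ler_pM2l.
  by clear; lra.
pose sigma := tau1 / 4.
have s0 : 0 < sigma by rewrite divr_gt0.
have stau1 : 4 * sigma <= tau1 by rewrite /sigma; clear; lra.
have sg : sigma <= gamma / 8 by move: stau1 t1g t10 g0; clear; lra.
exists sigma; split; first by rewrite s0; move: sg g1; clear; lra.
move=> nu0 nu00.
have [nu nu_gt0 /= /and3P[nu_le nug _]] : exists2 nu : R, 0 < nu & all (fun y => nu <= y) [:: nu0; gamma / 2].
  by apply: pos_lower_bound; rewrite /= nu00 divr_gt0.
have nu1 : nu <= 1 / 2 by move: nug g1; clear; lra.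
have nu2 : 0 < nu ^+ 2 by rewrite exprn_gt0.
have nu2_le : nu ^+ 2 <= nu / 2 by rewrite expr2 ler_pM2l //; move: nu1; clear; lra.
pose d := nu ^+ 2 / 16.
have d00 : 0 < d by rewrite divr_gt0.
have d1 : d <= 1 by rewrite /d; move: nu2_le nu1; clear; lra.
have d0 : 0 < d <= 1 by rewrite d00.
pose Dk := (d / 2) ^+ Delta.
have Dk0 : 0 < Dk by rewrite exprn_gt0 // divr_gt0.
have Dk1 : Dk <= 1 by rewrite exprn_ile1 //; move: d00 d1; clear; lra.
pose tau2 := Dk * (gamma / 4).
have t20 : 0 < tau2 by rewrite mulr_gt0 // divr_gt0.
have [lam lam_gt0 /= /and4P[lnu ltau1 ltau2 _]] :
    exists2 lam : R, 0 < lam & all (fun y => lam <= y) [:: nu / 10; tau1 / 8; tau2 / 4].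
  by apply: pos_lower_bound; rewrite /= ?divr_gt0.
pose D4 := (Delta.+1 ^ 4)%N.
have D40 : (0 < D4)%N by rewrite expn_gt0.
have D4R : 1 <= D4%:R :> R by rewrite ler1n.
have [kap kap_gt0 /= /and4P[kapg kap_nu kap_D _]] :
    exists2 kap : R, 0 < kap & all (fun y => kap <= y) [:: gamma / 8; nu / 4; Dk / 64].
  by apply: pos_lower_bound; rewrite /= ?divr_gt0.
(* The sites are a proportion [1 / (4 * D4)] of each initial block, and the initial blocks fill at
   least [kap / 2] of all positions. *)
pose iota_ := kap / (8 * D4%:R).
have D4R0 : 0 < 8 * D4%:R :> R by move: D4R; clear; lra.
have i0 : 0 < iota_ by rewrite divr_gt0.
have i1 : iota_ <= 1.
  rewrite ler_pdivrMr // mul1r; move: kapg g1 D4R; clear; lra.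
have li0 : 0 < lam * iota_ by rewrite mulr_gt0.
have li_le : lam * iota_ <= lam by rewrite ger_pMr.
have [eta eta0 /= /and4P[eta_li eta1 eta_D _]] :
    exists2 eta : R, 0 < eta & all (fun y => eta <= y) [:: lam * iota_ / 8; 1 / 16; Dk / 32].
  by apply: pos_lower_bound; rewrite /= ?divr_gt0.
have [e0 /= /andP[e0_lb _]] := nat_upper_bound [:: (2 + 2 * iota_) / (lam * iota_)].
have e0E : 2 <= (e0%:R * lam - 2) * iota_.
  by rewrite ler_pdivrMr // in e0_lb; move: e0_lb; clear; lra.
have D1R : 0 < Delta.+1%:R :> R by rewrite ltr0n.
have dD : Delta%:R <= Delta.+1%:R :> R by rewrite ler_nat.
have dD0 : 0 <= Delta%:R :> R by [].
pose B : R := (1 + Delta.+1 ^ 2)%:R.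
have B0 : 0 < B by rewrite ltr0n.
pose Y : R := (2 ^+ e0)^-1.
have Y0 : 0 < Y by rewrite invr_gt0 exprn_gt0.
have DE0 : 0 < Dk * eta by rewrite mulr_gt0.
have DL0 : 0 < Dk * (lam * nu / 2 * iota_) by rewrite !(divr_gt0, mulr_gt0).
have ti0 : 0 < tau2 * iota_ by rewrite mulr_gt0.
have [dl dl0 /= /and5P[dl_nu dl_s dl_t2 dl_D /and5P[dl_ti dl_Y dl_p dl_e /and4P[dl_DL dl_lam dl_li _]]]] :
    exists2 dl : R, 0 < dl & all (fun y => dl <= y) [:: nu ^+ 2 / 8; sigma; tau2 / 2; Dk / 2;
      tau2 * iota_ / 4; Y / (8 * Delta.+1%:R); p / 8 / (B * (8 * Delta.+1%:R)); Dk * eta / 2 / Delta.+1%:R;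
      Dk * (lam * nu / 2 * iota_) / 4; lam / 2; lam * iota_ / 8].
  by apply: pos_lower_bound; rewrite /= s0 !(divr_gt0, mulr_gt0).
have dl1 : dl <= 1 by move: dl_s sg g1; clear; lra.
have dnu : dl + 2 * d <= nu ^+ 2 / 4 by rewrite /d; move: dl_nu; clear; lra.
have dg : dl + 2 * d <= gamma / 2 by move: dnu nu2_le nug nu_gt0 g0; clear; lra.
have {}dl_Y : Delta%:R * (8 * dl) <= Y.
  move: dl_Y; rewrite ler_pdivlMr ?mulr_gt0 //; apply: le_trans.
  have : Delta%:R * dl <= Delta.+1%:R * dl by rewrite ler_pM2r.
  by clear; lra.
have {}dl_p : B * (Delta%:R * (8 * dl)) <= p / 8.
  move: dl_p; rewrite ler_pdivlMr ?mulr_gt0 //; apply: le_trans.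
  have : B * (Delta%:R * dl) <= B * (Delta.+1%:R * dl) by rewrite ler_pM2l // ler_pM2r.
  by clear; lra.
have {}dl_e : Delta.+1%:R * dl <= Dk * eta / 2 by rewrite mulrC -ler_pdivlMr.
have [M [zeta [zeta0 reg]]] := reduced_graph d00 (dl := dl) (introT andP (conj dl0 dl1)).
have [j' /= /andP[j_lb _]] := nat_upper_bound [:: 1 / nu].
pose j := j'.+1; pose L := j.*2.+2.
have walk : 1 <= sigma + (j.*2.-1)%:R * (nu / 2).
  have -> : j.*2.-1 = (2 * j').+1 by rewrite mul2n.
  rewrite ler_pdivrMr // in j_lb; rewrite -natr1 natrM; move: j_lb s0 nu_gt0; clear; lra.
have ez0 : 0 < eta * zeta by rewrite mulr_gt0.
have L0 : 0 < L%:R :> R by rewrite ltr0n.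
have [q /= /and3P[q_ez q_L _]] := nat_upper_bound [:: 2 * L%:R / (eta * zeta); (L + 10)%:R].
rewrite ler_nat in q_L; rewrite ler_pdivrMr // in q_ez.
(* With [r = q * l] sites per block, half of the block leaves room for [2 * r * D4] positions, and
   [q >= L + 10] makes the link and margins fit in the other half. *)
pose Q := (4 * D4 * q)%N.
have LQ : (L + 10 < Q)%N by rewrite /Q; move: q_L D40; clear; nia.
have QL : 2 * L%:R <= Q%:R * (eta * zeta).
  apply: le_trans q_ez _; rewrite ler_pM2r // ler_nat /Q; move: D40; clear; nia.
(* Bounds [s * #|K| ^ 2 / l], so the rounding losses are at most [U * l]; the added 1 keeps it
   positive. *)
pose U : R := Q%:R * (M * M)%:R + 1.
have U0 : 0 < U by rewrite ltr_wpDl // mulr_ge0.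
have [bb bb0 /= /and5P[bb_L bb_k bb_li bb_D _]] : exists2 bb : R, 0 < bb & all (fun y => bb <= y)
    [:: eta * zeta / (2 * L%:R); kap * lam / 2 / U; lam * iota_ / 32 / U; Dk * eta * zeta / 4].
  by apply: pos_lower_bound; rewrite /= !(divr_gt0, mulr_gt0).
exists bb; split=> //.
have [n0 /= /and5P[n_p n_D n_g n_M /andP[n_t _]]] := nat_upper_bound [:: 16 * Delta.+1%:R ^+ 2 / (p * zeta);
  8 / (Dk * zeta); 8 * Lh%:R / (gamma * iota_); (2 * M%:R + 1) / (lam * iota_ / 8);
  8 / (tau1 * iota_) ^+ 2 + 1].
exists n0.+1 => V T G H c pos l n0V TV sG iG min_deg rob sH iH degH cH posI pos_lt l0 l_le posH.
have [K [f [bad [KM rb]]]] := reg V G sG.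
have V0 : (0 < #|V|)%N by apply: leq_trans n0V.
pose N : R := #|V|%:R.
have N0 : 0 < N by rewrite ltr0n.
have n0N : n0%:R <= N by rewrite ler_nat ltnW.
have rob' : robust_expander G nu sigma.
  move=> S hS; apply: le_trans (le_trans (rob S hS) _); first by rewrite lerD2l ler_wpM2r.
  rewrite ler_nat; apply: subset_leq_card; apply/subsetP=> v; rewrite !inE.
  by apply: le_trans; rewrite ler_wpM2r.
have Q0 : 0 < Q%:R :> R by rewrite ltr0n; apply: leq_trans LQ.
have lR0 : 0 < l%:R :> R by rewrite ltr0n.
have l1 : 1 <= l%:R :> R by rewrite ler1n.
set s := (Q * l)%N.
have sKK : s%:R * (#|K|%:R * #|K|%:R) <= U * l%:R :> R.
  rewrite /s -natrM natrM mulrAC /U ler_pM2r // ler_wpDr // ler_pM2l // ler_nat.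
  exact: leq_mul.
have sKK_k : s%:R * (#|K|%:R * #|K|%:R) <= kap * lam / 2 * N.
  apply: le_trans sKK _; rewrite ler_pdivlMr // in bb_k.
  have h1 : U * l%:R <= U * (bb * N) by rewrite ler_pM2l.
  have h2 : bb * U * N <= kap * lam / 2 * N by rewrite ler_pM2r.
  by move: h1 h2; clear; lra.
have sKK_li : s%:R * (#|K|%:R * #|K|%:R) <= lam * iota_ / 32 * N.
  apply: le_trans sKK _; rewrite ler_pdivlMr // in bb_li.
  have h1 : U * l%:R <= U * (bb * N) by rewrite ler_pM2l.
  have h2 : bb * U * N <= lam * iota_ / 32 * N by rewrite ler_pM2r.
  by move: h1 h2; clear; lra.
have lam1 : lam <= 1 / 20 by move: lnu nu1; clear; lra.
have types_small : s%:R * (#|K|%:R * #|K|%:R) <= kap * (lam - dl) * N.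
  apply: le_trans sKK_k _; rewrite ler_pM2r // -mulrA ler_pM2l //.
  by move: dl_lam; clear; lra.
have half_small : s%:R * (#|K|%:R * #|K|%:R) <= kap * (1 / 2 - dl) * N.
  apply: le_trans sKK_k _; rewrite ler_pM2r // -mulrA ler_pM2l //.
  by move: dl_lam lam1; clear; lra.
have link_small : ((#|V| %/ s).+1 * (L * l))%:R <= eta * zeta * N.
  rewrite natrM -natr1 natrM; set a : R := (#|V| %/ s)%:R.
  have h1 : a * (Q%:R * l%:R) <= N by rewrite -!natrM ler_nat leq_trunc_div.
  have h2 : a * l%:R * (2 * L%:R) <= a * l%:R * (Q%:R * (eta * zeta)) by rewrite ler_wpM2l // mulr_ge0.
  have h3 : eta * zeta * (a * (Q%:R * l%:R)) <= eta * zeta * N by rewrite ler_pM2l.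
  have h4 : 2 * L%:R * l%:R <= eta * zeta * N.
    apply: (@le_trans _ _ (2 * L%:R * (bb * N))); first by rewrite ler_pM2l // mulr_gt0.
    rewrite mulrA ler_pM2r // mulrC -ler_pdivlMr //; exact: mulr_gt0.
  by move: h2 h3 h4; clear; lra.
have KR : #|K|%:R <= M%:R :> R by rewrite ler_nat.
have slack : dl * N + 2 * eta * N + 2 * #|K|%:R + 4 * s%:R * (#|K|%:R * #|K|%:R) + 1 <= lam * iota_ * N.
  have h1 : dl * N <= lam * iota_ / 8 * N by rewrite ler_pM2r.
  have h2 : eta * N <= lam * iota_ / 8 * N by rewrite ler_pM2r.
  have h3 : 2 * M%:R + 1 <= N * (lam * iota_ / 8).
    by rewrite -ler_pdivrMr ?divr_gt0 //; apply: le_trans n_M n0N.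
  have h4 : 0 < lam * iota_ * N by rewrite mulr_gt0.
  by move: h1 h2 h3 h4 KR sKK_li; clear; lra.
have D_D4 : (Delta <= D4)%N by apply: leq_trans (leqnSn _) _; rewrite -{1}(expn1 Delta.+1) leq_pexp2l.
have rQ : (2 * (q * l * Delta.+1 ^ 4) <= (Q - L - 10) * l)%N.
  have h1 : (2 * (D4 * q) <= Q - L - 10)%N by rewrite /Q; move: q_L D40; clear; nia.
  by apply: leq_trans (leq_mul h1 (leqnn l)); rewrite -/D4; clear; nia.
have rs : (q * l <= Q * l)%N by rewrite leq_mul // /Q; move: D40; clear; nia.
have Drs : (Delta * (q * l) <= Q * l)%N.
  by rewrite mulnA leq_mul // /Q leq_mul //; move: D_D4; clear; lia.
have kap1 : kap <= 1 / 8 by move: kapg g1; clear; lra.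
have iota_le : iota_ * (2 * (Q * l)%:R) <= (q * l)%:R * kap.
  have -> : (2 * (Q * l)%:R : R) = 8 * D4%:R * (q * l)%:R by rewrite /Q !natrM; clear; ring.
  by rewrite mulrA divfK ?gt_eqF // mulrC.
have perm_nu : kap + lam * iota_ <= nu / 2 by move: kap_nu li_le lnu nu_gt0; clear; lra.
have perm_g : kap + lam * iota_ <= gamma / 4 by move: kapg li_le lnu nug g0; clear; lra.
have lam01 : 0 < lam <= 1 by rewrite lam_gt0; move: lam1; clear; lra.
have [h [I [lab [Z [J0 [[C1 C2 C3 C0 C4] [C5 C6] [C7 C8 _] [C9 C10 C11 C11'] C12]]]]]] :=
  @schedule_exists R V T K G f H c pos d dl zeta gamma nu sigma bad Delta l Q j (q * l) kap lam eta iota_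
    sG rb d00 dl0 nu_gt0 g0 V0 min_deg rob' dnu dg dl1 s0 sg dl_s TV sH degH cH posI pos_lt l0 posH
    isT walk LQ rQ rs Drs kap_gt0 kap1 eta0 eta1 lam01 i0 iota_le link_small types_small half_small
    slack perm_nu perm_g.
have kapg4 : 2 * kap <= gamma / 4 by move: kapg; clear; lra.
have lam_g : 8 * lam <= gamma by move: lnu nug lam_gt0 g0; clear; lra.
have lnu10 : 10 * lam <= nu by move: lnu; clear; lra.
have ltau18 : 8 * lam <= tau1 by move: ltau1; clear; lra.
have ltau2' : dl + 2 * lam <= tau2 by move: ltau2 dl_t2; clear; lra.
have dlt : 4 * dl <= tau2 * iota_ by move: dl_ti; clear; lra.
have bigp : 16 * Delta.+1%:R ^+ 2 <= p * (zeta * N).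
  rewrite mulrA -ler_pdivrMl ?mulr_gt0 // mulrC; exact: le_trans n_p n0N.
have DN : 8 <= Dk * zeta * N.
  by rewrite -ler_pdivrMl ?mulr_gt0 // mulrC; exact: le_trans n_D n0N.
have q1 : Delta.+1%:R * dl + 2 * kap + eta <= Dk / 8.
  have : Dk * eta <= Dk * (1 / 16) by rewrite ler_pM2l.
  by move: dl_e kap_D eta_D Dk0; clear; lra.
have q2 : 1 <= Dk / 8 * (zeta * N) by move: DN; clear; lra.
have q4 : 1 + l%:R <= Dk * eta / 2 * (zeta * N).
  have : bb * N <= Dk * eta * zeta / 4 * N by rewrite ler_pM2r.
  by move: l_le l1; rewrite -/N; clear; lra.
have mbig : 8 * Lh%:R <= gamma * (iota_ * N).
  have := le_trans n_g n0N; rewrite ler_pdivrMr ?(mulr_gt0 g0 i0) // => h1.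
  by apply: le_trans h1 _; rewrite mulrC mulrA.
have pow_big k : tau1 * (iota_ * N) <= k%:R -> 2 * N < 2 ^+ k.
  rewrite mulrA; apply: linear_lt_pow; first by rewrite mulr_gt0.
  by apply: lt_le_trans (le_trans n_t n0N); rewrite ltrDl.
have sees_ok : 4 * dl <= Dk * (lam * nu / 2 * iota_) by move: dl_DL; clear; lra.
exact: (@embed_with_absorbers R V T K G f H c pos d dl zeta gamma nu sigma bad Delta l e0 Lh J0
  kap lam eta iota_ p tau1 tau2 h I lab Z sG iG rb d0 dl0 nu_gt0 g01 V0 min_deg rob' dnu dg dl1 s0 sg
  TV sH iH degH cH posI posH C1 C2 C3 C0 C4 C5 C6 C7 C8 C9 C10 C11 C11' C12 zeta0 kap_gt0 kapg4 kap1
  lam_gt0 eta0 i0 p0 (lexx _) lam_g lnu10 ltau18 stau1 nug ltau2' (lexx _) dl_D dlt dl_Y dl_p bigp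
  q1 q2 dl_e q4 Lh0 LhE tau1E mbig pow_big e0E sees_ok).
Qed.

Theorem theorem1p4 (R : realType) :
  forall (Delta : nat) (gamma : R), 0 < gamma ->
  exists beta : R, 0 < beta /\ exists n0 : nat,
    forall (n : nat) (H G : rel 'I_n), (n0 <= n)%N ->
      simple_graph H -> bipartite H -> max_deg_le H Delta ->
      bandwidth_le H (beta * n%:R) ->
      simple_graph G -> degree_condition G gamma ->
      contains_copy G H.
Proof.
move=> Delta gamma g0; have [g1|g1] := leP gamma 1; last first.
  (* The degree condition would force a minimum degree larger than [n]. *)
  exists 1; split=> //; exists 3 => n H G n3 _ _ _ _ sG dG; exfalso.
  have n0 : (0 < n)%N by apply: leq_trans n3.
  have := degree_condition_min_deg g0 n3 sG dG (Ordinal n0).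
  apply/negP; rewrite -ltNge; apply: (@le_lt_trans _ _ n%:R).
    by rewrite ler_nat (leq_trans (max_card _)) // card_ord.
  by rewrite ltr_pMl // ltr0n.
have g01 : 0 < gamma <= 1 by rewrite g0.
have [sigma [s01 contain]] := robust_expanders_contain Delta g01.
have [nu [nu0 [n1 rob]]] := degree_condition_robust g01 s01.
have [b [b0 [n2 emb]]] := contain nu nu0.
have [n3 /= /andP[n3_lb _]] := nat_upper_bound [:: 2 / b].
exists (b / 2); split; first by rewrite divr_gt0.
exists (maxn 3 (maxn n1 (maxn n2 n3))) => n H G.
rewrite !geq_max => /and4P[n_3 n_1 n_2 n_n3] [sH iH] [c cH] dH [pos [posI posH]] [sG iG] dG.
have b_n : 2 <= b * n%:R.
  by rewrite mulrC -ler_pdivrMr //; apply: le_trans n3_lb _; rewrite ler_nat.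
(* Adding one makes [l] positive and an upper bound for the stretch of every edge; halving [b] in
   the choice of [beta] pays for it. *)
pose l := (Num.truncn (b / 2 * n%:R)).+1.
have bn0 : 0 <= b / 2 * n%:R by rewrite mulr_ge0 // divr_ge0 // ltW.
have /andP[l_le l_gt] := truncn_itv bn0.
have cn := card_ord n.
apply: (emb 'I_n 'I_n G H c (fun u => pos u) l); rewrite ?cn //.
- by move=> u; apply: negbTE.
- by move=> v; apply: degree_condition_min_deg.
- exact: rob.
- by move=> u; apply: negbTE.
- by move=> u v /val_inj /posI.
- by rewrite -natr1; move: l_le b_n; clear; lra.
- move=> u v uv; rewrite -(ler_nat R) natrD.
  have := le_trans (ler_norm _) (posH u v uv).
  by move: l_gt; rewrite -/l; clear; lra.
Qed.
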